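(* Let $V$ be a finite-dimensional vector space over an algebraically closed field of characteristic $0$ and let $k$ be an integer with $3\le k\le \frac{\dim V}{2}$. (1) The orbits $\Sigma_{l,\mathrm{Gr}(k,V)}$ for $l\ge 3$ are the only $\mathrm{SL}(V)$-orbits in $\sigma_2(\mathrm{Gr}(k,V))$ that are identifiable. (2) The orbits $\Theta_{l,\mathrm{Gr}(k,V)}$ for $l\ge 3$ are the only $\mathrm{SL}(V)$-orbits in the tangential variety $\tau(\mathrm{Gr}(k,V))$ that are tangential-identifiable.
   Context: $X=\mathrm{Gr}(k,V)\subset\mathbb P(\bigwedge^kV)$ is the Grassmannian of $k$-dimensional subspaces in its Plücker embedding; $p=[v_1\wedge\dots\wedge v_k]$ corresponds to $H_p=\langle v_1,\dots,v_k\rangle$. $\sigma_2(X)$ is the Zariski closure of the set of points lying in the span of at most two points of $X$. The tangential variety is $\tau(X)=\bigcup_{p\in X}T_pX$, where $T_pX$ is the embedded projective tangent space, whose affine cone is $\hat T_pX=\bigwedge^{k-1}H_p\wedge V$; one has $\hat T_pX/\langle p\rangle\simeq\mathrm{Hom}(H_p,V/H_p)$. The Hamming distance $d(p,q)$ of $p\ne q$ in $X$ is the minimum $r$ for which there exist $p=p_0,\dots,p_r=q$ in $X$ such that each line $\langle p_i,p_{i+1}\rangle$ is contained in $X$. $\Sigma_{l,X}$ ($1\le l\le k$) is the set of points $[u+v]$ with $u,v\in\bigwedge^kV$ nonzero decomposable vectors and $d([u],[v])=l$. $\Theta_{l,X}$ ($1\le l\le k$) is the set of points $[t]\in\tau(X)$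 such that, for some $p\in X$, $t\in\hat T_pX$ and the image of $t$ in $\mathrm{Hom}(H_p,V/H_p)$ is a linear map of rank $l$. All these sets are $\mathrm{SL}(V)$-orbits, and they exhaust the $\mathrm{SL}(V)$-orbits in $\sigma_2(X)$; those in $\tau(X)$ are exactly the $\Theta_{l,X}$; moreover $\Sigma_{1,X}=\Theta_{1,X}=X$ and $\Sigma_{2,X}=\Theta_{2,X}$. The $X$-rank $r_X(p)$ of a point $p$ is the minimum number of points of $X$ whose span contains $p$. A point $p$ of $X$-rank $r$ is identifiable if there is exactly one unordered $r$-tuple of points $p_1,\dots,p_r\in X$ with $p\in\langle p_1,\dots,p_r\rangle$. A point $q\in\tau(X)$ is tangential-identifiable if there is a unique $p\in X$ with $q\in T_pX$. An orbit is (tangential-)identifiable if all its points are.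
   Formalization: In part (1) the orbit Gr(k,V) itself is excluded, since each of its points has rank 1 and is trivially identifiable under the given definition, so the claim that only the orbits Σ_l with l ≥ 3 are identifiable would fail for it. *)

(* Defs.v *)
From HB Require Import structures.
From mathcomp Require Import all_boot all_order all_algebra.
From mathcomp Require Import boolp classical_sets.
From mathcomp Require Import mpoly.

Set Implicit Arguments.
Unset Strict Implicit.
Unset Printing Implicit Defensive.

Import GRing.Theory.
Local Open Scope classical_set_scope.
Local Open Scope ring_scope.

Section Projective.
Variables (K : fieldType) (W : vectType K).

(* P(W) is the set of lines through the origin of W, so the affine cone over a
   point p is [val p] and the span of p and q is [(val p + val q)%VS]. *)
Definition proj := {L : {vspace W} | \dim L == 1%N}.

(* p = [t]; this forces t != 0, since [val p] has dimension 1. *)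
Definition is_pt (p : proj) (t : W) : Prop := val p = <[t]>%VS.

Definition vanishes_at (F : {mpoly K[\dim {:W}]}) (p : proj) : Prop :=
  forall t, t \in val p -> F.@[fun i => coord (vbasis {:W}) i t] = 0.

Definition zariski_closure (S : set proj) : set proj :=
  [set p | forall (d : nat) (F : {mpoly K[\dim {:W}]}), F \is d.-homog ->
     (forall q, S q -> vanishes_at F q) -> vanishes_at F p].

Definition linear_span (S : set W) : set W :=
  [set t | exists2 s : seq W, (forall u, u \in s -> S u) & t \in <<s>>%VS].

Section Variety.
Variable X : set proj.

Definition sigma2 : set proj :=
  zariski_closure [set q | exists p1 p2,
    [/\ X p1, X p2 & (val q <= val p1 + val p2)%VS]].

Definition line_in (p q : proj) : Prop :=
  forall z : proj, (val z <= val p + val q)%VS -> X z.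

(* c_0 = p, ..., c_r = q; the values of c beyond r are irrelevant. *)
Definition line_chain (p q : proj) (r : nat) : Prop :=
  exists c : nat -> proj,
    [/\ c 0%N = p, c r = q, forall i, (i <= r)%N -> X (c i) &
        forall i, (i < r)%N -> c i != c i.+1 /\ line_in (c i) (c i.+1)].

Definition hamming_dist (p q : proj) (r : nat) : Prop :=
  line_chain p q r /\ forall r', line_chain p q r' -> (r <= r')%N.

Definition decomposition (p : proj) (s : seq proj) : Prop :=
  (forall x, x \in s -> X x) /\ (val p <= \sum_(x <- s) val x)%VS.

Definition has_rank (p : proj) (r : nat) : Prop :=
  (exists2 s, size s = r & decomposition p s) /\
  forall s, decomposition p s -> (r <= size s)%N.

(* Unordered r-tuples are sequences of size r up to [perm_eq]. *)
Definition identifiable (p : proj) : Prop :=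
  exists2 r, has_rank p r &
    exists s, [/\ size s = r, decomposition p s &
      forall s', size s' = r -> decomposition p s' -> perm_eq s s'].

End Variety.
End Projective.

Section Grassmannian.
Variables (K : fieldType) (V : vectType K) (k : nat).

Local Notation n := (\dim {:V}).
Local Notation e := (vbasis {:V}).

Definition increasing (I : {ffun 'I_k -> 'I_n}) : bool :=
  [forall i : 'I_k, forall j : 'I_k, (i < j)%N ==> (I i < I j)%N].

Definition multiindex := {I : {ffun 'I_k -> 'I_n} | increasing I}.

(* \bigwedge^k V, through its basis e_I = e_(I 0) /\ ... /\ e_(I (k-1)), where
   e is the reference basis of V and I runs over the increasing multi-indices;
   t I is the coordinate of t along e_I. *)
Definition extpow := {ffun multiindex -> K^o}.

(* v_0 /\ ... /\ v_(k-1): its coordinates are the maximal minors of the matrix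
   of coordinates of the v_i. *)
Definition wedge (v : 'I_k -> V) : extpow :=
  [ffun I : multiindex => \det (\matrix_(i, j) coord e (val I j) (v i))].

(* \bigwedge^k g, the linear map sending e_I to
   g e_(I 0) /\ ... /\ g e_(I (k-1)). *)
Definition extpow_map (g : 'End(V)) (t : extpow) : extpow :=
  \sum_(I : multiindex) t I *: wedge (fun i => g e`_(val I i)).

Definition in_SL (g : 'End(V)) : Prop := \det (passmx.mxof e e g) = 1.

Definition SL_orbit (p : proj extpow) : set (proj extpow) :=
  [set q | exists g t, [/\ in_SL g, is_pt p t & is_pt q (extpow_map g t)]].

Definition is_SL_orbit (O : set (proj extpow)) : Prop :=
  exists p, O = SL_orbit p.

Definition Gr : set (proj extpow) := [set p | exists v, is_pt p (wedge v)].

(* H is the k-dimensional subspace H_p. *)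
Definition is_subspace_of (p : proj extpow) (H : {vspace V}) : Prop :=
  exists2 v : 'I_k -> V, is_pt p (wedge v) & H = (\sum_i <[v i]>)%VS.

(* \bigwedge^(k-1) H /\ V *)
Definition affine_tangent (H : {vspace V}) : set extpow :=
  linear_span [set t | exists (x : 'I_k -> V) (i0 : 'I_k),
    (forall i, i != i0 -> x i \in H) /\ t = wedge x].

Definition tangent (p : proj extpow) : set (proj extpow) :=
  [set q | exists2 H, is_subspace_of p H &
           exists2 t, affine_tangent H t & is_pt q t].

Definition tau : set (proj extpow) :=
  [set q | exists2 p, Gr p & tangent p q].

Definition tangential_identifiable (q : proj extpow) : Prop :=
  exists p, (Gr p /\ tangent p q) /\
    forall p', Gr p' -> tangent p' q -> p' = p.

Definition replace (v : 'I_k -> V) (i : 'I_k) (u : V) : 'I_k -> V :=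
  fun j => if j == i then u else v j.

(* The isomorphism of \hat T_p X / <p> with Hom(H_p, V / H_p), for
   p = [v_0 /\ ... /\ v_(k-1)], is inverse to
     f |-> \sum_i v_0 /\ ... /\ f v_i /\ ... /\ v_(k-1)  modulo p.
   Homomorphisms from H_p to V / H_p are represented by endomorphisms phi of V,
   of which only the restriction to H_p modulo H_p matters. *)
Definition tangent_hom (v : 'I_k -> V) (t : extpow) (phi : 'End(V)) : Prop :=
  t - \sum_i wedge (replace v i (phi (v i))) \in <[wedge v]>%VS.

(* The rank of the map from H to V / H induced by phi, i.e. the dimension of
   its image (phi(H) + H) / H. *)
Definition rank_mod (H : {vspace V}) (phi : 'End(V)) : nat :=
  (\dim (phi @: H + H) - \dim H)%N.

Definition Sigma (l : nat) : set (proj extpow) :=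
  [set q | exists (x y : 'I_k -> V) (p1 p2 : proj extpow),
    [/\ is_pt p1 (wedge x), is_pt p2 (wedge y), hamming_dist Gr p1 p2 l &
        is_pt q (wedge x + wedge y)]].

Definition Theta (l : nat) : set (proj extpow) :=
  [set q | tau q /\ exists (p : proj extpow) (v : 'I_k -> V) (t : extpow) phi,
    let H := (\sum_i <[v i]>)%VS in
    [/\ is_pt p (wedge v), is_pt q t, affine_tangent H t, tangent_hom v t phi &
        rank_mod H phi = l]].

Definition identifiable_orbit (O : set (proj extpow)) : Prop :=
  forall p, O p -> identifiable Gr p.

Definition tangential_identifiable_orbit (O : set (proj extpow)) : Prop :=
  forall q, O q -> tangential_identifiable q.

End Grassmannian.

Arguments Gr {K} V k.
Arguments tau {K} V k.
Arguments Sigma {K} V k l.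
Arguments Theta {K} V k l.

(* Main.v *)
Require Import Defs.
From HB Require Import structures.
From mathcomp Require Import all_boot all_order all_algebra fingroup perm.
From mathcomp Require Import boolp classical_sets.
From mathcomp Require Import mpoly zify ring.

(* Normal forms: if b_0, ..., b_(k+l-1) are independent, a point of Sigma_l is
   [b_0 ^ ... ^ b_(k-1) + b_l ^ ... ^ b_(k+l-1)] and a point of Theta_l is
   [\sum_(i < l) b_0 ^ ... ^ b_(k+i) ^ ... ^ b_(k-1)], with b_(k+i) in position i;
   since GL(V) and SL(V) have the same orbits of points, each of these sets is an
   orbit.

   Uniqueness: an endomorphism with kernel <a> kills a decomposable vector exactly
   when its subspace contains a. Applied to a vector a of the subspace of a summand of
   u + v, or of the subspace of a point of tangency of t, it leaves a decomposable
   vector; this is impossible if l >= 3, unless a belongs to the subspaces prescribed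
   by the normal form.

   Non-uniqueness: for l >= 2 a point t of Theta_l is fixed by all 1 + N, where N maps
   V to H, vanishes on H and satisfies a trace condition. If t had a unique
   decomposition, its finitely many points would be stable under all these maps, hence
   all equal to the point of tangency.

   Closure: a point of sigma_2 is a specialization of the generic secant vector, over
   the field L of rational functions in the entries of two k x n matrices. Chevalley's
   extension of the specialization to a place of L, which is total in the sense that x or
   1/x is finite, shows that the limit is a secant or a tangent vector. *)

Set Implicit Arguments.
Unset Strict Implicit.
Unset Printing Implicit Defensive.

Import GRing.Theory.
Local Open Scope classical_set_scope.
Local Open Scope ring_scope.

(** * Exterior powers *)

(** The threshold l >= 3 comes from two estimates: killing one vector lowers the distance of two
    summands, or the rank of a tangent vector, by at most one; and a sum at distance at least 2, or
    a tangent vector of rank at least 2, is not decomposable. At l = 2 both uniqueness statements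
    fail, since the secant and tangent normal forms then give the same points. Points of the
    Grassmannian have rank one and are identifiable, which is why (1) sets this orbit aside; in (2)
    they drop out by having several points of tangency. The closure is defined by forms over an
    abstract field, where no limits exist. The place stands for the limit, and its totality for the
    compactness of the Grassmannian: some Pluecker coordinate dominates all others. Characteristic 0
    makes the integers distinct in K, for the pigeonhole argument and for separating homogeneous
    parts. Algebraic closedness gives roots of determinants and the common zero in Chevalley's
    extension. The bound 2k <= dim V makes room for k + l independent vectors when l <= k. *)

Section Multilinear.
Variables (K : fieldType) (V : vectType K) (k : nat).
Implicit Types (v : 'I_k -> V) (i j : 'I_k).

Lemma replace_id v i : replace v i (v i) = v.
Proof. by apply: funext => j; rewrite /replace; case: eqP => // ->. Qed.

Lemma replace_eq v i u : replace v i u i = u.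
Proof. by rewrite /replace eqxx. Qed.

Lemma replace_ne v i u j : j != i -> replace v i u j = v j.
Proof. by rewrite /replace => /negPf->. Qed.

Lemma replace2 v i u u' : replace (replace v i u) i u' = replace v i u'.
Proof. by apply: funext => j; rewrite /replace; case: eqP. Qed.

Lemma replaceC v i j u u' : i != j ->
  replace (replace v i u) j u' = replace (replace v j u') i u.
Proof.
move=> ij; apply: funext => m; rewrite /replace.
by case: (m =P j) => // ->; rewrite eq_sym (negPf ij).
Qed.

Lemma lfun_replace (g : 'End(V)) v i u :
  (fun j => g (replace v i u j)) = replace (fun j => g (v j)) i (g u).
Proof. by apply: funext => j; rewrite /replace; case: eqP. Qed.

Definition multilinear (W : lmodType K) (F : ('I_k -> V) -> W) :=
  forall v i (a : K) x y,
    F (replace v i (a *: x + y)) = a *: F (replace v i x) + F (replace v i y).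

Definition alternating (W : lmodType K) (F : ('I_k -> V) -> W) :=
  forall v i j, i != j -> v i = v j -> F v = 0.

Section Theory.
Variables (W : lmodType K) (F : ('I_k -> V) -> W).
Hypothesis F_lin : multilinear F.

Lemma multilinear0 v i : F (replace v i 0) = 0.
Proof.
have /eqP := F_lin v i 1 0 0.
by rewrite scaler0 addr0 scale1r -subr_eq0 opprD addNKr oppr_eq0 => /eqP.
Qed.

Lemma multilinearD v i x y :
  F (replace v i (x + y)) = F (replace v i x) + F (replace v i y).
Proof. by have := F_lin v i 1 x y; rewrite !scale1r. Qed.

Lemma multilinearZ v i a x : F (replace v i (a *: x)) = a *: F (replace v i x).
Proof. by have := F_lin v i a x 0; rewrite !addr0 multilinear0 addr0. Qed.

Lemma multilinear_sum v i (I : Type) (r : seq I) (P : pred I) x :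
  F (replace v i (\sum_(j <- r | P j) x j)) =
  \sum_(j <- r | P j) F (replace v i (x j)).
Proof.
elim/big_rec2: _ => [|j y1 y2 _ <-]; first exact: multilinear0.
exact: multilinearD.
Qed.

Hypothesis F_alt : alternating F.

Lemma alternating_swap v i j x y : i != j ->
  F (replace (replace v i x) j y) = - F (replace (replace v i y) j x).
Proof.
move=> ij.
have zz z : F (replace (replace v i z) j z) = 0.
  by apply: (F_alt ij); rewrite replace_eq replace_ne // replace_eq.
have := zz (x + y).
rewrite multilinearD !(replaceC _ _ _ ij) !multilinearD -!(replaceC _ _ _ ij).
by rewrite !zz addr0 add0r => /eqP; rewrite addrC addr_eq0 => /eqP.
Qed.

Lemma alternating_tperm v i j : i != j -> F (v \o tperm i j) = - F v.
Proof.
move=> ij; have vE : v = replace (replace v i (v i)) j (v j).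
  by rewrite replace_id replace_id.
rewrite [in RHS]vE alternating_swap // opprK.
congr F; apply: funext => m; rewrite /replace /=.
by case: tpermP => [->|->|/eqP/negPf-> /eqP/negPf->//];
  rewrite ?eqxx // (negPf ij).
Qed.

Lemma alternating_perm_eq0 v (s : 'S_k) : F (v \o s) = 0 -> F v = 0.
Proof.
have [ts -> _] := prod_tpermP s.
elim: ts v => [|[i j] ts IH] v; rewrite ?big_nil ?big_cons.
  by move=> <-; congr F; apply: funext => m /=; rewrite perm1.
have [->|ij] := eqVneq i j; first by rewrite tperm1 mul1g; apply: IH.
move=> H; apply: IH.
have := @alternating_tperm (v \o (\prod_(t <- ts) tperm t.1 t.2)%g) _ _ ij.
rewrite -[LHS](_ : F (v \o (tperm i j * \prod_(t <- ts) tperm t.1 t.2)%g) = _).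
  by rewrite H => /eqP; rewrite eq_sym oppr_eq0 => /eqP.
by congr F; apply: funext => m /=; rewrite permM.
Qed.

End Theory.

Local Notation n := (\dim {:V}).
Local Notation e := (vbasis {:V}).

(** Sort the values of [f]; injectivity makes the sorted sequence strictly increasing. *)
Lemma increasing_perm (f : {ffun 'I_k -> 'I_n}) : injective f ->
  exists s : 'S_k, increasing (V := V) [ffun i => f (s i)].
Proof.
move=> f_inj; pose t := [tuple f i | i < k]; pose le := fun i j : 'I_n => (i <= j)%N.
have /tuple_permP[s ts] : perm_eq (sort le t) t by rewrite perm_sort.
exists s; apply/forallP=> i; apply/forallP=> j; apply/implyP=> ij; rewrite !ffunE.
have st : sorted (fun i j : 'I_n => (i < j)%N) (sort le t).
  rewrite -[sorted _ _](sorted_map (f := @nat_of_ord n) (e' := ltn)).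
  rewrite ltn_sorted_uniq_leq sorted_map.
  rewrite (sort_sorted (_ : total le)) ?andbT; last by move=> ? ?; apply: leq_total.
  rewrite (map_inj_uniq (@ord_inj n)) sort_uniq map_inj_uniq //; exact: enum_uniq.
have nt m : f (s m) = nth (f m) (sort le t) m.
  by rewrite ts -tnth_nth tnth_mktuple tnth_mktuple.
rewrite !nt (set_nth_default (f j)) ?size_sort ?size_tuple //.
apply: (sorted_ltn_nth _ _ st) => //; rewrite ?inE ?size_sort ?size_tuple //.
by move=> ? ? ? /ltn_trans H /H.
Qed.

Lemma increasing_inj (f : {ffun 'I_k -> 'I_n}) :
  increasing f -> injective f.
Proof.
move=> /forallP f_inc i j fij; apply: val_inj; case: (ltngtP i j) => // ij.
  by have /forallP/(_ j) := f_inc i; rewrite ij fij ltnn.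
by have /forallP/(_ i) := f_inc j; rewrite ij fij ltnn.
Qed.

(** A strictly increasing sequence is determined by its set of values, and both sets have [k]
    elements, so that the inclusion is an equality. *)
Lemma increasing_codom_eq (f g : {ffun 'I_k -> 'I_n}) :
  increasing f -> increasing g -> (forall i, exists j, f i = g j) -> f = g.
Proof.
move=> f_inc g_inc fg.
have inc (h : {ffun 'I_k -> 'I_n}) : increasing (V := V) h ->
    sorted (fun i j : 'I_n => (i < j)%N) (codom h).
  move=> /forallP h_inc; rewrite sorted_map.
  have := iota_ltn_sorted 0 k; rewrite -val_enum_ord sorted_map.
  apply: sub_sorted => i j ij.
  by have /forallP/(_ j)/implyP := h_inc i; apply.
have sub : {subset codom f <= codom g}.
  by move=> _ /codomP[i ->]; have [j ->] := fg i; apply: codom_f.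
have ufg (h : {ffun 'I_k -> 'I_n}) : increasing (V := V) h -> uniq (codom h).
  by move=> h_inc; rewrite (map_inj_uniq (@increasing_inj _ h_inc)) enum_uniq.
have [|_ mem] := uniq_min_size (ufg _ f_inc) sub; first by rewrite !size_codom.
have eq_cod : codom f = codom g.
  apply: (irr_sorted_eq _ _ (inc _ f_inc) (inc _ g_inc)) => //.
  - by move=> ? ? ? /ltn_trans H /H.
  - by move=> ?; rewrite ltnn.
by apply/ffunP=> i; move/eq_in_map: eq_cod; apply; rewrite mem_enum.
Qed.

(* Multilinearity reduces to basis vectors, and alternation to an increasing
   family of them. *)
Lemma alternating_eq0 (W : lmodType K) (F : ('I_k -> V) -> W) :
  multilinear F -> alternating F ->
  (forall I : multiindex V k, F (fun i => e`_(val I i)) = 0) -> forall v, F v = 0.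
Proof.
move=> F_lin F_alt F0.
have F_basis (f : {ffun 'I_k -> 'I_n}) : F (fun i => e`_(f i)) = 0.
  have [/injectiveP f_inj|/injectivePn[i [j ij fij]]] := boolP (injectiveb f);
    last by apply: (F_alt _ _ _ ij); rewrite fij.
  have [s s_inc] := increasing_perm f_inj.
  apply: (alternating_perm_eq0 F_lin F_alt (s := s)).
  by rewrite -(F0 (Sub _ s_inc : multiindex V k)); congr F; apply: funext => i /=; rewrite ffunE.
(* Induction on the number of leading slots still holding arbitrary vectors; slot [m] is expanded in
   the basis [e]. *)
suff main m : (m <= k)%N -> forall v,
    (forall i, (m <= i)%N -> exists j : 'I_n, v i = e`_j) -> F v = 0.
  by move=> v; apply: (main k) => // i; rewrite leqNgt ltn_ord.
elim: m => [_ v v_e|m IH mk v v_e].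
  have [f fE] := choice (fun i => v_e i isT).
  rewrite -(F_basis [ffun i => f i]); congr F.
  by apply: funext => i; rewrite ffunE fE.
rewrite -(replace_id v (Ordinal mk)) (coord_vbasis (memvf (v _))).
rewrite multilinear_sum // big1 // => j _.
rewrite multilinearZ // IH ?scaler0 ?(ltnW mk) // => i mi.
have [->|im] := eqVneq i (Ordinal mk); first by exists j; rewrite replace_eq.
rewrite replace_ne //; apply: v_e; rewrite ltn_neqAle mi andbT.
by apply: contra im => /eqP mi'; apply/eqP/val_inj.
Qed.

Lemma wedge_multilinear : multilinear (@wedge K V k).
Proof.
move=> v i a x y; apply/ffunP => I; rewrite !ffunE.
rewrite -[\det _ in X in _ = _ + X]mul1r; apply: (determinant_multilinear (i0 := i)).
- by apply/rowP=> j; rewrite !mxE !replace_eq linearP mul1r.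
- by apply/matrixP=> m j; rewrite !mxE !replace_ne // eq_sym neq_lift.
- by apply/matrixP=> m j; rewrite !mxE !replace_ne // eq_sym neq_lift.
Qed.

Lemma wedge_alternating : alternating (@wedge K V k).
Proof.
move=> v i j ij vij; apply/ffunP => I; rewrite !ffunE.
by apply: (determinant_alternate ij) => m; rewrite !mxE vij.
Qed.

Lemma wedge_basis (I J : multiindex V k) :
  wedge (fun i => e`_(val I i)) J = (I == J)%:R.
Proof.
rewrite ffunE; have efree := basis_free (vbasisP {:V}).
have [<-|neqIJ] := eqVneq I J.
  rewrite -[RHS](det1 _ k); congr (\det _); apply/matrixP => i j.
  rewrite !mxE coord_free // (inj_eq (@increasing_inj _ (valP I))).
  by rewrite eq_sym.
have [i Hi] : exists i, forall j, val I i != val J j.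
  apply: contrapT => /forallNP H; case/eqP: neqIJ; apply: val_inj.
  apply: increasing_codom_eq (valP I) (valP J) _ => i; apply: contrapT.
  by move=> /forallNP H'; apply: (H i) => j; apply/eqP.
(* The value [I i] is missed by [J], so row [i] of the minor vanishes. *)
apply/eqP/det0P; exists (delta_mx 0 i).
  by apply/eqP => /matrixP/(_ 0 i); rewrite !mxE !eqxx; apply/eqP/oner_neq0.
apply/rowP=> j; rewrite -rowE !mxE coord_free //.
by rewrite (negPf (Hi j)).
Qed.

(** The universal property of the exterior power: the difference of the two sides is again
    alternating and vanishes on increasing families of basis vectors. *)
Lemma alternating_wedge (W : lmodType K) (F : ('I_k -> V) -> W) v :
  multilinear F -> alternating F ->
  F v = \sum_I (wedge v I : K) *: F (fun i => e`_(val I i)).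
Proof.
move=> F_lin F_alt; apply/eqP; rewrite -subr_eq0; apply/eqP.
pose G v := F v - \sum_I (wedge v I : K) *: F (fun i => e`_(val I i)).
apply: (alternating_eq0 (F := G)) => [{}v i a x y|{}v i j ij vij|J]; rewrite /G.
- rewrite F_lin wedge_multilinear scalerBr addrACA -opprD; congr (_ + - _).
  rewrite scaler_sumr -big_split; apply: eq_bigr => I _ /=.
  by rewrite !ffunE scalerDl scalerA.
- rewrite (F_alt _ _ _ ij) // sub0r big1 ?oppr0 // => I _.
  by rewrite (wedge_alternating ij) // ffunE scale0r.
- rewrite (bigD1 J) //= wedge_basis eqxx scale1r big1 ?addr0 ?subrr // => I.
  by rewrite wedge_basis eq_sym => /negPf->; rewrite scale0r.
Qed.

End Multilinear.

(** * Induced maps and derivations *)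

Section Functoriality.
Variables (K : fieldType) (V : vectType K) (k : nat).
Implicit Types (v : 'I_k -> V) (g phi : 'End(V)) (t : extpow V k).

Local Notation e := (vbasis {:V}).

Lemma extpow_map_is_linear g : linear (@extpow_map K V k g).
Proof.
move=> a s t; rewrite /extpow_map scaler_sumr -big_split.
by apply: eq_bigr => I _; rewrite !ffunE scalerDl scalerA.
Qed.

HB.instance Definition _ g :=
  GRing.isLinear.Build K (extpow V k) (extpow V k) _ (@extpow_map K V k g)
    (extpow_map_is_linear g).

Lemma extpow_map_wedge g v : extpow_map g (wedge v) = wedge (fun i => g (v i)).
Proof.
symmetry; apply: (alternating_wedge (F := fun v => wedge (fun i => g (v i)))).
  by move=> {}v i a x y; rewrite !lfun_replace linearP wedge_multilinear.
by move=> {}v i j ij vij; apply: (wedge_alternating ij); rewrite vij.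
Qed.

Definition tangent_vec v phi : extpow V k :=
  \sum_i wedge (replace v i (phi (v i))).

Lemma tangent_vec_multilinear phi : multilinear (tangent_vec ^~ phi).
Proof.
move=> v i a x y; rewrite /tangent_vec scaler_sumr -big_split.
apply: eq_bigr => j _ /=; have [->|ji] := eqVneq j i.
  by rewrite !replace2 !replace_eq linearP wedge_multilinear.
rewrite !(replace_ne _ _ ji) !(replaceC _ _ _ (_ : i != j)) 1?eq_sym //.
exact: wedge_multilinear.
Qed.

(** If two entries of [v] agree, the terms that replace neither of them vanish, and the remaining
    two differ by a transposition and cancel. *)
Lemma tangent_vec_alternating phi : alternating (tangent_vec ^~ phi).
Proof.
move=> v i j ij vij; rewrite /tangent_vec (bigD1 i) //= (bigD1 j) 1?eq_sym //=.
rewrite big1 ?addr0 => [|m /andP[mi mj]]; last first.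
  by apply: (wedge_alternating ij); rewrite !replace_ne // eq_sym.
have -> : replace v i (phi (v i)) = replace (replace v i (phi (v i))) j (v i).
  by rewrite replaceC // [in RHS]vij replace_id vij.
have -> : replace v j (phi (v j)) = replace (replace v i (v i)) j (phi (v i)).
  by rewrite replace_id vij.
by rewrite (alternating_swap (@wedge_multilinear K V k) (@wedge_alternating K V k))
  ?addNr.
Qed.

(* [tangent_vec v phi] depends only on [wedge v]: it is the derivation of the
   exterior algebra extending [phi]. *)
Lemma tangent_vecZ phi v u a : wedge v = a *: wedge u ->
  tangent_vec v phi = a *: tangent_vec u phi.
Proof.
move=> vu; have E w := alternating_wedge w (tangent_vec_multilinear phi)
                         (tangent_vec_alternating phi).
rewrite !E vu scaler_sumr; apply: eq_bigr => I _.
by rewrite ffunE scalerA.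
Qed.

Lemma tangent_vecP v a phi psi :
  tangent_vec v (a *: phi + psi) = a *: tangent_vec v phi + tangent_vec v psi.
Proof.
rewrite /tangent_vec scaler_sumr -big_split; apply: eq_bigr => i _ /=.
by rewrite -wedge_multilinear add_lfunE scale_lfunE.
Qed.

Lemma extpow_map_scale a g t :
  extpow_map (a *: g) t = a ^+ k *: extpow_map g t.
Proof.
rewrite /extpow_map scaler_sumr; apply: eq_bigr => I _.
rewrite scalerA mulrC -scalerA; congr (_ *: _); apply/ffunP => J.
rewrite !ffunE -[RHS]detZ; congr (\det _); apply/matrixP => i j.
by rewrite !mxE scale_lfunE linearZ.
Qed.

Lemma wedge_comp (A : 'M[K]_k) (u : 'I_k -> V) v :
  (forall i, v i = \sum_j A i j *: u j) -> wedge v = \det A *: wedge u.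
Proof.
move=> vE; apply/ffunP => I; rewrite !ffunE -[RHS]det_mulmx; congr (\det _).
apply/matrixP => i j; rewrite !mxE vE linear_sum; apply: eq_bigr => m _.
by rewrite !mxE linearZ.
Qed.

End Functoriality.

(** * Points of a projective space and their representatives *)

Section Points.
Variables (K : fieldType) (W : vectType K).
Implicit Types (p q : proj W) (s t : W).

Lemma is_pt_neq0 p t : is_pt p t -> t != 0.
Proof.
move=> pt; apply/eqP => t0; have := valP p.
by rewrite (_ : \val p = <[t]>%VS) // t0 dim_vline eqxx.
Qed.

Lemma is_pt_exists t : t != 0 -> exists p, is_pt p t.
Proof.
move=> t0; have d1 : \dim <[t]> == 1%N by rewrite dim_vline t0.
by exists (exist _ <[t]>%VS d1).
Qed.

Lemma is_pt_inj p q t : is_pt p t -> is_pt q t -> p = q.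
Proof. by move=> pt qt; apply: val_inj; rewrite pt qt. Qed.

Lemma vline_scale a t : a != 0 -> <[a *: t]>%VS = <[t]>%VS.
Proof.
move=> a0; apply/eqP; rewrite eqEsubv -!memvE; apply/andP; split.
  by rewrite memvZ ?memv_line.
by rewrite -[t in t \in _](scalerK a0) memvZ ?memv_line.
Qed.

Lemma is_ptZ p a t : a != 0 -> is_pt p (a *: t) <-> is_pt p t.
Proof. by move=> a0; rewrite /is_pt vline_scale. Qed.

Lemma is_pt_scale p s t : is_pt p s -> is_pt p t ->
  exists2 a, a != 0 & s = a *: t.
Proof.
move=> ps pt; have /vlineP[a sE] : s \in <[t]>%VS by rewrite -pt ps memv_line.
exists a => //; apply/eqP => a0; have := is_pt_neq0 ps.
by rewrite sE a0 scale0r eqxx.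
Qed.

Lemma is_pt_mem p t : t \in val p -> t != 0 -> is_pt p t.
Proof.
move=> tp t0; apply/esym/eqP; rewrite eqEdim -memvE tp dim_vline t0.
by rewrite (eqP (valP p)).
Qed.

Lemma is_pt_ex p : exists t, is_pt p t.
Proof.
have p0 : val p != 0%VS by rewrite -dimv_eq0 (eqP (valP p)).
by exists (vpick (val p)); apply: is_pt_mem; rewrite ?memv_pick ?vpick0.
Qed.

End Points.

Section KillSubspace.
Variables (K : fieldType) (V : vectType K).
Implicit Types (U H : {vspace V}).

(** The quotient map to [V / U], realized inside [V] as the projection with kernel [U] onto a
    complement, so that images stay in the same exterior power. *)
Definition quot_end U : 'End(V) := (\1 - projv U)%VF.

Lemma lker_quot_end U : lker (quot_end U) = U.
Proof.
apply/vspaceP => u; rewrite memv_ker add_lfunE opp_lfunE id_lfunE subr_eq0.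
apply/eqP/idP => [->|uU]; last by rewrite projv_id.
exact: memv_proj.
Qed.

Lemma limg_subv_ker (g : 'End(V)) U H :
  (g @: U <= g @: H)%VS -> (U <= H + lker g)%VS.
Proof.
move=> /subvP sub; apply/subvP => u uU.
have /memv_imgP[h hH gu] := sub _ (memv_img g uU).
rewrite -[u](subrK h) addrC memv_add // memv_ker linearB /= gu.
by rewrite subrr.
Qed.

End KillSubspace.

(** * Decomposable vectors and their subspaces *)

Section WedgeSpan.
Variables (K : fieldType) (V : vectType K) (k : nat).
Implicit Types (v u x y z : 'I_k -> V).

Local Notation e := (vbasis {:V}).

Definition spanv v : {vspace V} := (\sum_i <[v i]>)%VS.

Lemma mem_spanv v i : v i \in spanv v.
Proof. by rewrite /spanv (bigD1 i) //= memvE addvSl. Qed.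

Lemma spanvP v (a : V) :
  a \in spanv v -> exists c : 'I_k -> K, a = \sum_i c i *: v i.
Proof.
move=> /memv_sumP[w wv ->].
have /choice[c cE] : forall i, exists c, w i = c *: v i.
  by move=> i; have /vlineP := wv i isT.
by exists c; apply: eq_bigr => i _.
Qed.

Lemma spanv_sub v (U : {vspace V}) : (forall i, v i \in U) -> (spanv v <= U)%VS.
Proof. by move=> vU; apply/subv_sumP => i _; rewrite -memvE. Qed.

Lemma spanv_seq v : spanv v = <<[tuple v i | i < k]>>%VS.
Proof. by rewrite span_def big_tuple; apply: eq_bigr => i _; rewrite tnth_mktuple. Qed.

Lemma dim_spanv v : (\dim (spanv v) <= k)%N.
Proof. by rewrite spanv_seq (leq_trans (dim_span _)) // size_tuple. Qed.

Lemma spanv_lfun v (c : 'I_k -> V) : \dim (spanv v) = k ->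
  exists g : 'End(V), forall i, g (v i) = c i.
Proof.
move=> dv; have v_free : free [tuple v i | i < k] by rewrite /free -spanv_seq dv size_tuple.
have [f fE] := linear_of_free [tuple v i | i < k] [tuple c i | i < k].
exists (linfun f) => i.
have := fE v_free; rewrite !size_tuple => /(_ erefl) /(congr1 (nth 0 ^~ i)).
by rewrite (nth_map 0) ?size_tuple // -!(tnth_nth 0 (mktuple _)) !tnth_mktuple lfunE.
Qed.

Lemma limg_spanv (g : 'End(V)) v : (g @: spanv v)%VS = spanv (fun i => g (v i)).
Proof. by rewrite limg_sum; apply: eq_bigr => i _; rewrite limg_line. Qed.

Lemma wedge_spanv v u : (forall i, v i \in spanv u) ->
  exists a, wedge v = a *: wedge u.
Proof.
move=> vu; have /choice[c cE] := fun i => spanvP (vu i).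
exists (\det (\matrix_(i, j) c i j)); apply: wedge_comp => i; rewrite cE.
by apply: eq_bigr => j _; rewrite mxE.
Qed.

(** In dimension [k] an endomorphism carries [v] to the first [k] basis vectors, whose wedge has a
    coordinate equal to 1. In smaller dimension the [v i] are combinations of fewer than [k]
    vectors, padded by zeros, and the coefficient matrix has a zero column. *)
Lemma wedge_eq0 v : (wedge v == 0) = (\dim (spanv v) < k)%N.
Proof.
rewrite ltn_neqAle dim_spanv andbT; apply/idP/idP => [|dk].
  apply: contraL => /eqP dk.
  have kn : (k <= \dim {:V})%N by rewrite -[X in (X <= _)%N]dk dimvS ?subvf.
  pose I : {ffun 'I_k -> 'I_(\dim {:V})} := [ffun i => widen_ord kn i].
  have I_inc : increasing (V := V) I.
    apply/forallP=> i; apply/forallP=> j; apply/implyP=> ij; rewrite !ffunE; exact: ij.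
  have [f fE] := spanv_lfun (fun i => e`_(I i)) dk.
  apply/eqP => w0; have := extpow_map_wedge f v.
  rewrite w0 linear0 => /ffunP/(_ (Sub _ I_inc)) /eqP.
  rewrite (_ : (fun i => _) = fun i => e`_(I i)); last exact: funext.
  by rewrite (wedge_basis (Sub _ I_inc : multiindex V k)) eqxx ffunE eq_sym oner_eq0.
set U := spanv v in dk *; pose d := \dim U.
have dk' : (d < k)%N by rewrite ltn_neqAle dk dim_spanv.
pose b (i : 'I_k) : V := if (i < d)%N then (vbasis U)`_i else 0.
pose A := \matrix_(i < k, j < k)
  (if insub (j : nat) is Some j' then coord (vbasis U) (j' : 'I_d) (v i) else 0).
have -> : wedge v = \det A *: wedge b.
  apply: wedge_comp => i; rewrite [LHS](coord_vbasis (mem_spanv v i)).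
  pose F j := (if insub j is Some j' then
    coord (vbasis U) (j' : 'I_d) (v i) else 0) *: (vbasis U)`_j.
  transitivity (\sum_(j < d) F j); first by apply: eq_bigr => j _; rewrite /F valK.
  rewrite (big_ord_widen k F (ltnW dk')) big_mkcond.
  by apply: eq_bigr => j _; rewrite !mxE /b /F; case: ltnP => // dj; rewrite scaler0.
suff -> : \det A = 0 by rewrite scale0r.
rewrite (expand_det_col _ (Ordinal dk')) big1 // => i _.
by rewrite mxE insubF ?mul0r // ltnn.
Qed.

Lemma wedge_neq0 v : (wedge v != 0) = (\dim (spanv v) == k).
Proof. by rewrite wedge_eq0 -leqNgt eqn_leq dim_spanv. Qed.

Lemma dim_wedge v : wedge v != 0 -> \dim (spanv v) = k.
Proof. by rewrite wedge_neq0 => /eqP. Qed.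

Lemma wedge_same_span v u : wedge v != 0 -> spanv v = spanv u ->
  exists2 a, a != 0 & wedge v = a *: wedge u.
Proof.
move=> v0 vu; have [|a aE] := @wedge_spanv v u; first by move=> i; rewrite -vu mem_spanv.
by exists a => //; apply: contra v0 => /eqP a0; rewrite aE a0 scale0r.
Qed.

Lemma dim_limg_quot (a : V) (U : {vspace V}) : a != 0 ->
  \dim (quot_end <[a]> @: U) = (\dim U - (a \in U))%N.
Proof.
move=> a0; have := limg_ker_dim (quot_end <[a]>) U; rewrite lker_quot_end => <-.
have [aU|aU] := boolP (a \in U).
  by rewrite (capv_idPr _) -?memvE // dim_vline a0 addKn.
suff -> : (U :&: <[a]>)%VS = 0%VS by rewrite dimv0 add0n subn0.
apply/eqP; rewrite -subv0; apply/subvP => u /memv_capP[uU /vlineP[c uE]].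
rewrite memv0; apply: contraNT aU => u0.
have c0 : c != 0 by apply: contra u0 => /eqP c0; rewrite uE c0 scale0r.
by rewrite -(scalerK c0 a) -uE memvZ.
Qed.

Lemma quot_wedge_eq0 v a : wedge v != 0 -> a != 0 ->
  (extpow_map (quot_end <[a]>) (wedge v) == 0) = (a \in spanv v).
Proof.
move=> /dim_wedge dv a0; rewrite extpow_map_wedge wedge_eq0 -limg_spanv.
rewrite dim_limg_quot // dv; have [av|] := boolP (_ \in _); last by rewrite subn0 ltnn.
have v0 : (0 < \dim (spanv v))%N.
  by rewrite lt0n dimv_eq0; apply: contraTneq av => ->; rewrite memv0.
by rewrite subn1 ltn_predL -dv v0.
Qed.

(** Whether [z] lies in the subspace is decided by whether killing [z] kills the decomposable
    vector, a test that scaling does not affect. *)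
Lemma wedge_scale_span v u a : wedge v != 0 -> wedge v = a *: wedge u ->
  spanv v = spanv u.
Proof.
move=> v0 vu; have a0 : a != 0 by apply: contra v0 => /eqP a0; rewrite vu a0 scale0r.
have u0 : wedge u != 0 by apply: contra v0 => /eqP u0; rewrite vu u0 scaler0.
apply/vspaceP => z; have [->|z0] := eqVneq z 0; first by rewrite !mem0v.
by rewrite -!quot_wedge_eq0 // vu linearZ /= scaler_eq0 (negPf a0).
Qed.

Lemma wedge_scale (i : 'I_k) v a : a *: wedge v = wedge (replace v i (a *: v i)).
Proof. by rewrite (multilinearZ (@wedge_multilinear K V k)) replace_id. Qed.

(** If the subspace of [z] contains some [a] outside that of [x], killing [a] makes the images of
    [wedge x] and [wedge y] opposite, so the subspaces of [x] and [y] agree modulo [a] and their sum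
    has dimension at most [k + 1]. If neither [x] nor [y] admits such an [a], all three subspaces
    coincide. *)
Lemma dim_cap_decomposable x y z : wedge x != 0 -> wedge y != 0 ->
  wedge x + wedge y = wedge z -> (k <= (\dim (spanv x :&: spanv y)).+1)%N.
Proof.
move=> x0 y0 xyz; have [z0|z0] := eqVneq (wedge z) 0.
  apply: leqW; rewrite (@wedge_scale_span x y (-1)) ?capvv ?dim_wedge // scaleN1r.
  by apply/eqP; rewrite -addr_eq0 xyz z0.
suff main x' y' : wedge x' != 0 -> wedge y' != 0 -> wedge x' + wedge y' = wedge z ->
    ~~ (spanv z <= spanv x')%VS -> (k <= (\dim (spanv x' :&: spanv y')).+1)%N.
  have [zx|] := boolP (spanv z <= spanv x)%VS; last exact: main.
  have [zy|] := boolP (spanv z <= spanv y)%VS; last first.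
    by rewrite capvC; apply: main; rewrite // addrC.
  apply: leqW; rewrite -[X in (X <= _)%N](dim_wedge z0) dimvS // subv_cap zx.
  exact: zy.
move=> {}x0 {}y0 {}xyz /subvPn[a az ax].
have a0 : a != 0 by apply: contra ax => /eqP->; rewrite mem0v.
have := congr1 (extpow_map (quot_end <[a]>)) xyz; rewrite linearD /=.
have /eqP-> : extpow_map (quot_end <[a]>) (wedge z) == 0 by rewrite quot_wedge_eq0.
move=> /eqP; rewrite addr_eq0 => /eqP gxy.
have gx0 : extpow_map (quot_end <[a]>) (wedge x') != 0 by rewrite quot_wedge_eq0.
move: gxy gx0; rewrite !extpow_map_wedge -scaleN1r => gxy gx0.
have := wedge_scale_span gx0 gxy; rewrite -!limg_spanv => gE.
have /limg_subv_ker : (quot_end <[a]> @: spanv y' <= quot_end <[a]> @: spanv x')%VS.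
  by rewrite gE.
rewrite lker_quot_end => sub.
have := dimv_sum_cap (spanv x') (spanv y'); rewrite !dim_wedge //.
have : (\dim (spanv x' + spanv y') <= k.+1)%N.
  apply: (@leq_trans (\dim (spanv x' + <[a]>))).
    by rewrite dimvS // subv_add addvSl.
  rewrite (leq_trans (dimv_add_leqif _ _)) // dim_vline a0 (dim_wedge x0).
  by rewrite addn1.
by lia.
Qed.

End WedgeSpan.

(** * Orbits *)

Section Families.
Variables (K : fieldType) (V : vectType K).
Implicit Types (b c : nat -> V) (g : 'End(V)) (m : nat).

Local Notation e := (vbasis {:V}).

(** Families are functions on [nat] of which only an initial segment matters; extending or shifting
    one involves no change of type. *)
Definition indep m b := free (mkseq b m).

Lemma eq_indep m b c : (forall i, (i < m)%N -> b i = c i) -> indep m b = indep m c.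
Proof.
move=> bc; congr free; apply/eq_in_map => i; rewrite mem_iota => /andP[_ im].
exact: bc.
Qed.

Lemma indep_span m b : indep m b = (\dim <<mkseq b m>> == m).
Proof. by rewrite /indep /free size_mkseq. Qed.

Lemma indepW m m' b : (m' <= m)%N -> indep m b -> indep m' b.
Proof.
move=> le; rewrite /indep /mkseq -(subnKC le) iotaD map_cat.
exact: catl_free.
Qed.

Lemma indep_map m b (s : seq nat) : indep m b -> uniq s ->
  (forall i, i \in s -> (i < m)%N) -> free (map b s).
Proof.
move=> b_free s_uniq s_m; have : perm_eq (s ++ [seq i <- iota 0 m | i \notin s]) (iota 0 m).
  apply: uniq_perm; rewrite ?iota_uniq // ?cat_uniq ?s_uniq ?filter_uniq ?iota_uniq //.
    by rewrite andbT; apply/hasPn => i; rewrite mem_filter => /andP[].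
  move=> i; rewrite mem_cat mem_filter mem_iota add0n.
  by case: (boolP (i \in s)) => // /s_m ->.
move=> /(perm_map b)/perm_free; rewrite map_cat [X in _ = X]b_free.
exact: catl_free.
Qed.

Lemma indep_comp m m' b (f : nat -> nat) : indep m b ->
  {in [pred i | i < m']%N &, injective f} -> (forall i, (i < m')%N -> (f i < m)%N) ->
  indep m' (fun i => b (f i)).
Proof.
move=> b_free f_inj fm; rewrite /indep /mkseq map_comp.
apply: (indep_map b_free) => [|_ /mapP[i + ->]]; last by rewrite mem_iota => /fm.
by rewrite map_inj_in_uniq ?iota_uniq // => i j; rewrite !mem_iota; apply: f_inj.
Qed.

Lemma indep_extend m b : indep m b ->
  exists B, indep (\dim {:V}) B /\ forall i, (i < m)%N -> B i = b i.
Proof.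
move=> b_free; pose X := mkseq b m; pose C := (<<X>>^C)%VS.
have s_basis : basis_of fullv (X ++ vbasis C).
  rewrite -(addv_complf <<X>>); apply: cat_basis; last exact: vbasisP.
    by apply/directv_addP; rewrite capv_compl.
  by rewrite basisEfree subvv dim_span -/(indep m b) b_free.
exists (nth 0 (X ++ vbasis C)); split.
  rewrite /indep -[X in mkseq _ X](_ : size (X ++ vbasis C) = _) ?mkseq_nth.
    exact: basis_free s_basis.
  by rewrite -(span_basis s_basis); apply/esym/eqP/(basis_free s_basis).
by move=> i im; rewrite nth_cat size_mkseq im nth_mkseq.
Qed.

Lemma indep_leq m b : indep m b -> (m <= \dim {:V})%N.
Proof. by rewrite indep_span => /eqP <-; rewrite dimvS ?subvf. Qed.

Lemma indep_lfun m b c : indep m b ->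
  exists g : 'End(V), forall i, (i < m)%N -> g (b i) = c i.
Proof.
move=> b_free; have [f fE] := linear_of_free (mkseq b m) (mkseq c m).
exists (linfun f) => i im; rewrite lfunE /=.
have := fE b_free; rewrite !size_mkseq => /(_ erefl)/(congr1 (nth 0 ^~ i)).
by rewrite (nth_map 0) ?size_mkseq // !nth_mkseq.
Qed.

Lemma span_lfun m b g : <<mkseq (fun i => g (b i)) m>>%VS = (g @: <<mkseq b m>>)%VS.
Proof. by rewrite limg_span /mkseq -map_comp. Qed.

Lemma indep_lker m b g : indep m b -> (<<mkseq b m>> :&: lker g = 0)%VS ->
  indep m (fun i => g (b i)).
Proof. by rewrite !indep_span span_lfun => bm /limg_dim_eq ->. Qed.

Lemma indep_auto m b c : indep m b -> indep m c ->
  exists g : 'End(V), lker g == 0%VS /\ forall i, (i < m)%N -> g (b i) = c i.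
Proof.
move=> b_free c_free; have mn := indep_leq b_free.
have [B [B_free Bb]] := indep_extend b_free.
have [C [C_free Cc]] := indep_extend c_free.
have [g gE] := indep_lfun C B_free.
exists g; split => [|i im]; last by rewrite -Bb // gE ?Cc // (leq_trans im).
have Bf : <<mkseq B (\dim {:V})>>%VS = fullv.
  by apply/eqP; rewrite eqEdim subvf; rewrite (eqP (_ : \dim <<_>>%VS == \dim {:V})) ?leqnn // -indep_span.
rewrite -dimv_eq0 -(capfv (lker g)) -(eqn_add2r (\dim (g @: fullv))) add0n.
rewrite limg_ker_dim -{2}Bf -span_lfun.
suff : indep (\dim {:V}) (fun i => g (B i)) by rewrite indep_span eq_sym.
by rewrite (@eq_indep _ _ C).
Qed.

Lemma lker_in_SL g : in_SL g -> lker g == 0%VS.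
Proof.
move=> detg; have e_basis := vbasisP {:V}.
have g_unit : passmx.mxof e e g \in unitmx by rewrite unitmxE detg unitr1.
rewrite -subv0; apply/subvP => u; rewrite memv_ker => /eqP gu.
have /eqP := passmx.rVof_app e e_basis g u; rewrite gu.
have /eqP-> : passmx.rVof e (0 : V) == 0 by rewrite passmx.rVof_eq0.
rewrite eq_sym => /eqP uM; rewrite memv0 -(passmx.rVof_eq0 e_basis).
by rewrite -[X in X == _](mulmxK g_unit) uM mul0mx.
Qed.

Lemma det_mxof_neq0 g : lker g == 0%VS -> \det (passmx.mxof e e g) != 0.
Proof.
move=> /lker0_compfV/(congr1 (passmx.mxof e e)).
rewrite (passmx.mxof_comp _ _ (vbasisP {:V})) passmx.mxof1 ?(basis_free (vbasisP _)) //.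
move=> /(congr1 determinant); rewrite det_mulmx det1 => /eqP; apply: contraTneq => ->.
by rewrite mulr0 eq_sym oner_eq0.
Qed.

End Families.

Section Orbits.
Variables (K : closedFieldType) (V : vectType K) (k : nat).
Hypothesis V_gt0 : (0 < \dim {:V})%N.
Implicit Types (b c : nat -> V) (g : 'End(V)) (m : nat).

Local Notation e := (vbasis {:V}).

Lemma closed_root_ex m (a : K) : (0 < m)%N -> exists z, z ^+ m = a.
Proof.
move=> m0; have [z zE] := solve_monicpoly (fun i => if i == 0%N then a else 0) m0.
exists z; rewrite zE; case: m m0 {zE} => // m _.
by rewrite big_ord_recl /= expr0 mulr1 big1 ?addr0 // => i _; rewrite mul0r.
Qed.

(** The scalar is an n-th root of the inverse determinant, n being the dimension of [V]; this passes
    from GL-orbits to SL-orbits. *)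
Lemma SL_scale g : lker g == 0%VS -> exists2 a, in_SL (a *: g) & a != 0.
Proof.
move=> /det_mxof_neq0 g0; have [a aE] := closed_root_ex (\det (passmx.mxof e e g))^-1 V_gt0.
exists a.
  rewrite /in_SL -[(a *: g)%VF]addr0 passmx.mxof_linear.
  have /eqP-> : passmx.mxof e e (0 : 'End(V)) == 0.
    by rewrite passmx.mxof_eq0 ?vbasisP.
  by rewrite addr0 detZ aE mulVf.
apply: contraTneq (invr_neq0 g0) => a0.
by rewrite -aE a0 expr0n (gtn_eqF V_gt0) negbK.
Qed.

Variables (m : nat) (NF : (nat -> V) -> extpow V k).
Hypothesis NF_map : forall g b, extpow_map g (NF b) = NF (fun i => g (b i)).
Hypothesis NF_local : forall b c, (forall i, (i < m)%N -> b i = c i) -> NF b = NF c.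

(** Automorphisms act transitively on independent families and [NF] commutes with them. Rescaling
    into SL multiplies the vector by a nonzero scalar, which points do not see. [NF] will be a
    single wedge, [NS l] or [NT l]. *)
Lemma SL_orbit_NF p b : indep m b -> is_pt p (NF b) ->
  SL_orbit p = [set q | exists2 c, indep m c & is_pt q (NF c)].
Proof.
move=> b_free pb; apply/seteqP; split => q /=.
  move=> [g [t [/lker_in_SL gSL pt qt]]]; exists (fun i => g (b i)).
    by apply: indep_lker; rewrite ?(eqP gSL) ?capv0.
  have [a a0 tE] := is_pt_scale pt pb.
  by move: qt; rewrite tE linearZ /= is_ptZ // NF_map.
move=> [c c_free qc]; have [g [gk gE]] := indep_auto b_free c_free.
have [a aSL a0] := SL_scale gk; exists (a *: g)%VF, (NF b); split => //.
by rewrite extpow_map_scale is_ptZ ?expf_neq0 // NF_map (NF_local gE).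
Qed.

End Orbits.

(** * Windows of a family and the Hamming distance *)

Section Windows.
Variables (K : fieldType) (V : vectType K) (k : nat).
Implicit Types (b c : nat -> V) (x y : 'I_k -> V).

Definition wedge_nat b : extpow V k := wedge (fun i : 'I_k => b i).

Lemma spanv_nat b : spanv (fun i : 'I_k => b i) = <<mkseq b k>>%VS.
Proof.
rewrite spanv_seq; congr <<_>>%VS; rewrite /mkseq -val_enum_ord -map_comp.
by apply: eq_map.
Qed.

Lemma wedge_nat_neq0 b : (wedge_nat b != 0) = indep k b.
Proof. by rewrite wedge_neq0 spanv_nat indep_span. Qed.

Lemma mem_mkseq_span b m i : (i < m)%N -> b i \in <<mkseq b m>>%VS.
Proof. by move=> im; apply/memv_span/mapP; exists i; rewrite ?mem_iota. Qed.

Lemma mkseq_span_sub b m (U : {vspace V}) :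
  (forall i, (i < m)%N -> b i \in U) -> (<<mkseq b m>> <= U)%VS.
Proof.
by move=> bU; apply/span_subvP => _ /mapP[i + ->]; rewrite mem_iota => /bU.
Qed.

Lemma indep_sub m b c : indep m b ->
  (forall i, (i < m)%N -> b i \in <<mkseq c m>>%VS) -> indep m c.
Proof.
rewrite !indep_span => /eqP bm /mkseq_span_sub/dimvS; rewrite bm => mc.
by rewrite eqn_leq mc andbT (leq_trans (dim_span _)) ?size_mkseq.
Qed.

Lemma indep_shift m l b : indep (m + l) b -> indep m (fun i => b (i + l)%N).
Proof.
move=> /indep_comp; apply; first by move=> i j _ _ /addIn.
by move=> i; rewrite ltn_add2r.
Qed.

(** For [l <= k] the two windows cover all [k + l] vectors, which gives the dimension of their
    sum. *)
Lemma dim_window_cap b l : (l <= k)%N -> indep (k + l) b ->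
  (\dim (<<mkseq b k>> :&: <<mkseq (fun i => b (i + l)%N) k>>) + l = k)%N.
Proof.
move=> lk b_free; have := b_free; have := indep_shift b_free.
have := indepW (leq_addr l k) b_free; rewrite !indep_span => /eqP d1 /eqP d2 /eqP d3.
have := dimv_sum_cap <<mkseq b k>> <<mkseq (fun i => b (i + l)%N) k>>.
set U := (_ + _)%VS; suff -> : U = <<mkseq b (k + l)>>%VS by rewrite d1 d2 d3; lia.
apply: subv_anti; apply/andP; split.
  rewrite subv_add !mkseq_span_sub // => i ik; rewrite mem_mkseq_span //; lia.
apply: mkseq_span_sub => i ikl; have [ik|ki] := ltnP i k.
  by rewrite memvE (subv_trans _ (addvSl _ _)) // -memvE mem_mkseq_span.
rewrite memvE (subv_trans _ (addvSr _ _)) // -memvE.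
rewrite -[i in b i](subnK (leq_trans lk ki)).
by apply: (mem_mkseq_span (fun i => b (i + l)%N)); lia.
Qed.

Lemma mkseq_nth_take (s : seq V) m : (m <= size s)%N -> mkseq (nth 0 s) m = take m s.
Proof.
move=> ms; apply: (@eq_from_nth _ 0); first by rewrite size_mkseq size_takel.
by rewrite size_mkseq => i im; rewrite nth_mkseq // nth_take.
Qed.

Lemma mkseq_nth_drop (s : seq V) m l : size s = (m + l)%N ->
  mkseq (fun i => nth 0 s (i + l)) m = drop l s.
Proof.
move=> ms; apply: (@eq_from_nth _ 0); first by rewrite size_mkseq size_drop ms addnK.
by rewrite size_mkseq => i im; rewrite nth_mkseq // nth_drop addnC.
Qed.

(** Concatenate bases of a complement of the intersection in the first subspace, of the
    intersection, and of a complement in the second; their sizes are [l], [k - l] and [l]. *)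
Lemma adapted_family x y l : wedge x != 0 -> wedge y != 0 ->
  (\dim (spanv x :&: spanv y) + l = k)%N ->
  exists b, [/\ indep (k + l) b, <<mkseq b k>>%VS = spanv x &
    <<mkseq (fun i => b (i + l)%N) k>>%VS = spanv y].
Proof.
move=> /dim_wedge dx /dim_wedge dy dl.
set X := spanv x in dx dl *; set Y := spanv y in dy dl *.
have dXY : \dim (X :\: Y) = l.
  by have := dimv_cap_compl X Y; rewrite dx; lia.
have dYX : \dim (Y :\: X) = l.
  by have := dimv_cap_compl Y X; rewrite capvC dy; lia.
pose s := vbasis (X :\: Y) ++ vbasis (X :&: Y) ++ vbasis (Y :\: X).
have s_size : size s = (k + l)%N by rewrite !size_cat !size_tuple dXY dYX; lia.
have spX : <<vbasis (X :\: Y) ++ vbasis (X :&: Y)>>%VS = X.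
  by rewrite span_cat !(span_basis (vbasisP _)) addv_diff_cap.
have spY : <<vbasis (X :&: Y) ++ vbasis (Y :\: X)>>%VS = Y.
  by rewrite span_cat !(span_basis (vbasisP _)) addvC capvC addv_diff_cap.
exists (nth 0 s); split.
- rewrite indep_span -s_size mkseq_nth s_size /s.
  suff -> : <<s>>%VS = (X + Y)%VS by have := dimv_sum_cap X Y; rewrite dx dy; lia.
  rewrite /s catA span_cat spX -[in RHS]spY span_cat addvA; congr (_ + _)%VS.
  by apply/esym/addv_idPl; rewrite (span_basis (vbasisP _)) capvSl.
- rewrite mkseq_nth_take ?s_size ?leq_addr // /s catA take_size_cat //.
  by rewrite size_cat !size_tuple dXY addnC.
- by rewrite mkseq_nth_drop // /s drop_size_cat // size_tuple dXY.
Qed.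

Definition decomposable (t : extpow V k) := exists v, t = wedge v.

Hypothesis k_gt0 : (0 < k)%N.
Let i0 : 'I_k := Ordinal k_gt0.

Lemma decomposable_scale a t : decomposable t -> decomposable (a *: t).
Proof. by move=> [v ->]; exists (replace v i0 (a *: v i0)); apply: wedge_scale. Qed.

(** Moving [b k] to the front costs a sign, left as an unspecified scalar [a]. *)
Lemma wedge_shift1 b : exists a, forall c : nat -> V,
  (forall i, (i < k)%N -> c i = b i.+1) ->
  wedge (fun i : 'I_k => c i) = a *: wedge (replace (fun i : 'I_k => b i) i0 (b k)).
Proof.
have [|a aE] := @wedge_spanv _ _ _ (fun i : 'I_k => b i.+1)
                  (replace (fun i : 'I_k => b i) i0 (b k)).
  move=> i; have [ik|ki] := ltnP i.+1 k.
    have := mem_spanv (replace (fun i : 'I_k => b i) i0 (b k)) (Ordinal ik).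
    by rewrite replace_ne // -val_eqE.
  have ik : i.+1 = k by apply/eqP; rewrite eqn_leq ki ltn_ord.
  have := mem_spanv (replace (fun i : 'I_k => b i) i0 (b k)) i0.
  by rewrite replace_eq -{1}ik.
exists a => c cb; rewrite -aE; congr wedge; apply: funext => i; exact: cb.
Qed.

(** The two wedges share the factors [b 1, ..., b k.-1], so a combination only alters the remaining
    factor. *)
Lemma line_decomposable b a1 a2 :
  decomposable (a1 *: wedge_nat b + a2 *: wedge_nat (fun i => b i.+1)).
Proof.
have [a aE] := wedge_shift1 b; exists (replace (fun i : 'I_k => b i) i0
  (a1 *: b 0%N + (a2 * a) *: b k)).
rewrite wedge_multilinear (multilinearZ (@wedge_multilinear K V k)) replace_id.
by rewrite /wedge_nat (aE (fun i => b i.+1)) // scalerA.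
Qed.

Lemma Gr_decomposable p t : is_pt p t -> Gr V k p <-> decomposable t.
Proof.
move=> pt; split=> [[v pv]|[v tv]]; last by exists v; rewrite -tv.
by have [a _ ->] := is_pt_scale pt pv; apply: decomposable_scale; exists v.
Qed.

Lemma line_in_dim p q x y : is_pt p (wedge x) -> is_pt q (wedge y) ->
  line_in (Gr V k) p q -> (k <= (\dim (spanv x :&: spanv y)).+1)%N.
Proof.
move=> px qy pq; have x0 := is_pt_neq0 px; have y0 := is_pt_neq0 qy.
have [t0|t0] := eqVneq (wedge x + wedge y) 0.
  rewrite (@wedge_scale_span _ _ _ x y (-1)) ?capvv ?dim_wedge // scaleN1r.
  by apply/eqP; rewrite -addr_eq0 t0.
have [z zt] := is_pt_exists t0.
have /(Gr_decomposable zt)[v xyv] : Gr V k z.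
  by apply: pq; rewrite zt px qy -memvE memv_add ?memv_line.
exact: dim_cap_decomposable xyv.
Qed.

(** The triangle inequality for the distance [k - \dim (A :&: B)] between [k]-dimensional
    subspaces. *)
Lemma dim_cap_trans (A B C : {vspace V}) :
  (\dim (A :&: B) + \dim (B :&: C) <= \dim B + \dim (A :&: C))%N.
Proof.
rewrite -dimv_sum_cap; apply: leq_add; apply: dimvS.
  by rewrite subv_add capvSr capvSl.
by apply: capvS; rewrite ?capvSl ?capvSr.
Qed.

(** Each line of the chain lowers the dimension of the intersection with the starting subspace by at
    most one. *)
Lemma line_chain_dim p q x y r : is_pt p (wedge x) -> is_pt q (wedge y) ->
  line_chain (Gr V k) p q r -> (k <= \dim (spanv x :&: spanv y) + r)%N.
Proof.
move=> px qy [c [c0 cr cGr c_line]]; rewrite -{}cr in qy.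
elim: r y qy cGr c_line => [|r IH] y qy cGr c_line.
  have py : is_pt p (wedge y) by rewrite -c0.
  have [a a0 xy] := is_pt_scale px py.
  by rewrite (wedge_scale_span (is_pt_neq0 px) xy) capvv addn0 (dim_wedge (is_pt_neq0 qy)).
have [v rv] := cGr r (leqnSn r).
have := IH v rv (fun i ir => cGr i (leqW ir)) (fun i ir => c_line i (ltnW ir)).
have := line_in_dim rv qy (proj2 (c_line r (leqnn _))).
have := dim_cap_trans (spanv x) (spanv v) (spanv y).
by rewrite (dim_wedge (is_pt_neq0 rv)); lia.
Qed.

(** The window of [k] vectors slides one step at a time; neighbouring windows share [k - 1] vectors,
    so a line of the Grassmannian joins them. *)
Lemma window_chain p q l b : indep (k + l) b -> is_pt p (wedge_nat b) ->
  is_pt q (wedge_nat (fun i => b (i + l)%N)) -> line_chain (Gr V k) p q l.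
Proof.
move=> b_free pb qb.
have win0 i : (i <= l)%N -> indep k (fun j => b (j + i)%N).
  by move=> il; apply: indep_shift; apply: indepW b_free; rewrite leq_add2l.
have /choice[P cE] : forall i, exists z, (i <= l)%N ->
    is_pt z (wedge_nat (fun j => b (j + i)%N)).
  move=> i; case: (leqP i l) => [il|_]; last by exists p.
  have : wedge_nat (fun j => b (j + i)%N) != 0 by rewrite wedge_nat_neq0 win0.
  by move=> /is_pt_exists[z zi]; exists z.
exists P; split=> [|||i il].
- apply: is_pt_inj (cE 0%N _) _ => //; rewrite /wedge_nat.
  by rewrite (_ : (fun _ => _) = fun i : 'I_k => b i) //; apply: funext => i; rewrite addn0.
- exact: is_pt_inj (cE l _) _.
- by move=> i il; exists (fun j : 'I_k => b (j + i)%N); apply: cE.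
have ci := cE i (ltnW il); have ci1 := cE i.+1 il; split.
  apply/eqP => cc; rewrite -cc in ci1; have [a a0 E] := is_pt_scale ci ci1.
  have := wedge_scale_span (is_pt_neq0 ci) E.
  rewrite (spanv_nat (fun j => b (j + i)%N)) (spanv_nat (fun j => b (j + i.+1)%N)) => sp.
  have := dim_window_cap k_gt0 (b := fun j => b (j + i)%N).
  have -> : (fun j => (fun j => b (j + i)%N) (j + 1)%N) = fun j => b (j + i.+1)%N.
    by apply: funext => j; rewrite addn1 addSnnS.
  rewrite -sp capvv; have := win0 i (ltnW il); rewrite indep_span => /eqP-> /=.
  suff -> : indep (k + 1) (fun j => b (j + i)%N) by move=> /(_ isT); lia.
  by apply: indep_shift; apply: indepW b_free; rewrite -addnA leq_add2l add1n.
move=> z; rewrite ci ci1; have [t zt] := is_pt_ex z.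
rewrite zt -memvE => /memv_addP[_ /vlineP[a1 ->] [_ /vlineP[a2 ->] tE]].
apply/(Gr_decomposable zt); rewrite tE.
have := line_decomposable (fun j => b (j + i)%N) a1 a2; congr decomposable.
congr (_ + _ *: wedge _); apply: funext => j; by rewrite addSnnS.
Qed.

Lemma hamming_distP p q x y l : is_pt p (wedge x) -> is_pt q (wedge y) ->
  hamming_dist (Gr V k) p q l <-> (\dim (spanv x :&: spanv y) + l = k)%N.
Proof.
move=> px qy; have x0 := is_pt_neq0 px; have y0 := is_pt_neq0 qy.
have chain l' : (\dim (spanv x :&: spanv y) + l' = k)%N -> line_chain (Gr V k) p q l'.
  move=> dl; have [b [b_free bx by_]] := adapted_family x0 y0 dl.
  apply: (window_chain b_free).
    have [|a a0 xb] := @wedge_same_span _ _ _ x (fun i : 'I_k => b i) x0.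
      by rewrite spanv_nat bx.
    by move: px; rewrite xb is_ptZ.
  have [|a a0 yb] := @wedge_same_span _ _ _ y (fun i : 'I_k => b (i + l')%N) y0.
    by rewrite (spanv_nat (fun i => b (i + l')%N)) by_.
  by move: qy; rewrite yb is_ptZ.
split=> [[pql l_min]|dl]; last first.
  split=> [|r /(line_chain_dim px qy)]; [exact: chain|lia].
have := line_chain_dim px qy pql.
have dk : (\dim (spanv x :&: spanv y) <= k)%N.
  by rewrite -[X in (_ <= X)%N](dim_wedge x0) dimvS ?capvSl.
by have := l_min _ (chain _ (subnKC dk)); lia.
Qed.

Definition NS l b := wedge_nat b + wedge_nat (fun i => b (i + l)%N).

Lemma NS_map l (g : 'End(V)) b : extpow_map g (NS l b) = NS l (fun i => g (b i)).
Proof. by rewrite linearD /= !extpow_map_wedge. Qed.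

Lemma NS_local l b c : (forall i, (i < k + l)%N -> b i = c i) -> NS l b = NS l c.
Proof.
move=> bc; congr (wedge _ + wedge _); apply: funext => i; apply: bc.
  by rewrite ltn_addr.
by rewrite ltn_add2r.
Qed.

Lemma sum_NS l x y : (0 < l)%N -> wedge x != 0 -> wedge y != 0 ->
  (\dim (spanv x :&: spanv y) + l = k)%N ->
  exists2 b, indep (k + l) b & wedge x + wedge y = NS l b.
Proof.
move=> l_gt0 x0 y0 dl; have [b [b_free bx by_]] := adapted_family x0 y0 dl.
have [|a a0 xb] := @wedge_same_span _ _ _ x (fun i : 'I_k => b i) x0.
  by rewrite spanv_nat bx.
have [|a' a0' yb] := @wedge_same_span _ _ _ y (fun i : 'I_k => b (i + l)%N) y0.
  by rewrite (spanv_nat (fun i => b (i + l)%N)) by_.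
(* As [l > 0], the first vector lies only in the first window and the last only in the second:
   rescaling them absorbs the two scalars. *)
pose d i := if i == 0%N then a else if i == (k + l).-1 then a' else 1.
have d0 i : d i != 0 by rewrite /d; do 2!case: ifP => // _; rewrite oner_eq0.
exists (fun i => d i *: b i).
  apply: (indep_sub b_free) => i ikl; rewrite -[b i](scalerK (d0 i)) memvZ //.
  exact: (mem_mkseq_span (fun i => d i *: b i)).
rewrite xb yb /NS /wedge_nat (wedge_scale i0).
have il : (k.-1 < k)%N by rewrite prednK.
rewrite (wedge_scale (Ordinal il)); congr (wedge _ + wedge _); apply: funext => i;
  rewrite /replace -val_eqE /= /d; case: eqP => [E|/eqP iE].
- by rewrite E.
- by rewrite ifN ?scale1r //; have := ltn_ord i; lia.
- by rewrite E ifN ?ifT //; lia.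
- by rewrite !ifN ?scale1r //; lia.
Qed.

Lemma SigmaE l : (0 < l <= k)%N ->
  Sigma V k l = [set q | exists2 b, indep (k + l) b & is_pt q (NS l b)].
Proof.
move=> /andP[l_gt0 lk]; apply/seteqP; split=> q /=.
  move=> [x [y [p1 [p2 [px py /(hamming_distP _ px py) dl qt]]]]].
  have [b b_free bE] := sum_NS l_gt0 (is_pt_neq0 px) (is_pt_neq0 py) dl.
  by exists b; rewrite // -bE.
move=> [b b_free qb].
have [p1 px] : exists p, is_pt p (wedge_nat b).
  by apply: is_pt_exists; rewrite wedge_nat_neq0 (indepW _ b_free) ?leq_addr.
have [p2 py] : exists p, is_pt p (wedge_nat (fun i => b (i + l)%N)).
  by apply: is_pt_exists; rewrite wedge_nat_neq0 indep_shift.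
exists (fun i : 'I_k => b i), (fun i : 'I_k => b (i + l)%N), p1, p2.
split=> //; apply/(hamming_distP _ px py).
by rewrite spanv_nat (spanv_nat (fun i => b (i + l)%N)) dim_window_cap.
Qed.

End Windows.

(** * Tangent vectors *)

Section Tangent.
Variables (K : fieldType) (V : vectType K) (k : nat).
Hypothesis k_gt0 : (0 < k)%N.
Implicit Types (b c : nat -> V) (v x y : 'I_k -> V) (phi : 'End(V)).

Lemma tangent_vec_affine v phi : affine_tangent (spanv v) (tangent_vec v phi).
Proof.
exists [seq wedge (replace v i (phi (v i))) | i <- enum 'I_k].
  move=> _ /mapP[i _ ->]; exists (replace v i (phi (v i))), i; split=> // j ji.
  by rewrite replace_ne ?mem_spanv.
apply: memv_suml => i _; apply: memv_span.
by apply/mapP; exists i; rewrite ?mem_enum.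
Qed.

Lemma tangent_vec0 v : tangent_vec v 0 = 0.
Proof.
rewrite /tangent_vec big1 // => j _.
by rewrite lfunE /= (multilinear0 (@wedge_multilinear K V k)).
Qed.

Lemma spanv_exchange v (a : V) : a \in spanv v -> a != 0 ->
  exists m, spanv (replace v m a) = spanv v.
Proof.
move=> av a0; have [d aE] := spanvP av.
have [m dm] : exists m, d m != 0.
  apply: contrapT => /forallNP d0; case/eqP: a0; rewrite aE big1 // => i _.
  by have /negP/negbNE/eqP-> := d0 i; rewrite scale0r.
exists m; apply: subv_anti; apply/andP; split; apply: spanv_sub => i.
  by rewrite /replace; case: eqP => // _; rewrite mem_spanv.
have [->|im] := eqVneq i m; last first.
  by rewrite -[v i](replace_ne v a im) mem_spanv.
rewrite -[v m](scalerK dm) memvZ //.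
have -> : d m *: v m = a - \sum_(j | j != m) d j *: v j.
  by rewrite aE (bigD1 m) //= addrK.
rewrite memvB //; first by rewrite -{1}(replace_eq v m a) mem_spanv.
by apply: memv_suml => j jm; rewrite memvZ // -(replace_ne v a jm) mem_spanv.
Qed.

(** The [k - 1] vectors other than [x i] are independent, so any [h] in [H] outside their span
    completes them to a basis of [H]. *)
Lemma complete_hyperplane x i (H : {vspace V}) : \dim H = k ->
  (forall j, j != i -> x j \in H) -> wedge x != 0 ->
  exists h, spanv (replace x i h) = H.
Proof.
move=> dH xH /dim_wedge dx.
pose U := (\sum_(j | j != i) <[x j]>)%VS.
have UH : (U <= H)%VS by apply/subv_sumP => j ji; rewrite -memvE xH.
have U_lt : (\dim U < k)%N.
  have -> : U = <<[seq x j | j <- enum (predC1 i)]>>%VS.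
    by rewrite span_def big_map big_enum.
  by rewrite (leq_ltn_trans (dim_span _)) // size_map -cardE cardC1 card_ord ltn_predL.
have : ~~ (H <= U)%VS by apply: contraL U_lt => /dimvS; rewrite dH -leqNgt.
move=> /subvPn[h hH hU]; exists h; apply/eqP; rewrite eqEdim dH.
have xU : spanv x = (<[x i]> + U)%VS by rewrite /spanv (bigD1 i).
have yU : spanv (replace x i h) = (<[h]> + U)%VS.
  rewrite /spanv (bigD1 i) //= replace_eq; congr (_ + _)%VS.
  by apply: eq_bigr => j ji; rewrite replace_ne.
apply/andP; split.
  by rewrite yU subv_add UH -memvE hH.
have hU0 : (<[h]> :&: U)%VS = 0%VS.
  apply/eqP; rewrite -subv0; apply/subvP => z /memv_capP[/vlineP[d ->] dU].
  rewrite memv0; have [->|d0] := eqVneq d 0; first by rewrite scale0r.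
  by case/negP: hU; rewrite -[h](scalerK d0) memvZ.
have := dimv_sum_cap <[h]> U; rewrite hU0 dimv0 addn0 yU => ->.
have h0 : h != 0 by apply: contra hU => /eqP->; rewrite mem0v.
rewrite dim_vline h0 -dx xU (leq_trans (dimv_add_leqif _ _)) //.
by rewrite leq_add2r dim_vline; case: eqP.
Qed.

(** A nonzero generator is the wedge of a basis of [H] with one entry [h] replaced by [x i]; it
    comes from the map sending [h] to [x i] and the other entries to 0. Linearity in [phi] handles
    sums. *)
Lemma affine_tangentP v t : wedge v != 0 -> affine_tangent (spanv v) t ->
  exists phi, t = tangent_vec v phi.
Proof.
move=> v0 [s sT]; have dv := dim_wedge v0.
have gen u : u \in s -> exists phi, u = tangent_vec v phi.
  move=> /sT[x [i [xH ->]]].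
  have [x0|x0] := eqVneq (wedge x) 0.
    by exists 0; rewrite x0 tangent_vec0.
  have [h hH] := complete_hyperplane dv xH x0.
  have y0 : wedge (replace x i h) != 0 by rewrite wedge_neq0 hH dv.
  have [a a0 yv] := wedge_same_span y0 hH.
  have [f fE] := spanv_lfun (fun j => if j == i then x i else 0) (etrans (congr1 _ hH) dv).
  exists (a *: f)%VF; rewrite -[X in tangent_vec v X]addr0 tangent_vecP.
  rewrite tangent_vec0 addr0 -(tangent_vecZ _ yv) /tangent_vec (bigD1 i) //= fE eqxx replace2 replace_id.
  rewrite big1 ?addr0 // => j ji.
  by rewrite fE (negPf ji) (multilinear0 (@wedge_multilinear K V k)).
elim: s {sT} t gen => [|u s IH] t gen; rewrite ?span_nil ?span_cons.
  by rewrite memv0 => /eqP->; exists 0; rewrite tangent_vec0.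
move=> /memv_addP[_ /vlineP[a ->] [w ws ->]].
have [phi ->] := gen u (mem_head _ _).
have [|psi ->] := IH w _ ws; first by move=> z zs; apply: gen; rewrite inE zs orbT.
by exists (a *: phi + psi)%VF; rewrite tangent_vecP.
Qed.

Lemma extpow_map_tangent_vec (g : 'End(V)) v phi : extpow_map g (tangent_vec v phi) =
  \sum_i wedge (replace (fun j => g (v j)) i (g (phi (v i)))).
Proof.
by rewrite linear_sum; apply: eq_bigr => i _; rewrite /= extpow_map_wedge lfun_replace.
Qed.

(* If [phi (v i)] is outside [H], a transvection fixing [H] and sending [phi (v i)]
   to [phi (v i) + v i] adds [wedge v] to [tangent_vec v phi]. *)
Lemma tangent_vec_notin_line v phi a : wedge v != 0 ->
  (0 < rank_mod (spanv v) phi)%N -> tangent_vec v phi <> a *: wedge v.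
Proof.
move=> v0; rewrite /rank_mod subn_gt0; set H := spanv v => rk tv.
have [i iH] : exists i, phi (v i) \notin H.
  apply: contrapT => /forallNP phiH; move: rk; rewrite ltnNge => /negP; apply.
  rewrite dimvS // subv_add subvv andbT limg_spanv spanv_sub // => i.
  by have /negP/negbNE := phiH i.
set u := phi (v i) in iH; set p := quot_end H.
have pu : p u != 0 by rewrite -memv_ker lker_quot_end.
have [f fE] := linear_of_free [:: p u] [:: v i].
have {}fE : f (p u) = v i.
  have pu_free : free [:: p u] by rewrite seq1_free.
  by have [] := fE pu_free erefl.
(* The final projection confines the image of [N] to [<[v i]>], so that every other term gains only
   a wedge with [v i] repeated. *)
pose N := (projv <[v i]> \o (linfun f \o p))%VF.
have NH z : z \in H -> N z = 0.
  by rewrite -(lker_quot_end H) memv_ker => /eqP px; rewrite /N !comp_lfunE px !linear0.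
have Nu : N u = v i by rewrite /N !comp_lfunE lfunE /= fE projv_id ?memv_line.
have NL z : N z \in <[v i]>%VS by rewrite /N !comp_lfunE memv_proj.
have gv j : (\1 + N)%VF (v j) = v j.
  by rewrite add_lfunE id_lfunE NH ?addr0 ?mem_spanv.
have := extpow_map_tangent_vec (\1 + N)%VF v phi.
have gvE : (fun j => (\1 + N)%VF (v j)) = v by apply: funext => j; rewrite gv.
rewrite tv linearZ /= extpow_map_wedge gvE -tv => /eqP.
rewrite /tangent_vec -subr_eq0 -sumrB (bigD1 i) //= big1 ?addr0 => [|j ji].
  rewrite add_lfunE id_lfunE Nu (multilinearD (@wedge_multilinear K V k)) replace_id.
  by rewrite opprD addNKr oppr_eq0 (negPf v0).
rewrite add_lfunE id_lfunE (multilinearD (@wedge_multilinear K V k)).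
rewrite opprD addNKr; apply/eqP; rewrite oppr_eq0; apply/eqP.
have /vlineP[d ->] := NL (phi (v j)).
rewrite (multilinearZ (@wedge_multilinear K V k)).
by rewrite (wedge_alternating ji) ?scaler0 // replace_eq replace_ne 1?eq_sym.
Qed.
End Tangent.

(** * The rank of a tangent vector *)

Section TangentRank.
Variables (K : fieldType) (V : vectType K) (k : nat).
Hypothesis k_gt0 : (0 < k)%N.
Implicit Types (b c : nat -> V) (v x y : 'I_k -> V) (phi : 'End(V)).

Lemma rank_mod_quot (H : {vspace V}) phi :
  rank_mod H phi = \dim ((quot_end H \o phi)%VF @: H).
Proof.
rewrite /rank_mod limg_comp; set W := (phi @: H)%VS.
have := limg_ker_dim (quot_end H) (W + H); rewrite lker_quot_end.
rewrite (capv_idPr (addvSr _ _)) => <-; rewrite addKn limgD; congr (\dim _).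
apply/addv_idPl; rewrite (_ : (_ @: H)%VS = 0%VS) ?sub0v //.
by apply/eqP; rewrite -lkerE lker_quot_end.
Qed.

Lemma rank_mod_le v phi : (rank_mod (spanv v) phi <= k)%N.
Proof.
rewrite rank_mod_quot (leq_trans _ (dim_spanv v)) //.
by rewrite -(limg_ker_dim (quot_end (spanv v) \o phi)%VF (spanv v)) leq_addl.
Qed.

(** As [a] is outside the subspace, [g] is injective on it, while the dimension of its sum with its
    image under [phi] drops by at most one. *)
Lemma tangent_quot v phi (a : V) : wedge v != 0 -> a \notin spanv v ->
  let g := quot_end <[a]> in
  exists psi, [/\ wedge (fun i => g (v i)) != 0,
    extpow_map g (tangent_vec v phi) = tangent_vec (fun i => g (v i)) psi &
    (rank_mod (spanv v) phi <= (rank_mod (spanv (fun i => g (v i))) psi).+1)%N].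
Proof.
move=> v0 av g; have a0 : a != 0 by apply: contra av => /eqP->; rewrite mem0v.
have gv0 : wedge (fun i => g (v i)) != 0 by rewrite -extpow_map_wedge quot_wedge_eq0.
have [f fE] := spanv_lfun (fun j => g (phi (v j))) (dim_wedge gv0).
exists f; split=> //.
  by rewrite extpow_map_tangent_vec; apply: eq_bigr => i _; rewrite fE.
rewrite /rank_mod (dim_wedge gv0) (dim_wedge v0) -limg_spanv.
have -> : (f @: (g @: spanv v) = g @: (phi @: spanv v))%VS.
  by rewrite !limg_spanv; apply: eq_bigr => i _; rewrite fE.
rewrite -limgD dim_limg_quot //; case: (_ \in _); lia.
Qed.

(** If [spanv z] lies in [spanv v], then [wedge z] is a multiple of [wedge v], which positive rank
    forbids. Otherwise killing a vector of [spanv z] outside [spanv v] gives 0 on one side and a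
    tangent vector of positive rank on the other. *)
Lemma tangent_vec_not_decomposable v phi : wedge v != 0 ->
  (1 < rank_mod (spanv v) phi)%N -> ~ decomposable (tangent_vec v phi).
Proof.
move=> v0 rk [z tz]; have rk0 := ltnW rk.
have z0 : wedge z != 0.
  apply/eqP => z0; case: (tangent_vec_notin_line (a := 0) v0 rk0).
  by rewrite tz z0 scale0r.
have [zv|] := boolP (spanv z <= spanv v)%VS.
  have [a aE] : exists a, wedge z = a *: wedge v.
    by apply: wedge_spanv => i; apply: (subvP zv); rewrite mem_spanv.
  by case: (tangent_vec_notin_line (a := a) v0 rk0); rewrite tz.
move=> /subvPn[a az av]; have [psi [gv0 gt rk']] := tangent_quot phi v0 av.
case: (tangent_vec_notin_line (a := 0) gv0 (phi := psi)); first by lia.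
rewrite -gt tz scale0r; apply/eqP; rewrite quot_wedge_eq0 //.
by apply: contra av => /eqP->; rewrite mem0v.
Qed.

(** In a basis of the subspace containing [a], the only term that survives killing [a] is the one in
    which [a] itself was replaced. *)
Lemma affine_tangent_quot v (a : V) (t : extpow V k) : wedge v != 0 -> a \in spanv v -> a != 0 ->
  affine_tangent (spanv v) t -> decomposable (extpow_map (quot_end <[a]>) t).
Proof.
move=> v0 av a0 tv; have [m vE] := spanv_exchange av a0.
have y0 : wedge (replace v m a) != 0 by rewrite wedge_neq0 vE (dim_wedge v0).
rewrite -vE in tv; have [phi ->] := affine_tangentP k_gt0 y0 tv.
set g := quot_end _; rewrite extpow_map_tangent_vec (bigD1 m) //= big1 ?addr0.
  by eexists; reflexivity.
move=> i im; rewrite lfun_replace replaceC 1?eq_sym //.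
have -> : g a = 0 by apply/eqP; rewrite -memv_ker lker_quot_end memv_line.
exact: (multilinear0 (@wedge_multilinear K V k)).
Qed.

Lemma tangent_unique v x phi (t : extpow V k) a : wedge v != 0 -> wedge x != 0 -> a != 0 ->
  (2 < rank_mod (spanv v) phi)%N -> t = a *: tangent_vec v phi ->
  affine_tangent (spanv x) t -> spanv x = spanv v.
Proof.
move=> v0 x0 a0 rk tE tx; apply/eqP; rewrite eqEdim !dim_wedge // leqnn andbT.
apply: contraT => /subvPn[u ux uv].
have u0 : u != 0 by apply: contra uv => /eqP->; rewrite mem0v.
have [psi [gv0 gt rk']] := tangent_quot phi v0 uv.
case: (@tangent_vec_not_decomposable _ psi gv0); first by lia.
rewrite -gt -[X in extpow_map _ X](scalerK a0) -tE linearZ /=.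
by apply: decomposable_scale => //; apply: affine_tangent_quot tx.
Qed.

Definition NT l b : extpow V k := \sum_(i < k | (i < l)%N)
  wedge (replace (fun j : 'I_k => b j) i (b (k + i)%N)).

Lemma NT_map l (g : 'End(V)) b : extpow_map g (NT l b) = NT l (fun i => g (b i)).
Proof.
rewrite linear_sum; apply: eq_bigr => i _ /=.
by rewrite extpow_map_wedge lfun_replace.
Qed.

Lemma NT_local l b c : (forall i, (i < k + l)%N -> b i = c i) -> NT l b = NT l c.
Proof.
move=> bc; apply: eq_bigr => i il; rewrite bc ?ltn_add2l //.
by congr (wedge (replace _ _ _)); apply: funext => j; rewrite bc // ltn_addr.
Qed.

Lemma NT_tangent l b : (l <= k)%N -> indep (k + l) b ->
  exists phi, NT l b = tangent_vec (fun i : 'I_k => b i) phi /\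
    rank_mod (spanv (fun i : 'I_k => b i)) phi = l.
Proof.
move=> lk b_free; have k_free := indepW (leq_addr l k) b_free.
have [phi phiE] := indep_lfun (fun i => if (i < l)%N then b (k + i)%N else 0) k_free.
exists phi; split.
  rewrite /NT big_mkcond; apply: eq_bigr => i _; rewrite phiE //.
  by case: ifP => // _; rewrite (multilinear0 (@wedge_multilinear K V k)).
rewrite /rank_mod limg_spanv spanv_nat; move: (k_free); rewrite indep_span => /eqP->.
suff -> : (spanv (fun i : 'I_k => phi (b i)) + <<mkseq b k>> = <<mkseq b (k + l)>>)%VS.
  by move: b_free; rewrite indep_span => /eqP->; rewrite addKn.
apply: subv_anti; apply/andP; split.
  rewrite subv_add; apply/andP; split.
    apply: spanv_sub => i; rewrite phiE //; case: ifP => il; last exact: mem0v.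
    by rewrite mem_mkseq_span // ltn_add2l.
  by apply: mkseq_span_sub => i ik; rewrite mem_mkseq_span // ltn_addr.
apply: mkseq_span_sub => i ikl; have [ik|ki] := ltnP i k.
  by rewrite memvE (subv_trans _ (addvSr _ _)) // -memvE mem_mkseq_span.
rewrite memvE (subv_trans _ (addvSl _ _)) // -memvE.
have il : (i - k < l)%N by rewrite ltn_subLR.
have ik : (i - k < k)%N := leq_trans il lk.
have -> : b i = phi (b (Ordinal ik)) by rewrite phiE //= il subnKC.
exact: (mem_spanv (fun i : 'I_k => phi (b i))).
Qed.

(** [B] lists a basis of a complement in [H] to the kernel of the induced map to [V / H], then one
    of that kernel, then the images under [phi] of the first [l] vectors. Kernel vectors contribute
    only multiples of [wedge v]; these and [a *: wedge v] are absorbed into the vector [b k], which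
    exists in the family once [l > 0]. *)
Lemma tangent_NT v phi a : wedge v != 0 ->
  let l := rank_mod (spanv v) phi in let t := tangent_vec v phi + a *: wedge v in
  (l = 0%N -> t \in <[wedge v]>%VS) /\
  ((0 < l)%N -> exists b, [/\ indep (k + l) b, spanv (fun i : 'I_k => b i) = spanv v & t = NT l b]).
Proof.
move=> v0 l t; set H := spanv v in l *; have dH : \dim H = k := dim_wedge v0.
pose psi := (quot_end H \o phi)%VF.
have lE : l = \dim (psi @: H) by rewrite /l rank_mod_quot.
have psi_ker u : (psi u == 0) = (phi u \in H).
  by rewrite comp_lfunE -memv_ker lker_quot_end.
have dC : \dim (H :\: lker psi) = l.
  have := dimv_cap_compl H (lker psi); rewrite -(limg_ker_dim psi H) -lE; lia.
have dN : (l + \dim (H :&: lker psi) = k)%N.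
  by rewrite -dH -(limg_ker_dim psi H) -lE addnC.
pose s1 := vbasis (H :\: lker psi) ++ vbasis (H :&: lker psi).
pose s2 := map phi (vbasis (H :\: lker psi)).
have sz1 : size s1 = k by rewrite size_cat !size_tuple dC.
have sz2 : size s2 = l by rewrite size_map size_tuple.
have sp1 : <<s1>>%VS = H by rewrite span_cat !(span_basis (vbasisP _)) addv_diff_cap.
have sp2 : (H + <<s2>> = phi @: H + H)%VS.
  rewrite -limg_span (span_basis (vbasisP _)).
  have phiN : (phi @: (H :&: lker psi) <= H)%VS.
    apply/subvP => _ /memv_imgP[u /memv_capP[_ +] ->].
    by rewrite memv_ker psi_ker.
  rewrite -[X in (phi @: X + _)%VS](addv_diff_cap H (lker psi)) limgD -addvA.
  by rewrite (addv_idPr phiN) addvC.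
pose B := nth 0 (s1 ++ s2).
have sz : size (s1 ++ s2) = (k + l)%N by rewrite size_cat sz1 sz2.
have B_free : indep (k + l) B.
  rewrite indep_span -[X in mkseq _ X]sz mkseq_nth span_cat sp1 sp2.
  by rewrite /l /rank_mod -/H dH addnC subnK // -dH dimvS ?addvSr.
have szC : size (vbasis (H :\: lker psi)) = l by rewrite size_tuple.
have BH : spanv (fun i : 'I_k => B i) = H.
  by rewrite spanv_nat mkseq_nth_take ?sz ?leq_addr // take_size_cat.
have B_phi i : (i < l)%N -> B (k + i)%N = phi (B i).
  move=> il; rewrite /B nth_cat sz1 ltnNge leq_addr addKn (nth_map 0) ?szC //.
  by rewrite !nth_cat sz1 szC il (leq_trans il) // -dN leq_addr.
have B_H i : (l <= i < k)%N -> phi (B i) \in H.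
  move=> /andP[li ik]; rewrite -psi_ker -memv_ker (subvP (capvSr H (lker psi))) //.
  rewrite /B nth_cat sz1 ik nth_cat szC ltnNge li /= vbasis_mem // mem_nth //.
  by rewrite size_tuple; lia.
set b0 := fun i : 'I_k => B i in BH.
have [|a1 a10 vB] := wedge_same_span v0 (_ : spanv v = spanv b0); first by rewrite BH.
have /choice[d dE] : forall i : 'I_k, exists d, (l <= i)%N ->
    wedge (replace b0 i (phi (B i))) = d *: wedge b0.
  move=> i; have [il|li] := ltnP i l; first by exists 0.
  have [|d dE] := @wedge_spanv _ _ _ (replace b0 i (phi (B i))) b0; last by exists d.
  move=> j; rewrite /replace; case: eqP => _; last exact: mem_spanv.
  by rewrite BH B_H // li /=.
have tB : tangent_vec b0 phi = NT l B + (\sum_(i < k | ~~ (i < l)%N) d i) *: wedge b0.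
  rewrite /tangent_vec (bigID (fun i : 'I_k => (i < l)%N)) /= scaler_suml.
  congr (_ + _); first by apply: eq_bigr => i il; rewrite B_phi.
  by apply: eq_bigr => i li; rewrite dE // leqNgt.
have {tB} [e tB] : exists e, t = a1 *: NT l B + e *: wedge b0.
  exists (a1 * (\sum_(i < k | ~~ (i < l)%N) d i) + a * a1).
  by rewrite /t (tangent_vecZ _ vB) vB tB scalerDr !scalerA -addrA -scalerDl.
split=> [l0|l_gt0].
  rewrite tB vB vline_scale // /NT l0 big1 // scaler0 add0r memvZ ?memv_line //.
(* In slot 0, [a1 *: B k + e *: B 0] yields the term of [B k] scaled by [a1], plus [e *: wedge b0];
   the other new vectors are only scaled. *)
pose b j := if (j < k)%N then B j else
  if j == k then a1 *: B k + e *: B 0%N else a1 *: B j.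
have b_lt (i : 'I_k) : b i = B i by rewrite /b ltn_ord.
exists b; split.
- have bm := mem_mkseq_span b; apply: (indep_sub B_free) => j jkl.
  have [jk|kj] := ltnP j k; first by have := bm _ _ jkl; rewrite /b jk.
  rewrite -[B j](scalerK a10) memvZ //; have [jk|jk] := eqVneq j k.
    rewrite jk -[a1 *: _](addrK (e *: B 0%N)) memvB //.
      by have := bm _ _ jkl; rewrite /b jk ltnn eqxx.
    by rewrite memvZ //; have := bm (k + l)%N 0%N; rewrite /b k_gt0 ltn_addr //; apply.
  by have := bm _ _ jkl; rewrite /b ltnNge kj (negPf jk).
- by rewrite -BH; congr spanv; apply: funext => i; apply: b_lt.
rewrite tB /NT; have -> : (fun j : 'I_k => b j) = b0 by apply: funext => i; apply: b_lt.
rewrite !(bigD1 (Ordinal k_gt0) (P := fun i : 'I_k => (i < l)%N)) //=.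
rewrite addn0 [b k]/b ltnn eqxx scalerDr addrAC; congr (_ + _).
  rewrite wedge_multilinear (multilinearZ (@wedge_multilinear K V k)).
  by rewrite (replace_id b0 (Ordinal k_gt0)).
rewrite scaler_sumr; apply: eq_bigr => i /andP[il i0].
rewrite /b ltnNge leq_addr /= -[X in _ == X]addn0 eqn_add2l.
rewrite -val_eqE /= in i0; rewrite (negPf i0).
by rewrite (multilinearZ (@wedge_multilinear K V k)).
Qed.

End TangentRank.

(** * Tangential identifiability *)

Section TangentVariety.
Variables (K : fieldType) (V : vectType K) (k : nat).
Hypothesis k_gt0 : (0 < k)%N.
Implicit Types (b c : nat -> V) (v x y : 'I_k -> V) (phi : 'End(V)).
Implicit Types (p q : proj (extpow V k)) (t : extpow V k).

Lemma tangentP p q : tangent p q -> exists v t,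
  [/\ is_pt p (wedge v), affine_tangent (spanv v) t & is_pt q t].
Proof. by move=> [H [v pv ->] [t tH qt]]; exists v, t. Qed.

Lemma tangent_pt p q v t : is_pt p (wedge v) -> affine_tangent (spanv v) t ->
  is_pt q t -> tangent p q.
Proof. by move=> pv tv qt; exists (spanv v); [exists v | exists t]. Qed.

Lemma Gr_wedge p v : is_pt p (wedge v) -> Gr V k p.
Proof. by exists v. Qed.

Lemma NT_tangent_pt l b q : (l <= k)%N -> indep (k + l) b -> is_pt q (NT k l b) ->
  exists p phi, [/\ is_pt p (wedge_nat k b), tangent p q,
    NT k l b = tangent_vec (fun i : 'I_k => b i) phi &
    rank_mod (spanv (fun i : 'I_k => b i)) phi = l].
Proof.
move=> lk b_free qb; have [phi [tE rk]] := NT_tangent lk b_free.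
have [p pb] : exists p, is_pt p (wedge_nat k b).
  by apply: is_pt_exists; rewrite wedge_nat_neq0 (indepW _ b_free) ?leq_addr.
exists p, phi; split=> //; apply: (tangent_pt pb _ qb).
by rewrite tE; apply: tangent_vec_affine.
Qed.

Lemma ThetaE l : (0 < l <= k)%N ->
  Theta V k l = [set q | exists2 b, indep (k + l) b & is_pt q (NT k l b)].
Proof.
move=> /andP[l_gt0 lk]; apply/seteqP; split=> q /=.
  move=> [_ [p [v [t [phi [pv qt _ tv rk]]]]]].
  have /vlineP[a /(canRL (subrK _)) tE] := tv.
  have [_] := tangent_NT k_gt0 phi a (is_pt_neq0 pv).
  rewrite [rank_mod _ _]rk => /(_ l_gt0)[b [b_free _ bE]]; exists b => //.
  by rewrite -bE addrC -/(tangent_vec v phi) -tE.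
move=> [b b_free qb]; have [p [phi [pb pq tE rk]]] := NT_tangent_pt lk b_free qb.
split; first by exists p => //; exists (fun i : 'I_k => b i).
exists p, (fun i : 'I_k => b i), (NT k l b), phi; split=> //.
  by rewrite tE; apply: tangent_vec_affine.
by rewrite /tangent_hom tE subrr mem0v.
Qed.

Lemma NT1_decomposable b : decomposable (NT k 1 b).
Proof.
exists (replace (fun j : 'I_k => b j) (Ordinal k_gt0) (b k)).
rewrite /NT (bigD1 (Ordinal k_gt0)) //= addn0 big1 ?addr0 // => i /andP[i1].
by rewrite -val_eqE /= -lt0n; case: (nat_of_ord i) i1.
Qed.

(** Rank 0 leaves a multiple of [wedge v], and rank 1 a wedge with a single factor changed; both are
    decomposable. *)
Lemma tau_cases q : tau V k q -> Gr V k q \/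
  exists l b, [/\ (1 < l <= k)%N, indep (k + l) b & is_pt q (NT k l b)].
Proof.
move=> [p _ /tangentP[v [t [pv tv qt]]]]; have v0 := is_pt_neq0 pv.
have [phi tE] := affine_tangentP k_gt0 v0 tv.
have [rk0 rk1] := tangent_NT k_gt0 phi 0 v0.
rewrite scale0r addr0 -{}tE in rk0 rk1; move: rk0 rk1.
have := rank_mod_le v phi; case: (rank_mod _ _) => [|[|l]] lk rk0 rk1.
- left; have /vlineP[a tE] := rk0 erefl.
  by apply/(Gr_decomposable k_gt0 qt); rewrite tE; apply: decomposable_scale; [|exists v].
- left; apply/(Gr_decomposable k_gt0 qt).
  by have [b [_ _ ->]] := rk1 isT; apply: NT1_decomposable.
- by right; have [b [b_free _ tE]] := rk1 isT; exists l.+2, b; rewrite -tE.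
Qed.

Lemma affine_tangent_gen (H : {vspace V}) x i :
  (forall j, j != i -> x j \in H) -> affine_tangent H (wedge x).
Proof.
move=> xH; exists [:: wedge x]; last by rewrite memv_span ?mem_head.
by move=> u; rewrite inE => /eqP->; exists x, i.
Qed.

Lemma affine_tangentD (H : {vspace V}) t t' :
  affine_tangent H t -> affine_tangent H t' -> affine_tangent H (t + t').
Proof.
move=> [s sH ts] [s' sH' ts']; exists (s ++ s').
  by move=> u; rewrite mem_cat => /orP[/sH|/sH'].
by rewrite span_cat memv_add.
Qed.

Lemma indep_last m b : indep m.+1 b -> b m \notin <<mkseq b m>>%VS.
Proof.
rewrite indep_span; apply: contraL => bm; rewrite neq_ltn; apply/orP; left.
rewrite (@leq_ltn_trans (\dim <<mkseq b m>>)) //; last first.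
  by rewrite ltnS (leq_trans (dim_span _)) ?size_mkseq.
apply/dimvS/mkseq_span_sub => i; rewrite ltnS leq_eqVlt => /orP[/eqP->//|].
exact: mem_mkseq_span.
Qed.

Lemma wedge_nat_ex v : wedge v != 0 ->
  exists2 b, indep (\dim {:V}) b & wedge v = wedge_nat k b.
Proof.
move=> v0; pose c j := if insub j is Some i then v i else 0.
have cv : wedge_nat k c = wedge v.
  by congr wedge; apply: funext => i; rewrite /c valK.
have [b [b_free bc]] : exists b, indep (\dim {:V}) b /\ forall i, (i < k)%N -> b i = c i.
  by apply: indep_extend; rewrite -wedge_nat_neq0 cv.
by exists b => //; rewrite -cv; congr wedge; apply: funext => i; rewrite bc.
Qed.

Lemma two_tangents q p p' u v x : is_pt p (wedge v) -> is_pt p' (wedge x) ->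
  u \in spanv x -> u \notin spanv v -> tangent p q -> tangent p' q ->
  ~ tangential_identifiable q.
Proof.
move=> pv px ux uv pq pq' [p0 [_ p0_uniq]].
have pp : p' = p.
  by rewrite (p0_uniq p' (Gr_wedge px) pq') (p0_uniq p (Gr_wedge pv) pq).
rewrite pp in px; have [a a0 xv] := is_pt_scale px pv.
by move: uv; rewrite -(wedge_scale_span (is_pt_neq0 px) xv) ux.
Qed.

(** b_0 ^ ... ^ b_(k-1) is also tangent at b_1 ^ ... ^ b_k, whose subspace contains all its factors
    but b_0. *)
Lemma Gr_not_tangential_identifiable q : (k < \dim {:V})%N ->
  Gr V k q -> ~ tangential_identifiable q.
Proof.
move=> kn [v qv]; have [b /(indepW kn) b_free vb] := wedge_nat_ex (is_pt_neq0 qv).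
rewrite {}vb in qv; pose c j := b (j + 1)%N.
have c_free : indep k c by apply: indep_shift; rewrite addn1.
have [p pc] : exists p, is_pt p (wedge_nat k c).
  by apply: is_pt_exists; rewrite wedge_nat_neq0.
pose i := Ordinal k_gt0.
apply: (two_tangents (u := b k) qv pc).
- rewrite (spanv_nat k c) (_ : b k = c k.-1); last by rewrite /c addn1 prednK.
  by rewrite mem_mkseq_span // prednK.
- by rewrite spanv_nat indep_last.
- apply: (tangent_pt qv _ qv); apply: (@affine_tangent_gen _ _ i) => j _.
  exact: (mem_spanv (fun i : 'I_k => b i)).
apply: (tangent_pt pc _ qv); apply: (@affine_tangent_gen _ _ i) => j ji.
have j0 : (0 < j)%N by rewrite lt0n -[0%N]/(nat_of_ord i) val_eqE.
have jk : (j.-1 < k)%N by rewrite (leq_ltn_trans (leq_pred _)).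
have -> : b j = c (Ordinal jk) by rewrite /c /= addn1 prednK.
exact: (mem_spanv (fun i : 'I_k => c i)).
Qed.

(** With w = b_2 ^ ... ^ b_(k-1), the vector b_k ^ b_1 ^ w + b_0 ^ b_(k+1) ^ w is tangent both at
    b_0 ^ b_1 ^ w and at b_k ^ b_(k+1) ^ w; [f] enumerates the factors of the latter. *)
Lemma NT2_not_tangential_identifiable q b : (1 < k)%N -> indep (k + 2) b ->
  is_pt q (NT k 2 b) -> ~ tangential_identifiable q.
Proof.
move=> k_gt1 b_free qb; have [p [phi [pb pq _ _]]] := NT_tangent_pt k_gt1 b_free qb.
pose f j := if j == 0%N then k else if j == 1%N then k.+1 else j.
pose c j := b (f j).
have c_free : indep k c.
  apply: (indep_comp b_free) => [i j|i]; rewrite /f; last by do ?[case: ifP => ?]; lia.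
  by rewrite !inE; do ?[case: ifP => ?]; lia.
have [p' pc] : exists p, is_pt p (wedge_nat k c).
  by apply: is_pt_exists; rewrite wedge_nat_neq0.
have cS j : (j < k)%N -> c j \in spanv (fun i : 'I_k => c i).
  by move=> jk; rewrite (spanv_nat k c) mem_mkseq_span.
apply: (two_tangents (u := b k) pb pc) pq _.
- exact: (cS 0%N).
- by rewrite spanv_nat indep_last // (indepW _ b_free) // addn2 ltnS leqnSn.
apply: (tangent_pt pc _ qb); rewrite /NT.
rewrite (bigD1 (Ordinal k_gt0)) //= (bigD1 (Ordinal k_gt1)) //= big1 ?addr0; last first.
  move=> i; rewrite -!val_eqE /= => /andP[/andP[i2 i0] i1].
  by case: (nat_of_ord i) i2 i0 i1 => [|[|]].
rewrite addn0 addn1; apply: affine_tangentD.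
  apply: (@affine_tangent_gen _ _ (Ordinal k_gt1)) => j; rewrite -val_eqE /= => j1.
  rewrite /replace -val_eqE /=; have [j0|j0] := eqVneq (j : nat) 0%N.
    exact: (cS 0%N).
  by have := cS j (ltn_ord j); rewrite /c /f (negPf j0) (negPf j1).
apply: (@affine_tangent_gen _ _ (Ordinal k_gt0)) => j; rewrite -val_eqE /= => j0.
rewrite /replace -val_eqE /=; have [j1|j1] := eqVneq (j : nat) 1%N.
  exact: (cS 1%N).
by have := cS j (ltn_ord j); rewrite /c /f (negPf j0) (negPf j1).
Qed.

Lemma NT_tangential_identifiable l q b : (2 < l <= k)%N -> indep (k + l) b ->
  is_pt q (NT k l b) -> tangential_identifiable q.
Proof.
move=> /andP[l3 lk] b_free qb; have [p [phi [pb pq tE rk]]] := NT_tangent_pt lk b_free qb.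
exists p; split=> [|p' _ /tangentP[x [t [px tx qt]]]]; first by split=> //; apply: Gr_wedge pb.
have [a a0 at_] := is_pt_scale qt qb; rewrite tE in at_.
have x0 := is_pt_neq0 px; have b0 := is_pt_neq0 pb.
rewrite -rk in l3; have xb_span := tangent_unique k_gt0 b0 x0 a0 l3 at_ tx.
have [d d0 xb] := wedge_same_span x0 xb_span.
by move: px; rewrite xb is_ptZ // => px; apply: is_pt_inj px pb.
Qed.

End TangentVariety.

(** * Decompositions *)

Section Identifiability.
Variables (K : fieldType) (V : vectType K) (k : nat).
Hypothesis k_gt0 : (0 < k)%N.
Implicit Types (b c : nat -> V) (v x y : 'I_k -> V) (phi : 'End(V)).
Implicit Types (p q : proj (extpow V k)) (t : extpow V k).

Lemma NS_not_decomposable l b : (1 < l <= k)%N -> indep (k + l) b ->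
  ~ decomposable (NS k l b).
Proof.
move=> /andP[l1 lk] b_free [z zE].
have x0 : wedge_nat k b != 0 by rewrite wedge_nat_neq0 (indepW _ b_free) ?leq_addr.
have y0 : wedge_nat k (fun i => b (i + l)%N) != 0.
  by rewrite wedge_nat_neq0 indep_shift.
have := dim_cap_decomposable x0 y0 zE.
by rewrite spanv_nat (spanv_nat k (fun i => b (i + l)%N)); have := dim_window_cap lk b_free; lia.
Qed.

Lemma subv_or (H X Y : {vspace V}) : (forall a, a \in H -> a \in X \/ a \in Y) ->
  (H <= X)%VS \/ (H <= Y)%VS.
Proof.
move=> HXY; apply: contrapT => /not_orP[/negP/subvPn[a aH aX] /negP/subvPn[a' aH' aY]].
have aY' : a \in Y by case: (HXY _ aH) => // aX'; case/negP: aX.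
have aX' : a' \in X by case: (HXY _ aH') => // aY''; case/negP: aY.
have [aa|aa] := HXY (a + a') (memvD aH aH').
  by case/negP: aX; rewrite -[a](addrK a') memvB.
by case/negP: aY; rewrite -[a'](addKr a) memvD // memvN.
Qed.

(* Killing a vector [a] of [spanv u] leaves a sum of two decomposable vectors which
   is decomposable, although their subspaces are far apart unless [a] lies in one
   of the two original subspaces. *)
Lemma summand_span x y u z l a1 a2 : wedge x != 0 -> wedge y != 0 -> wedge u != 0 ->
  (2 < l)%N -> (\dim (spanv x :&: spanv y) + l = k)%N ->
  wedge x + wedge y = a1 *: wedge u + a2 *: wedge z ->
  spanv u = spanv x \/ spanv u = spanv y.
Proof.
move=> x0 y0 u0 l3 dl tE.
suff : (spanv u <= spanv x)%VS \/ (spanv u <= spanv y)%VS.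
  by case=> sub; [left|right]; apply/eqP; rewrite eqEdim sub !dim_wedge //=.
apply: subv_or => a au; apply: contrapT => /not_orP[/negP ax /negP ay].
have a0 : a != 0 by apply: contra ax => /eqP->; rewrite mem0v.
have := congr1 (extpow_map (quot_end <[a]>)) tE; rewrite !linearD !linearZ /=.
have /eqP-> : extpow_map (quot_end <[a]>) (wedge u) == 0 by rewrite quot_wedge_eq0.
rewrite scaler0 add0r.
have := quot_wedge_eq0 x0 a0; have := quot_wedge_eq0 y0 a0.
rewrite (negPf ax) (negPf ay) !extpow_map_wedge => /negbT gy0 /negbT gx0.
rewrite (wedge_scale (Ordinal k_gt0)) => /(dim_cap_decomposable gx0 gy0).
(* The images of the two subspaces meet in dimension at most [k - l + 1 <= k - 2], whereas a
   decomposable sum requires [k - 1]. *)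
have := dimv_sum_cap (spanv (fun i => quot_end <[a]> (x i)))
  (spanv (fun i => quot_end <[a]> (y i))).
rewrite !dim_wedge // -!limg_spanv -limgD dim_limg_quot //.
have := dimv_sum_cap (spanv x) (spanv y); rewrite !dim_wedge //.
by case: (_ \in _); lia.
Qed.

Lemma span_pt p q x y : is_pt p (wedge x) -> is_pt q (wedge y) ->
  spanv x = spanv y -> p = q.
Proof.
move=> px qy xy; have [a a0 E] := wedge_same_span (is_pt_neq0 px) xy.
by move: px; rewrite E is_ptZ // => py; apply: is_pt_inj py qy.
Qed.

Lemma decomposition_size q s : ~ Gr V k q -> decomposition (Gr V k) q s ->
  (1 < size s)%N.
Proof.
move=> qGr [sGr]; have [t qt] := is_pt_ex q; rewrite qt -memvE.
case: s sGr => [|x [|//]] sGr; rewrite ?big_cons big_nil.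
  by rewrite memv0 (negPf (is_pt_neq0 qt)).
rewrite addv0 => tx; case: qGr.
rewrite (_ : q = x); first by apply: sGr; rewrite mem_head.
by apply: (is_pt_inj qt); apply: is_pt_mem tx (is_pt_neq0 qt).
Qed.

(** Being outside [Gr], the point has rank at least 2. By [summand_span] both members of any other
    decomposition are among [p1] and [p2], and they differ because a repeated point would put [q] in
    [Gr]. *)
Lemma NS_identifiable l b q : (2 < l <= k)%N -> indep (k + l) b ->
  is_pt q (NS k l b) -> identifiable (Gr V k) q.
Proof.
move=> /andP[l3 lk] b_free qb.
have [p1 px] : exists p, is_pt p (wedge_nat k b).
  by apply: is_pt_exists; rewrite wedge_nat_neq0 (indepW _ b_free) ?leq_addr.
have [p2 py] : exists p, is_pt p (wedge_nat k (fun i => b (i + l)%N)).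
  by apply: is_pt_exists; rewrite wedge_nat_neq0 indep_shift.
have qGr : ~ Gr V k q.
  move=> /(Gr_decomposable k_gt0 qb); apply: NS_not_decomposable b_free.
  by rewrite lk ltnW.
have dl := dim_window_cap lk b_free.
rewrite -(spanv_nat k b) -(spanv_nat k (fun i => b (i + l)%N)) in dl.
have dec : decomposition (Gr V k) q [:: p1; p2].
  split; first by move=> z; rewrite !inE => /orP[/eqP->|/eqP->]; apply: Gr_wedge; eassumption.
  rewrite !big_cons big_nil addv0 qb -memvE px py.
  by rewrite memv_add ?memv_line.
exists 2%N; first by split=> [|s /(decomposition_size qGr)//]; exists [:: p1; p2].
exists [:: p1; p2]; split=> // s s2 [sGr].
case: s s2 sGr => [|u [|w []]] //= _ sGr; rewrite !big_cons big_nil addv0 => qs.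
have [x' ux] : Gr V k u by apply: sGr; rewrite mem_head.
have [y' wy] : Gr V k w by apply: sGr; rewrite !inE eqxx orbT.
have : NS k l b \in (val u + val w)%VS by move: qs; rewrite qb -memvE.
rewrite ux wy => /memv_addP[_ /vlineP[a1 ->] [_ /vlineP[a2 ->] tE]].
have uw : u != w.
  apply/eqP => uw; have := @decomposition_size q [:: u] qGr.
  suff dec1 : decomposition (Gr V k) q [:: u] by move=> /(_ dec1).
  split; first by move=> z; rewrite inE => /eqP->; exists x'.
  by move: qs; rewrite -uw big_cons big_nil !addv0 addvv.
have b0 := is_pt_neq0 px; have b1 := is_pt_neq0 py.
have p_or v z : is_pt z (wedge v) -> spanv v = spanv (fun i : 'I_k => b i) \/
    spanv v = spanv (fun i : 'I_k => b (i + l)%N) -> z = p1 \/ z = p2.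
  by move=> zv [E|E]; [left; apply: span_pt E|right; apply: span_pt E]; eassumption.
have u_or := p_or _ _ ux (summand_span b0 b1 (is_pt_neq0 ux) l3 dl tE).
rewrite addrC in tE.
have w_or := p_or _ _ wy (summand_span b0 b1 (is_pt_neq0 wy) l3 dl tE).
case: u_or w_or uw => -> [] -> //; rewrite ?eqxx // => _.
by rewrite (perm_catC [:: p1] [:: p2]).
Qed.

(** For independent [b], only the coefficient of [b i] in [N (b (k + i))] survives in the i-th
    wedge: the last condition says that these coefficients, for [i < l], have sum 0. *)
Definition trace_free l b (N : 'End(V)) :=
  [/\ forall i, (i < k)%N -> N (b i) = 0, forall z, N z \in <<mkseq b k>>%VS &
    \sum_(i < k | (i < l)%N) wedge (replace (fun j : 'I_k => b j) i (N (b (k + i)%N))) = 0].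

Lemma trace_free_fix l b N a : trace_free l b N ->
  extpow_map (\1 + a *: N)%VF (NT k l b) = NT k l b.
Proof.
move=> [N0 _ Ntr]; rewrite NT_map /NT.
transitivity (NT k l b + a *: \sum_(i < k | (i < l)%N)
    wedge (replace (fun j : 'I_k => b j) i (N (b (k + i)%N)))); last first.
  by rewrite Ntr scaler0 addr0.
rewrite /NT scaler_sumr -big_split.
apply: eq_bigr => i il /=.
have gE u : (\1 + a *: N)%VF u = a *: N u + u.
  by rewrite add_lfunE id_lfunE scale_lfunE addrC.
have -> : (fun j : 'I_k => (\1 + a *: N)%VF (b j)) = fun j : 'I_k => b j.
  by apply: funext => j; rewrite gE N0 // scaler0 add0r.
by rewrite gE wedge_multilinear addrC.
Qed.

Hypothesis char0 : [pchar K] =i pred0.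

Lemma pchar0_natr_inj : injective (fun n : nat => n%:R : K).
Proof.
suff H m n : (m <= n)%N -> m%:R = n%:R :> K -> m = n.
  by move=> m n; case/orP: (leq_total m n) => mn /[dup] E /esym E'; [|symmetry]; apply: H.
move=> mn /esym/eqP; rewrite -subr_eq0 -natrB // ((pcharf0P K).1 char0) subn_eq0.
by move=> nm; apply/eqP; rewrite eqn_leq mn.
Qed.

(* The unipotent maps [1 + a N] fix [t], so they permute its unique
   decomposition; by the pigeonhole principle two of them agree at each of its
   points. *)
Lemma unique_decomposition_stable q t s (N : 'End(V)) : is_pt q t ->
  decomposition (Gr V k) q s ->
  (forall s', size s' = size s -> decomposition (Gr V k) q s' -> perm_eq s s') ->
  (forall z, N (N z) = 0) ->
  (forall a, extpow_map (\1 + a *: N)%VF t = t) ->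
  forall p v z, p \in s -> is_pt p (wedge v) -> z \in spanv v -> N z \in spanv v.
Proof.
move=> qt [sGr qs] s_uniq NN Nt p v z ps pv zv.
pose g a : 'End(V) := (\1 + a *: N)%VF.
have gE a u : g a u = u + a *: N u by rewrite add_lfunE id_lfunE scale_lfunE.
have g_inj a u : g a u = 0 -> u = 0.
  rewrite gE => gu; have := congr1 N gu; rewrite linearD linearZ linear0 /= NN scaler0.
  by rewrite addr0 => Nu; rewrite Nu scaler0 addr0 in gu.
have g_wedge a x : wedge x != 0 -> extpow_map (g a) (wedge x) != 0.
  rewrite extpow_map_wedge !wedge_neq0 -limg_spanv => /eqP {2}<-.
  rewrite limg_dim_eq //; apply/eqP; rewrite -subv0; apply/subvP => u.
  by move=> /memv_capP[_]; rewrite memv_ker memv0 => /eqP/g_inj->.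
(* [A a] is the action of [g a] on points of [Gr], completed by the identity elsewhere. *)
have /choice[A AE] : forall a, exists f, forall p x, is_pt p (wedge x) ->
    is_pt (f p) (extpow_map (g a) (wedge x)).
  move=> a; suff /choice[f fE] : forall p', exists r, forall x, is_pt p' (wedge x) ->
      is_pt r (extpow_map (g a) (wedge x)) by exists f.
  move=> p'; have [[x px]|nGr] := pselect (Gr V k p'); last first.
    by exists p' => x px; case: nGr; exists x.
  have [y yx] := is_pt_exists (g_wedge a x (is_pt_neq0 px)).
  exists y => x' px'; have [d d0 ->] := is_pt_scale px' px.
  by rewrite linearZ is_ptZ.
have A_s a r : r \in s -> A a r \in s.
  move=> xs; have /perm_mem-> : perm_eq s (map (A a) s); last exact: map_f.
  apply: s_uniq; first by rewrite size_map.
  split=> [_ /mapP[y ys ->]|].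
    have [w yw] := sGr _ ys; exists (fun i => g a (w i)).
    by rewrite -extpow_map_wedge; apply: AE.
  have := limgS (linfun (extpow_map (g a))) qs.
  rewrite qt limg_line lfunE /= Nt limg_sum big_map; congr (_ <= _)%VS.
  apply: eq_big_seq => y ys; have [w yw] := sGr _ ys.
  by rewrite (AE a _ _ yw) yw limg_line lfunE.
have [i [j [ij Aij]]] : exists i j : nat, i <> j /\ A i%:R p = A j%:R p.
  pose f (i : 'I_(size s).+1) := A i%:R p.
  have /injectivePn[i [j ij fij]] : ~~ injectiveb f.
    apply/negP => /injectiveP f_inj.
    have sub : {subset map f (enum 'I_(size s).+1) <= s}.
      by move=> _ /mapP[i _ ->]; apply: A_s.
    have := uniq_leq_size _ sub.
    by rewrite map_inj_uniq // enum_uniq size_map size_enum_ord ltnn => /(_ isT).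
  exists i, j; split; last exact: fij.
  by move=> /ord_inj ijE; rewrite ijE eqxx in ij.
have [d d0] := is_pt_scale (AE j%:R _ _ pv) (etrans (congr1 val (esym Aij)) (AE i%:R _ _ pv)).
have gj0 := g_wedge j%:R _ (is_pt_neq0 pv).
rewrite !extpow_map_wedge in gj0 * => /(wedge_scale_span gj0).
rewrite -!limg_spanv => gg; have := memv_img (g j%:R) zv.
rewrite gg => /memv_imgP[z' z'v]; rewrite !gE => zz'.
(* From [z + j N z = z' + i N z'] and [N z = N z'] one gets [z - z' = (i - j) N z], with [i - j]
   invertible. *)
have Nzz' : N z = N z'.
  by have := congr1 N zz'; rewrite !linearD !linearZ /= !NN !scaler0 !addr0.
have ij0 : i%:R - j%:R != 0 :> K.
  by rewrite subr_eq0; apply/eqP => /pchar0_natr_inj.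
rewrite -(scalerK ij0 (N z)) memvZ // scalerBl {1}Nzz'.
have -> : i%:R *: N z' = z + j%:R *: N z - z'.
  by apply/eqP; rewrite eq_sym subr_eq zz' addrC.
by rewrite addrAC addrK memvB.
Qed.

(** Suppose the subspace of a point of the decomposition contains [z] outside [H], with a nonzero
    coordinate at some [B m], [m >= k]. Suitable maps [N] send [z] to a multiple of any [B a] in
    [H], up to a correction already in the subspace; so the subspace contains [H], and equals it by
    dimension, a contradiction. *)
Lemma NT_not_identifiable l b q : (1 < l <= k)%N -> indep (k + l) b ->
  is_pt q (NT k l b) -> ~ identifiable (Gr V k) q.
Proof.
move=> /andP[l2 lk] b_free qb [r _ [s [s_size s_dec s_uniq]]].
rewrite -{}s_size in s_uniq.
(* A basis of [V] allows [N] to be prescribed by its values, while [NT k l] sees only the first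
   [k + l] vectors. *)
have [B [B_free Bb]] := indep_extend b_free; have kln := indep_leq b_free.
rewrite -(NT_local Bb) in qb; have {b_free Bb b} b_free := indepW kln B_free.
have k_lt i : (i < k)%N -> (i < \dim {:V})%N by move=> ik; apply: leq_trans kln; rewrite ltn_addr.
set H := <<mkseq B k>>%VS.
have B_full : <<mkseq B (\dim {:V})>>%VS = fullv.
  apply/eqP; rewrite eqEdim subvf (eqP (_ : \dim <<_>>%VS == \dim {:V})) ?leqnn //.
  by rewrite -indep_span.
have B_H i : (i < k)%N -> B i \in H by apply: mem_mkseq_span.
have stab (c : nat -> V) : (forall i, (i < k)%N -> c i = 0) -> (forall i, c i \in H) ->
    \sum_(i < k | (i < l)%N) wedge (replace (fun j : 'I_k => B j) i (c (k + i)%N)) = 0 ->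
    forall p v (f : nat -> K), p \in s -> is_pt p (wedge v) ->
      \sum_(i < \dim {:V}) f i *: B i \in spanv v ->
      \sum_(i < \dim {:V}) f i *: c i \in spanv v.
  move=> c0 cH c_tr p v f ps pv fv.
  have [N NE] := indep_lfun c B_free.
  have NH z : z \in H -> N z = 0.
    rewrite /H -(spanv_nat k B) => /spanvP[d ->]; rewrite linear_sum big1 // => i _.
    by rewrite linearZ /= NE ?k_lt // c0 // scaler0.
  have NinH z : N z \in H.
    have : z \in <<mkseq B (\dim {:V})>>%VS by rewrite B_full memvf.
    rewrite -spanv_nat => /spanvP[d ->]; rewrite linear_sum memv_suml // => i _.
    by rewrite linearZ /= NE // memvZ.
  have := unique_decomposition_stable qb s_dec s_uniq (N := N) _ _ ps pv fv.
  rewrite linear_sum (eq_bigr (fun i : 'I__ => f i *: c i)) => [|i _].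
    apply=> [z|a]; first by rewrite NH.
    apply: trace_free_fix; split=> // [i ik|]; first by rewrite NH ?B_H.
    rewrite -[RHS]c_tr; apply: eq_bigr => i il; rewrite NE //.
    by rewrite (leq_trans _ kln) // ltn_add2l.
  by rewrite linearZ /= NE.
have s_H p v : p \in s -> is_pt p (wedge v) -> spanv v = H.
  move=> ps pv; have dv := dim_wedge (is_pt_neq0 pv).
  have dH : \dim H = k.
    by apply/eqP; rewrite -indep_span (indepW _ b_free) // leq_addr.
  suff vH : (spanv v <= H)%VS by apply/eqP; rewrite eqEdim vH dv dH /=.
  apply: contraT => /subvPn[z zv zH].
  have [f zE] : exists f : nat -> K, z = \sum_(i < \dim {:V}) f i *: B i.
    have : z \in spanv (fun i : 'I_(\dim {:V}) => B i).
      by rewrite spanv_nat B_full memvf.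
    move=> /spanvP[d ->]; exists (fun j => if insub j is Some i then d i else 0).
    by apply: eq_bigr => i _; rewrite valK.
  have [m [km fm]] : exists m : 'I_(\dim {:V}), (k <= m)%N /\ f m != 0.
    apply: contrapT => /forallNP fm; case/negP: zH; rewrite zE memv_suml // => i _.
    have [ik|ki] := ltnP i k; first by rewrite memvZ // B_H.
    have [->|fi] := eqVneq (f i) 0; first by rewrite scale0r mem0v.
    by case: (fm i).
  rewrite zE in zv.
  have B_v1 a : (a < k)%N -> (m != k + a :> nat)%N || (l <= a)%N -> B a \in spanv v.
    (* [N] sends [B m] to [B a] and the rest of the basis to 0. The trace condition holds since
       [B m] is not paired with [B a], or [a] is outside the range of the sum. *)
    move=> ak am; pose c i := if i == m :> nat then B a else 0.
    have cE : \sum_(i < \dim {:V}) f i *: c i = f m *: B a.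
      rewrite (bigD1 m) //= {1}/c eqxx big1 ?addr0 // => i im.
      by rewrite /c val_eqE (negPf im) scaler0.
    have := stab c _ _ _ p v f ps pv zv; rewrite cE => H'; rewrite -[B a](scalerK fm) memvZ // H' // => [i ik|i|].
    - by rewrite /c ltn_eqF // (leq_trans ik).
    - by rewrite /c; case: ifP => _; rewrite ?mem0v ?B_H.
    rewrite big1 // => i il; rewrite /c; case: eqP => [mE|_]; last first.
      by rewrite (multilinear0 (@wedge_multilinear K V k)).
    have ia : Ordinal ak != i.
      by rewrite -val_eqE /=; apply: contraTneq am => ->; rewrite mE eqxx -ltnNge.
    by rewrite (wedge_alternating ia) // replace_eq replace_ne.
  have B_v a : (a < k)%N -> B a \in spanv v.
    move=> ak; have [|] := boolP ((m != k + a :> nat)%N || (l <= a)%N); first exact: B_v1.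
    rewrite negb_or negbK -ltnNge => /andP[/eqP mE al].
    (* As [l >= 2], some index below [l] differs from [a]: 1 if [a] is 0, and 0 otherwise. *)
    have [i [ia il]] : exists i, i != a /\ (i < l)%N.
      by exists (nat_of_bool (a == 0%N)); split; [case: (a) | case: (a == _) => //; exact: ltnW].
    have ik : (i < k)%N := leq_trans il lk.
    have Bi : B i \in spanv v by rewrite B_v1 // mE eqn_add2l eq_sym ia.
    (* The value [- B i] at [B (k + i)] restores the trace condition; it contributes a multiple of
       [B i], already known to lie in [spanv v]. *)
    pose c j := if j == m :> nat then B a else if j == (k + i)%N then - B i else 0.
    have kin : (k + i < \dim {:V})%N by rewrite (leq_trans _ kln) // ltn_add2l.
    have im : Ordinal kin != m by rewrite -val_eqE /= mE eqn_add2l.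
    have cE : \sum_(j < \dim {:V}) f j *: c j = f m *: B a - f (k + i)%N *: B i.
      rewrite (bigD1 m) //= (bigD1 (Ordinal kin)) //= big1 => [|j /andP[jm ji]].
        rewrite addr0 -scalerN; congr (_ *: _ + _ *: _); rewrite /c ?eqxx //.
        by rewrite mE eqn_add2l (negPf ia).
      by rewrite /c val_eqE (negPf jm) -[_ == _]/(j == Ordinal kin) (negPf ji) scaler0.
    have := stab c _ _ _ p v f ps pv zv; rewrite cE => H'.
    rewrite -[B a](scalerK fm) memvZ // -[_ *: _](subrK (f (k + i)%N *: B i)).
    rewrite memvD ?memvZ // H' // => [j jk|j|].
    - by rewrite /c !ltn_eqF // ?(leq_trans jk) // leq_addr.
    - by rewrite /c; do 2?case: ifP => _; rewrite ?memvN ?mem0v ?B_H.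
    have ai : Ordinal ik != Ordinal ak by [].
    rewrite (bigD1 (Ordinal ak)) //= (bigD1 (Ordinal ik)) /= ?il //.
    rewrite {1 2}/c mE eqxx !eqn_add2l (negPf ia) eqxx.
    rewrite -[X in replace _ _ X]/((fun j : 'I_k => B j) (Ordinal ak)) replace_id.
    rewrite -[X in replace _ _ (- X)]/((fun j : 'I_k => B j) (Ordinal ik)).
    rewrite -scaleN1r (multilinearZ (@wedge_multilinear K V k)) replace_id scaleN1r.
    rewrite addrA subrr add0r big1 // => j /andP[/andP[jl ja] ji].
    rewrite -!val_eqE /= in ja ji.
    by rewrite /c mE !eqn_add2l (negPf ja) (negPf ji) (multilinear0 (@wedge_multilinear K V k)).
  have Hv : (H <= spanv v)%VS by apply: mkseq_span_sub.
  suff vE : spanv v = H by rewrite -vE zE zv in zH.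
  by apply/esym/eqP; rewrite eqEdim Hv dH dv /=.
have [phi [tE rk]] := NT_tangent lk b_free.
have B0 : wedge (fun i : 'I_k => B i) != 0.
  by rewrite wedge_nat_neq0 (indepW _ b_free) ?leq_addr.
(* All points of the decomposition are now the point of tangency, whose line contains no tangent
   vector of positive rank. *)
have [sGr] := s_dec; rewrite qb -memvE.
have /subvP sub : (\sum_(x <- s) val x <= <[wedge (fun i : 'I_k => B i)]>)%VS.
  rewrite big_seq; elim/big_ind: _ => [||x0 xs]; first exact: sub0v.
    by move=> U W UL WL; rewrite subv_add UL.
  have [v xv] := sGr x0 xs; have vE := s_H x0 v xs xv.
  have [|d d0 E] := wedge_same_span (is_pt_neq0 xv) (_ : _ = spanv (fun i : 'I_k => B i)).
    by rewrite vE spanv_nat.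
  by rewrite xv E vline_scale.
move=> /sub/vlineP[d]; rewrite tE.
by apply: tangent_vec_notin_line; rewrite // rk ltnW.
Qed.

End Identifiability.

(** * Points on secant lines *)

Section SecantCases.
Variables (K : fieldType) (V : vectType K) (k : nat).
Hypothesis k_gt1 : (1 < k)%N.
Implicit Types (b : nat -> V) (x y : 'I_k -> V).
Implicit Types (p q : proj (extpow V k)) (t : extpow V k).

Let k_gt0 : (0 < k)%N := ltnW k_gt1.

Lemma NS1_decomposable b : decomposable (NS k 1 b).
Proof.
have := line_decomposable k_gt0 b 1 1; rewrite !scale1r /NS.
by congr (decomposable (_ + wedge _)); apply: funext => i; rewrite addn1.
Qed.

(* [b_0 ^ b_1 ^ c + b_k ^ b_(k+1) ^ c] is tangent at [b_0 ^ b_(k+1) ^ c]. *)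
Lemma NS2_NT2 b : indep (k + 2) b -> exists2 c, indep (k + 2) c & NS k 2 b = NT k 2 c.
Proof.
move=> b_free; pose o0 := Ordinal k_gt0; pose o1 := Ordinal k_gt1.
pose b0 (i : 'I_k) := b i; pose y := replace (replace b0 o0 (b k)) o1 (b k.+1).
have [d dE] : exists d, wedge_nat k (fun i => b (i + 2)%N) = d *: wedge y.
  apply: wedge_spanv => i; have [ik|ki] := ltnP (i + 2) k.
    have := mem_spanv y (Ordinal ik); rewrite /y !replace_ne // -val_eqE /=; lia.
  have [E|E] : (i + 2 = k \/ i + 2 = k.+1)%N by have := ltn_ord i; lia.
    by rewrite E; have := mem_spanv y o0; rewrite /y replace_ne // replace_eq.
  by rewrite E; have := mem_spanv y o1; rewrite /y replace_eq.
have d0 : d != 0.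
  have : wedge_nat k (fun i => b (i + 2)%N) != 0 by rewrite wedge_nat_neq0 indep_shift.
  by rewrite dE; apply: contra => /eqP->; rewrite scale0r.
(* With [b 1] and [d *: b k.+1] exchanged, replacing slot 0 by [b k] gives the second window, and
   replacing slot 1 by [b 1] the first. *)
pose c j := if j == 1%N then d *: b k.+1 else if j == k.+1 then b 1%N else b j.
have c_neq j : j != 1%N -> j != k.+1 -> c j = b j by rewrite /c => /negPf-> /negPf->.
exists c.
  have cm := mem_mkseq_span c; apply: (indep_sub b_free) => j jk.
  have [->|j1] := eqVneq j 1%N.
    by have := cm (k + 2)%N k.+1; rewrite /c eqxx (_ : k.+1 == 1%N = false); [apply|]; lia.
  have [->|jk1] := eqVneq j k.+1; last by rewrite -c_neq ?cm.
  rewrite -[b _](scalerK d0) memvZ //.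
  by have := cm (k + 2)%N 1%N; rewrite /c eqxx; apply; lia.
rewrite /NS dE /NT (bigD1 o0) //= (bigD1 o1) //= big1 ?addr0 => [|i]; last first.
  rewrite -!val_eqE /= => /andP[/andP[i2 i0] i1].
  by case: (nat_of_ord i) i2 i0 i1 => [|[|]].
rewrite addn0 addn1 addrC; congr (_ + _); last first.
  rewrite /y -(multilinearZ (@wedge_multilinear K V k)); congr wedge.
  apply: funext => j; rewrite /replace -!val_eqE /= /b0.
  case: (eqVneq (j : nat) 1%N) => [->|j1] //=.
  case: eqP => [_|j0]; rewrite c_neq //; have := ltn_ord j; lia.
rewrite /wedge_nat; congr wedge; apply: funext => j; rewrite /replace -val_eqE /=.
case: (eqVneq (j : nat) 1%N) => [->|j1]; last by rewrite c_neq //; have := ltn_ord j; lia.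
by rewrite /c eqxx; case: eqP => //; lia.
Qed.

(** The distance [k - \dim (spanv x' :&: spanv y')] decides: at 0 or 1 the sum is decomposable, at 2
    it is tangent, from 3 on it is the secant normal form. *)
Lemma secant_cases q p1 p2 : Gr V k p1 -> Gr V k p2 -> (val q <= val p1 + val p2)%VS ->
  [\/ Gr V k q, exists2 b, indep (k + 2) b & is_pt q (NT k 2 b) |
    exists l b, [/\ (2 < l <= k)%N, indep (k + l) b & is_pt q (NS k l b)]].
Proof.
move=> [x px] [y py]; have [t qt] := is_pt_ex q.
rewrite qt px py -memvE => /memv_addP[_ /vlineP[a1 ->] [_ /vlineP[a2 ->] tE]].
move: tE; rewrite (wedge_scale (Ordinal k_gt0) x) (wedge_scale (Ordinal k_gt0) y).
set x' := replace x _ _; set y' := replace y _ _ => tE.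
have [x0|x0] := eqVneq (wedge x') 0.
  apply: Or31; apply/(Gr_decomposable k_gt0 qt); exists y'.
  by rewrite tE x0 add0r.
have [y0|y0] := eqVneq (wedge y') 0.
  apply: Or31; apply/(Gr_decomposable k_gt0 qt); exists x'.
  by rewrite tE y0 addr0.
have dk : (\dim (spanv x' :&: spanv y') <= k)%N.
  by rewrite -[X in (_ <= X)%N](dim_wedge x0) dimvS ?capvSl.
have := sum_NS k_gt0 _ x0 y0 (subnKC dk); move: (leq_subr (\dim (spanv x' :&: spanv y')) k).
case: (k - _)%N (subnKC dk) => [|[|[|l]]] dl lk H.
- apply: Or31; apply/(Gr_decomposable k_gt0 qt); rewrite tE.
  have [|a a0 ->] := @wedge_same_span _ _ _ x' y' x0.
    rewrite addn0 in dl; transitivity (spanv x' :&: spanv y')%VS; apply/eqP.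
      by rewrite eq_sym eqEdim capvSl (dim_wedge x0) dl /=.
    by rewrite eqEdim capvSr (dim_wedge y0) dl /=.
  by rewrite -[X in _ + X]scale1r -scalerDl; apply: decomposable_scale; [|exists y'].
- apply: Or31; apply/(Gr_decomposable k_gt0 qt); rewrite tE.
  by have [b _ ->] := H isT; apply: NS1_decomposable.
- apply: Or32; have [b b_free bE] := H isT; have [c c_free cE] := NS2_NT2 b_free.
  by exists c; rewrite // -cE -bE -tE.
- apply: Or33; have [b b_free bE] := H isT; exists l.+3, b.
  by split; rewrite // -bE -tE.
Qed.

End SecantCases.

(** * Places *)

Section Places.
Variables (K : closedFieldType) (L : fieldType) (iota : {rmorphism K -> L}).
Implicit Types (G : set (L * K)) (x y : L) (a b c : K).

(* The graph of a ring homomorphism to [K], identity on [K], from a subring of [L]. *)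
Record partial_hom G : Prop := PartialHom {
  phom_cst : forall c, G (iota c, c);
  phomD : forall x a y b, G (x, a) -> G (y, b) -> G (x + y, a + b);
  phomM : forall x a y b, G (x, a) -> G (y, b) -> G (x * y, a * b);
  phom0_eq : forall c, G (0, c) -> c = 0 }.

Definition maximal_phom G :=
  partial_hom G /\ forall G', partial_hom G' -> G `<=` G' -> G' `<=` G.

Lemma maximal_phom_exists G0 : partial_hom G0 ->
  exists2 G, maximal_phom G & G0 `<=` G.
Proof.
(* With [G0] united in the predicate, the empty chain also has an admissible union. *)
move=> hG0; have [|A [hA A_max]] := @Zorn_bigcup _ [set A | partial_hom (A `|` G0)].
  move=> F F_hom F_tot; have in2 u v : (\bigcup_(X in F) X `|` G0) u ->
      (\bigcup_(X in F) X `|` G0) v ->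
      exists A, [/\ partial_hom A, A `<=` \bigcup_(X in F) X `|` G0, A u & A v].
    have sub X : F X -> X `|` G0 `<=` \bigcup_(X in F) X `|` G0.
      by move=> FX w [Xw|Gw]; [left; exists X | right].
    move=> [[X FX Xu]|Gu] [[Y FY Yv]|Gv].
    - case: (F_tot X Y FX FY) => XY.
        by exists (Y `|` G0); split; [exact: F_hom|exact: sub|left; apply: XY|left].
      by exists (X `|` G0); split; [exact: F_hom|exact: sub|left|left; apply: XY].
    - by exists (X `|` G0); split; [exact: F_hom|exact: sub|left|right].
    - by exists (Y `|` G0); split; [exact: F_hom|exact: sub|right|left].
    - by exists G0; split=> // w; right.
  split=> [c|x a y b xa yb|x a y b xa yb|c c0].
  - by right; apply: phom_cst.
  - by have [A [hA A_sub Ax Ay]] := in2 _ _ xa yb; exact: (A_sub _ (phomD hA Ax Ay)).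
  - by have [A [hA A_sub Ax Ay]] := in2 _ _ xa yb; exact: (A_sub _ (phomM hA Ax Ay)).
  - by have [A [hA A_sub Ax Ay]] := in2 _ _ c0 c0; exact: (phom0_eq hA Ax).
exists (A `|` G0); last by move=> w; right.
split=> // G' hG' sub w G'w; apply: contrapT => Aw.
apply: (A_max G').
  split; first by move=> v Av; apply: sub; left.
  by move=> GA; apply: Aw; left; apply: GA.
suff E : G' `|` G0 = G' by rewrite /= E.
by apply/seteqP; split=> v; [case=> // G0v; apply: sub; right|left].
Qed.

Variables (G : set (L * K)).
Hypothesis G_max : maximal_phom G.
Let hG := proj1 G_max.

Definition place_dom x := exists a, G (x, a).

Lemma phom0 : G (0, 0).
Proof. by rewrite -[X in (X, _)](rmorph0 iota); apply: phom_cst. Qed.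

Lemma phom1 : G (1, 1).
Proof. by rewrite -[X in (X, _)](rmorph1 iota); apply: phom_cst. Qed.

Lemma phomN x a : G (x, a) -> G (- x, - a).
Proof.
move=> xa; rewrite -mulN1r -[X in (_, X)]mulN1r; apply: phomM => //.
by rewrite -(rmorph1 iota) -rmorphN; apply: phom_cst.
Qed.

Lemma phomB x a y b : G (x, a) -> G (y, b) -> G (x - y, a - b).
Proof. by move=> xa yb; apply: phomD => //; apply: phomN. Qed.

Lemma phomX x a n : G (x, a) -> G (x ^+ n, a ^+ n).
Proof.
move=> xa; elim: n => [|n IH]; first exact: phom1.
by rewrite !exprS; apply: phomM.
Qed.

Lemma phom_sum (I : Type) (r : seq I) (P : pred I) (F : I -> L) (f : I -> K) :
  (forall i, P i -> G (F i, f i)) ->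
  G (\sum_(i <- r | P i) F i, \sum_(i <- r | P i) f i).
Proof.
move=> Ff; elim: r => [|i r IH]; rewrite ?big_nil ?big_cons; first exact: phom0.
by case: ifP => // Pi; apply: phomD => //; apply: Ff.
Qed.

Lemma phom_sum0 (I : Type) (r : seq I) (P : pred I) (F : I -> L) :
  (forall i, P i -> G (F i, 0)) -> G (\sum_(i <- r | P i) F i, 0).
Proof.
by move=> F0; have := @phom_sum I r P F (fun=> 0) F0; rewrite [X in (_, X)]big1.
Qed.

Lemma phom_prod (I : Type) (r : seq I) (P : pred I) (F : I -> L) (f : I -> K) :
  (forall i, P i -> G (F i, f i)) ->
  G (\prod_(i <- r | P i) F i, \prod_(i <- r | P i) f i).
Proof.
move=> Ff; elim: r => [|i r IH]; rewrite ?big_nil ?big_cons; first exact: phom1.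
by case: ifP => // Pi; apply: phomM => //; apply: Ff.
Qed.

Lemma phom_inj x a b : G (x, a) -> G (x, b) -> a = b.
Proof.
move=> xa xb; apply/eqP; rewrite -subr_eq0; apply/eqP/(phom0_eq hG).
by rewrite -(subrr x); apply: phomB.
Qed.

(** Try to adjoin [x]. The residues of polynomials over the domain that vanish at [x] form an ideal
    [J] of [{poly K}]. A common zero [c] of [J] would extend the homomorphism by [x |-> c], against
    maximality; so [J] contains 1, the residue of some [f] with [f.[x] = 0], and [1 - f] is the
    relation. *)
Lemma place_dom_relation x : ~ place_dom x ->
  exists2 f : {poly L}, (forall i, G (f`_i, 0)) & f.[x] = 1.
Proof.
move=> x_dom.
pose PG (f : {poly L}) (g : {poly K}) := forall i, G (f`_i, g`_i).
have PGD f g f' g' : PG f g -> PG f' g' -> PG (f + f') (g + g').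
  by move=> fg fg' i; rewrite !coefD; apply: phomD.
have PGM f g f' g' : PG f g -> PG f' g' -> PG (f * f') (g * g').
  by move=> fg fg' i; rewrite !coefM; apply: phom_sum => j _; apply: phomM.
have PGiota h : PG (map_poly iota h) h.
  by move=> i; rewrite coef_map; apply: phom_cst.
pose J g := exists2 f, PG f g & f.[x] = 0.
have JD g h : J g -> J h -> J (g + h).
  move=> [f fg f0] [f' fh f0']; exists (f + f'); first exact: PGD.
  by rewrite hornerD f0 f0' addr0.
have JM g h : J g -> J (h * g).
  move=> [f fg f0]; exists (map_poly iota h * f); first exact: PGM.
  by rewrite hornerM f0 mulr0.
have [[f f1 f0]|J1] := pselect (J 1).
  exists (1 - f); last by rewrite hornerD hornerN f0 hornerC subr0.
  move=> i; rewrite coefB -(subrr ((1 : {poly K})`_i)); apply: phomB => //.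
  by rewrite !coef1; case: (_ == _); [exact: phom1|exact: phom0].
(* A nonzero element of least degree divides all of [J]; it is not constant, so it has a root. If
   [J] is 0, any [c] will do. *)
have [c Jc] : exists c, forall g, J g -> g.[c] = 0.
  have [[g0 Jg0 g00]|J0] := pselect (exists2 g, J g & g != 0); last first.
    exists 0 => g Jg; have [->|g0] := eqVneq g 0; first by rewrite horner0.
    by case: J0; exists g.
  have /ex_minnP[n /asboolP[g [Jg g_neq0 gn] n_min]] :
      exists n, `[< exists g, [/\ J g, g != 0 & size g = n] >].
    by exists (size g0); apply/asboolP; exists g0.
  have /closed_rootP[c gc] : size g != 1%N.
    apply/negP => /size_poly1P[d d0 gd]; apply: J1.
    by have := JM _ d^-1%:P Jg; rewrite gd -polyCM mulVf.
  exists c => h Jh; suff /eqP hg0 : h %% g == 0.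
    by rewrite (divp_eq h g) hg0 addr0 hornerM (rootP gc) mulr0.
  apply: contraT => hg.
  have : J (h %% g).
    rewrite (_ : h %% g = h + - (h %/ g) * g); first by apply: JD => //; apply: JM.
    by rewrite {2}(divp_eq h g) mulNr addrAC subrr add0r.
  move=> Jhg; have : (n <= size (h %% g)%R)%N.
    by apply: n_min; apply/asboolP; exists (h %% g).
  by rewrite -gn leqNgt ltn_modp g_neq0.
case: x_dom; exists c.
pose G' := [set u : L * K | exists f g, [/\ PG f g, u.1 = f.[x] & u.2 = g.[c]]].
apply: (proj2 G_max G').
- split=> [d|y a z b [f [g [fg /= -> ->]]] [f' [g' [fg' /= -> ->]]]
    |y a z b [f [g [fg /= -> ->]]] [f' [g' [fg' /= -> ->]]]|d [f [g [fg /= f0 ->]]]].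
  + by exists (map_poly iota d%:P), d%:P; split=> //=; rewrite ?map_polyC hornerC.
  + by exists (f + f'), (g + g'); split; rewrite ?hornerD //; apply: PGD.
  + by exists (f * f'), (g * g'); split; rewrite ?hornerM //; apply: PGM.
  + by apply: Jc; exists f.
- move=> [y a] ya; exists y%:P, a%:P; split=> /=; rewrite ?hornerC // => i.
  by rewrite !coefC; case: (_ == _); [|exact: phom0].
- exists 'X, 'X; split=> /=; rewrite ?hornerX // => i.
  by rewrite !coefX; case: (_ == _); [exact: phom1|exact: phom0].
Qed.

(** If [x^-1] were not finite, a relation [f.[x^-1] = 1] multiplied by [x ^+ size f] would give that
    power residue 0, although its residue is a power of [a]. *)
Lemma phomV x a : G (x, a) -> a != 0 -> G (x^-1, a^-1).
Proof.
move=> xa a0; have x0 : x != 0.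
  by apply: contra a0 => /eqP x0; rewrite x0 in xa; rewrite (phom0_eq hG xa).
suff [b xb] : place_dom x^-1.
  suff -> : a^-1 = b by [].
  have : G (1, a * b) by rewrite -(mulfV x0); apply: phomM.
  by move/(phom_inj phom1) => ab; rewrite -[b](mulKf a0) -ab mulr1.
apply: contrapT => /place_dom_relation[f f0 fx].
have := phomX (size f) xa; suff /phom_inj H : G (x ^+ size f, 0).
  by move=> /H /esym/eqP; rewrite expf_eq0 (negPf a0) andbF.
rewrite -[x ^+ _]mulr1 -fx horner_coef mulr_sumr.
apply: phom_sum0 => i _; rewrite mulrCA -[X in (_, X)](mul0r (a ^+ (size f - i))).
apply: phomM => //; rewrite -{1}(subnK (ltnW (ltn_ord i))) exprD -mulrA -exprMn.
by rewrite mulfV // expr1n mulr1; apply: phomX.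
Qed.

(* A relation for [x] of degree [n] is shortened by replacing [x ^+ n] with the
   expression obtained from a relation for [x^-1] of degree at most [n]. *)
Lemma relation_reduce x (F H : {poly L}) : x != 0 ->
  (forall i, G (F`_i, 0)) -> F.[x] = 1 ->
  (forall i, G (H`_i, 0)) -> H.[x^-1] = 1 -> (size H <= size F)%N ->
  exists F' : {poly L}, [/\ forall i, G (F'`_i, 0), F'.[x] = 1 & (size F' < size F)%N].
Proof.
move=> x0 F0 Fx H0 Hx HF.
have F_gt0 : (0 < size F)%N.
  rewrite lt0n size_poly_eq0; apply/eqP => F00.
  by move/eqP: Fx; rewrite F00 horner0 eq_sym oner_eq0.
pose n := (size F).-1; have nF : size F = n.+1 by rewrite prednK.
(* [u] has residue 1, so its inverse is finite. Multiplied by [x ^+ n], the relation [H.[x^-1] = 1]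
   expresses [x ^+ n * u] by lower powers of [x] with coefficients of residue 0. *)
pose u := 1 - H`_0; have u1 : G (u, 1).
  by rewrite -[X in (_, X)](subr0 1); apply: phomB => //; apply: phom1.
have u0 : u != 0.
  apply/eqP => u0; rewrite u0 in u1.
  by have /eqP := phom0_eq hG u1; rewrite oner_eq0.
have uE : x ^+ n * u = \sum_(j < n) H`_j.+1 * x ^+ (n - j.+1).
  have Hn : (size H <= n.+1)%N by rewrite -nF.
  rewrite /u -{1}Hx (horner_coef_wide _ Hn).
  rewrite big_ord_recl expr0 mulr1 addrC addKr mulr_sumr; apply: eq_bigr => j _.
  rewrite mulrCA; congr (_ * _); rewrite -{1}(subnK (ltn_ord j)) exprD -mulrA -exprMn.
  by rewrite mulfV // expr1n mulr1.
exists (take_poly n F + (F`_n * u^-1) *: \sum_(j < n) H`_j.+1 *: 'X^(n - j.+1)).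
have sumX (y : L) : (\sum_(j < n) H`_j.+1 *: 'X^(n - j.+1)).[y] =
    \sum_(j < n) H`_j.+1 * y ^+ (n - j.+1).
  by rewrite horner_sum; apply: eq_bigr => j _; rewrite hornerZ hornerXn.
split.
- move=> i; rewrite coefD coefZ coef_take_poly -[X in (_, X)](addr0 0); apply: phomD => //.
    by case: ifP => _; [exact: F0|exact: phom0].
  rewrite -[X in (_, X)](mulr0 (0 * 1^-1)); apply: phomM => //.
    exact: (phomM hG (F0 n) (phomV u1 (oner_neq0 K))).
  rewrite coef_sum; apply: phom_sum0 => j _.
  rewrite coefZ coefXn; case: (_ == _); rewrite ?mulr1 ?mulr0 //; exact: phom0.
- rewrite hornerD hornerZ sumX -uE mulrCA -!mulrA mulVf // mulr1 -Fx.
  rewrite [in RHS]horner_coef nF big_ord_recr /= mulrC; congr (_ + _).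
  rewrite (horner_coef_wide _ (size_take_poly n F)); apply: eq_bigr => i _.
  by rewrite coef_take_poly ltn_ord.
- rewrite nF ltnS (leq_trans (size_polyD _ _)) // geq_max size_take_poly.
  rewrite (leq_trans (size_scale_leq _ _)) // (leq_trans (size_sum _ _ _)) //.
  apply/bigmax_leqP => j _; rewrite (leq_trans (size_scale_leq _ _)) // size_polyXn.
  by have := ltn_ord j; lia.
Qed.

(** If neither [x] nor [x^-1] were finite, both would have relations of least degree, and the one of
    larger degree could be shortened by the other. If [x^-1] had a nonzero residue, [x] would be
    finite by [phomV]. *)
Lemma place_valuation x : ~ place_dom x -> G (x^-1, 0).
Proof.
move=> x_dom; have x0 : x != 0.
  by apply/eqP => x0; apply: x_dom; exists 0; rewrite x0; apply: phom0.
have [[b xb]|xV_dom] := pselect (place_dom x^-1).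
  have [<-//|b0] := eqVneq b 0; case: x_dom; exists b^-1.
  by rewrite -[x]invrK; apply: phomV.
pose rel y n := exists F : {poly L}, [/\ forall i, G (F`_i, 0), F.[y] = 1 & size F = n].
have min y : ~ place_dom y -> exists n, rel y n /\ forall m, rel y m -> (n <= m)%N.
  move=> /place_dom_relation[F F0 Fy].
  have /ex_minnP[n /asboolP nP n_min] : exists n, `[< rel y n >].
    by exists (size F); apply/asboolP; exists F.
  by exists n; split=> // m /asboolP/n_min.
have [n [[F [F0 Fx Fn]] n_min]] := min x x_dom.
have [m [[H [H0 Hx Hm]] m_min]] := min _ xV_dom.
case: (leqP m n) => mn.
  have [|F' [F0' Fx' sF']] := relation_reduce x0 F0 Fx H0 Hx; first by rewrite Fn Hm.
  by have := n_min _ (ex_intro _ F' (And3 F0' Fx' erefl)); rewrite leqNgt -Fn sF'.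
have Fx2 : F.[x^-1^-1] = 1 by rewrite invrK.
have [||F' [F0' Fx' sF']] := relation_reduce _ H0 Hx F0 Fx2.
- by rewrite invr_eq0.
- by rewrite Fn Hm ltnW.
by have := m_min _ (ex_intro _ F' (And3 F0' Fx' erefl)); rewrite leqNgt -Hm sF'.
Qed.

End Places.

(** * Maximal minors of matrices *)

Section Minors.
Variables (k n : nat).
Implicit Types (f g : {ffun 'I_k -> 'I_n}).

(** Columns are chosen by an arbitrary map [f], so that exchanging one of them requires no
    reordering. *)
Definition minor (R : comNzRingType) (X : 'M[R]_(k, n)) f : R :=
  \det (\matrix_(i, j) X i (f j)).

Definition set_row (R : nzRingType) (X Z : 'M[R]_(k, n)) (m : 'I_k) : 'M[R]_(k, n) :=
  \matrix_(i, j) if i == m then Z i j else X i j.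

Definition fupd f (i : 'I_k) (j : 'I_n) : {ffun 'I_k -> 'I_n} :=
  [ffun c => if c == i then j else f c].

Lemma minor_mul (R : comNzRingType) (A : 'M[R]_k) (X : 'M[R]_(k, n)) f :
  minor (A *m X) f = \det A * minor X f.
Proof.
rewrite /minor -det_mulmx; congr (\det _); apply/matrixP => i j.
by rewrite !mxE; apply: eq_bigr => m _; rewrite mxE.
Qed.

Lemma minor_row (R : comNzRingType) (X Y Z : 'M[R]_(k, n)) (m : 'I_k) (a b : R) f :
  (forall j, X m j = a * Y m j + b * Z m j) ->
  (forall i j, i != m -> X i j = Y i j) -> (forall i j, i != m -> X i j = Z i j) ->
  minor X f = a * minor Y f + b * minor Z f.
Proof.
move=> Xm XY XZ; apply: (determinant_multilinear (i0 := m)).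
- by apply/rowP => j; rewrite !mxE.
- by apply/matrixP => i j; rewrite !mxE XY // eq_sym neq_lift.
- by apply/matrixP => i j; rewrite !mxE XZ // eq_sym neq_lift.
Qed.

Lemma minor1 (R : comNzRingType) (X : 'M[R]_(k, n)) f :
  (forall i j, X i (f j) = (i == j)%:R) -> minor X f = 1.
Proof.
move=> X1; rewrite /minor -(det1 R k); congr (\det _).
by apply/matrixP => i j; rewrite !mxE X1.
Qed.

(** In the affine chart of the Grassmannian at [f], the entries of the normalized matrix are
    themselves Pluecker coordinates: expand along column [i], where the cofactors are those of the
    identity. *)
Lemma minor_fupd (R : comNzRingType) (X : 'M[R]_(k, n)) f i j :
  (forall r c, X r (f c) = (r == c)%:R) -> minor X (fupd f i j) = X i j.
Proof.
move=> X1; rewrite /minor (expand_det_col _ i).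
transitivity (\sum_r X r j * cofactor (1%:M : 'M[R]_k) r i).
  apply: eq_bigr => r _; rewrite mxE ffunE eqxx; congr (_ * _).
  rewrite /cofactor; congr (_ * \det _); apply/matrixP => a b.
  by rewrite !mxE ffunE eq_sym (negPf (neq_lift _ _)) X1.
have adj1 : \adj (1%:M : 'M[R]_k) = 1%:M.
  by rewrite -[LHS]mul1mx mul_mx_adj det1.
rewrite (bigD1 i) //= big1 => [|r ri]; last first.
  have -> : cofactor (1%:M : 'M[R]_k) r i = (\adj (1%:M : 'M[R]_k)) i r by rewrite mxE.
  by rewrite adj1 mxE eq_sym (negPf ri) mulr0.
have -> : cofactor (1%:M : 'M[R]_k) i i = (\adj (1%:M : 'M[R]_k)) i i by rewrite mxE.
by rewrite adj1 mxE eqxx mulr1 addr0.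
Qed.

(* Row reduction at the columns [f] and Cramer's rule. *)
Lemma minor_normalize (F : fieldType) (X : 'M[F]_(k, n)) f : minor X f != 0 ->
  exists Y : 'M[F]_(k, n), [/\ forall g, minor Y g = minor X g / minor X f,
    forall r c, Y r (f c) = (r == c)%:R &
    forall i j, Y i j = minor X (fupd f i j) / minor X f].
Proof.
move=> Xf; pose M := \matrix_(i, j) X i (f j).
have MU : M \in unitmx by rewrite unitmxE unitfE.
have YE g : minor (invmx M *m X) g = minor X g / minor X f.
  by rewrite minor_mul det_inv mulrC.
have Y1 r c : (invmx M *m X) r (f c) = (r == c)%:R.
  have /matrixP/(_ r c) := mulVmx MU; rewrite !mxE => <-.
  by apply: eq_bigr => m _; rewrite !mxE.
by exists (invmx M *m X); split=> // i j; rewrite -YE minor_fupd.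
Qed.

End Minors.

(** * Specialization of a sum of two decomposable vectors *)

Section Degeneration.
Variables (K : closedFieldType) (L : fieldType) (iota : {rmorphism K -> L}).
Variable G : set (L * K).
Hypothesis G_max : maximal_phom iota G.
Variables (k n : nat).
Implicit Types (f g : {ffun 'I_k -> 'I_n}).
Let hG := proj1 G_max.

Lemma phom_minor (X : 'M[L]_(k, n)) (A : 'M[K]_(k, n)) f :
  (forall i j, G (X i j, A i j)) -> G (minor X f, minor A f).
Proof.
move=> XA; apply: (phom_sum G_max) => s _; apply: (phomM hG).
  by apply: (phomX G_max); apply: (phomN G_max); apply: (phom1 G_max).
by apply: (phom_prod G_max) => i _; rewrite !mxE.
Qed.

(** If [z / x] is not finite, then [x / z] has residue 0, and [z] dominates whatever [x]
    dominated. *)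
Lemma dominant_element (s : seq L) : (exists2 x, x \in s & x != 0) ->
  exists x, [/\ x \in s, x != 0 & forall y, y \in s -> place_dom G (y / x)].
Proof.
have dom0 : place_dom G 0 by exists 0; apply: (phom0 G_max).
have dom1 : place_dom G 1 by exists 1; apply: (phom1 G_max).
elim: s => [|z s IH] [w ws w0]; first by rewrite in_nil in ws.
have [[v vs v0]|s0] := pselect (exists2 x, x \in s & x != 0); last first.
  have s0' y : y \in s -> y = 0.
    by move=> ys; apply: contrapT => /eqP y0; apply: s0; exists y.
  exists z; have z0 : z != 0.
    by move: ws; rewrite inE => /orP[/eqP<-//|/s0' wE]; rewrite wE eqxx in w0.
  split; rewrite ?mem_head // => y; rewrite inE => /orP[/eqP->|/s0'->].
    by rewrite divff.
  by rewrite mul0r.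
have [x [xs x0 x_dom]] := IH (ex_intro2 _ _ v vs v0).
have [z_dom|z_dom] := pselect (place_dom G (z / x)).
  exists x; rewrite inE xs orbT; split=> // y.
  by rewrite inE => /orP[/eqP->//|]; apply: x_dom.
have := place_valuation G_max z_dom; rewrite invf_div => zx.
have z0 : z != 0 by apply: contra_not_neq z_dom => ->; rewrite mul0r.
exists z; rewrite mem_head; split=> // y; rewrite inE => /orP[/eqP->|/x_dom[b yb]].
  by rewrite divff.
have -> : y / z = (y / x) * (x / z) by rewrite mulrA divfK.
by exists (b * 0); apply: (phomM hG).
Qed.

(** Properness of the Grassmannian: normalized at a dominant minor, the entries are quotients of
    minors by it, hence finite. *)
Lemma minor_residue (X : 'M[L]_(k, n)) : (exists f, minor X f != 0) ->
  exists f X' (A : 'M[K]_(k, n)), [/\ minor X f != 0,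
    forall g, minor X g = minor X f * minor X' g,
    forall i j, X' i (f j) = (i == j)%:R & forall i j, G (X' i j, A i j)].
Proof.
move=> [f0 Xf0].
have [|x [/mapP[f _ ->] Xf f_dom]] := @dominant_element [seq minor X f | f <- enum {ffun 'I_k -> 'I_n}].
  by exists (minor X f0) => //; apply: map_f; rewrite mem_enum.
have [X' [X'E X'1 X'ij]] := minor_normalize Xf.
have /choice[A AE] : forall ij : 'I_k * 'I_n, exists a, G (X' ij.1 ij.2, a).
  by move=> [i j] /=; rewrite X'ij; apply: f_dom; apply: map_f; rewrite mem_enum.
exists f, X', (\matrix_(i, j) A (i, j)); split=> // [g|i j]; first by rewrite X'E mulrC divfK.
by rewrite mxE; apply: (AE (i, j)).
Qed.

Lemma decomposable_residue (X : 'M[L]_(k, n)) (t : {ffun 'I_k -> 'I_n} -> K) :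
  (forall f, G (minor X f, t f)) -> (exists f, minor X f != 0) ->
  exists (A : 'M[K]_(k, n)) a, forall f, t f = a * minor A f.
Proof.
move=> Xt /minor_residue[f [X' [A [Xf XX' _ XA]]]].
exists A, (t f) => g; apply: (phom_inj G_max (Xt g)).
by rewrite XX'; apply: (phomM hG) => //; apply: phom_minor.
Qed.

(* Normalizing each of [X] and [Y] at a dominant minor makes their entries integral.
   If the residues [A] and [B] have independent Pluecker vectors, the two
   coefficients are integral by Cramer's rule. Otherwise [X] and [Y] can be
   normalized at the same columns, with the same residue, and the expansion of the
   minors of [Y = X + (Y - X)] row by row leaves a tangent vector. *)
Lemma degeneration (X Y : 'M[L]_(k, n)) (t : {ffun 'I_k -> 'I_n} -> K) :
  (forall f, G (minor X f + minor Y f, t f)) -> (exists f, t f != 0) ->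
  (exists (A B : 'M[K]_(k, n)) a b, forall f, t f = a * minor A f + b * minor B f) \/
  (exists (A Z : 'M[K]_(k, n)) c, (exists f, minor A f != 0) /\ forall f,
     t f = c * minor A f + \sum_i minor (set_row A Z i) f).
Proof.
move=> XYt [f1 tf1].
have [X0|X0] := pselect (exists f, minor X f != 0); last first.
  left; have {}X0 f : minor X f = 0.
    by apply: contrapT => /eqP Xf; apply: X0; exists f.
  have Yt f : G (minor Y f, t f) by have := XYt f; rewrite X0 add0r.
  have [|A [a tE]] := decomposable_residue Yt.
    exists f1; apply: contra tf1 => /eqP Y0; apply/eqP/(phom0_eq hG).
    by rewrite -Y0.
  by exists A, A, a, 0 => f; rewrite tE mul0r addr0.
have [Y0|Y0] := pselect (exists f, minor Y f != 0); last first.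
  left; have {}Y0 f : minor Y f = 0.
    by apply: contrapT => /eqP Yf; apply: Y0; exists f.
  have Xt f : G (minor X f, t f) by have := XYt f; rewrite Y0 addr0.
  have [A [a tE]] := decomposable_residue Xt X0.
  by exists A, A, a, 0 => f; rewrite tE mul0r addr0.
have [f [X' [A [Xf XX' X'1 XA]]]] := minor_residue X0.
have [g [Y' [B [Yg YY' Y'1 YB]]]] := minor_residue Y0.
set al := minor X f in XX'; set be := minor Y g in YY'.
have mX h := phom_minor h XA; have mY h := phom_minor h YB.
have p h : G (al * minor X' h + be * minor Y' h, t h) by rewrite -XX' -YY'.
have Af : minor A f = 1.
  by apply/esym/(phom_inj G_max (phom1 G_max)); rewrite -(minor1 X'1).
have Bg : minor B g = 1.
  by apply/esym/(phom_inj G_max (phom1 G_max)); rewrite -(minor1 Y'1).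
have [[h [h' D0]]|AB] := pselect (exists h h',
    minor A h * minor B h' - minor A h' * minor B h != 0).
  left; set D := _ - _ in D0.
  pose D' := minor X' h * minor Y' h' - minor X' h' * minor Y' h.
  have DD : G (D', D) by apply: (phomB G_max); apply: (phomM hG).
  have D'0 : D' != 0.
    by apply: contra D0 => /eqP E; apply/eqP/(phom0_eq hG); rewrite -E.
  have [a al_a] : place_dom G al.
    exists ((t h * minor B h' - t h' * minor B h) / D).
    have -> : al = ((al * minor X' h + be * minor Y' h) * minor Y' h' -
        (al * minor X' h' + be * minor Y' h') * minor Y' h) / D'.
      by apply: (canRL (mulfK D'0)); rewrite /D'; ring.
    apply: (phomM hG); last exact: (phomV G_max).
    by apply: (phomB G_max); apply: (phomM hG).
  have [b be_b] : place_dom G be.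
    exists ((minor A h * t h' - minor A h' * t h) / D).
    have -> : be = (minor X' h * (al * minor X' h' + be * minor Y' h') -
        minor X' h' * (al * minor X' h + be * minor Y' h)) / D'.
      by apply: (canRL (mulfK D'0)); rewrite /D'; ring.
    apply: (phomM hG); last exact: (phomV G_max).
    by apply: (phomB G_max); apply: (phomM hG).
  exists A, B, a, b => f'; apply: (phom_inj G_max (p f')).
  by apply: (phomD hG); apply: (phomM hG).
(* All 2 x 2 minors of the pair of Pluecker vectors vanish, and [minor A f = 1]. *)
right; have {}AB h : minor A h * minor B f = minor B h.
  apply/eqP; rewrite -subr_eq0; apply: contrapT => /negP E; apply: AB.
  by exists h, f; rewrite Af mul1r.
have Bf : minor B f != 0.
  by apply/eqP => Bf; have := AB g; rewrite Bf Bg mulr0 => /esym/eqP; rewrite oner_eq0.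
have Y'f : minor Y' f != 0.
  by apply: contra Bf => /eqP E; apply/eqP/(phom0_eq hG); rewrite -E.
(* [Y'] is renormalized at the columns [f] of [X']; since [minor B f != 0], the minors of [W] stay
   finite, with those of [A] as residues. *)
have [W [WE W1 Wij]] := minor_normalize Y'f.
have mW h : G (minor W h, minor A h).
  rewrite WE -[minor A h](mulfK Bf) AB; apply: (phomM hG) => //.
  exact: (phomV G_max).
have WA i j : G (W i j, A i j).
  have -> : A i j = minor A (fupd f i j).
    apply: (phom_inj G_max (XA i j)); rewrite -(minor_fupd i j X'1); exact: mX.
  by rewrite -(minor_fupd i j W1).
pose ga := be * minor Y' f.
have {}p h : G (al * minor X' h + ga * minor W h, t h).
  by rewrite WE /ga -mulrA [minor Y' f * _]mulrC divfK.
have c_val : G (al + ga, t f).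
  by have := p f; rewrite (minor1 X'1) (minor1 W1) !mulr1.
(* Even if [ga] is not finite, [ga * (W - X')] is: at the columns [fupd f i j] the given sum is
   [al * X' + ga * W], from which the finite [(al + ga) * X'] is subtracted. *)
have /choice[Z ZE] : forall ij : 'I_k * 'I_n, exists z,
    G (ga * (W ij.1 ij.2 - X' ij.1 ij.2), z).
  move=> [i j] /=; exists (t (fupd f i j) - t f * A i j).
  have := phomB G_max (p (fupd f i j)) (phomM hG c_val (XA i j)).
  rewrite (minor_fupd i j X'1) (minor_fupd i j W1); congr (G (_, _)); ring.
exists A, (\matrix_(i, j) Z (i, j)), (t f); split=> [|h].
  by exists f; rewrite Af oner_neq0.
(* [H m] takes its first [m] rows from [W] and the others from [X']. Telescoping over [m] changes
   one row at a time by [W - X']; as [W] and [X'] have the same residue, each change leaves one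
   tangent term. *)
pose H m : 'M[L]_(k, n) := \matrix_(i, j) if (i < m)%N then W i j else X' i j.
pose T (m : 'I_k) : 'M[L]_(k, n) :=
  \matrix_(i, j) if i == m then ga * (W i j - X' i j) else H m i j.
have HT (m : 'I_k) : ga * minor (H m.+1) h - ga * minor (H m) h = minor (T m) h.
  rewrite -mulNr; apply/esym/(minor_row (m := m)) => [j|i j im|i j im].
  - by rewrite !mxE eqxx ltnn ltnS leqnn mulNr mulrBr.
  - by rewrite !mxE (negPf im) ltnS [(i <= m)%N]leq_eqVlt (inj_eq val_inj) (negPf im).
  - by rewrite !mxE (negPf im).
apply: (phom_inj G_max (p h)).
have -> : al * minor X' h + ga * minor W h = (al + ga) * minor X' h + \sum_m minor (T m) h.
  rewrite -(eq_bigr _ (fun m _ => HT m)).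
  rewrite -(big_mkord xpredT (fun m => ga * minor (H m.+1) h - ga * minor (H m) h)).
  rewrite telescope_sumr //.
  have -> : H k = W by apply/matrixP => i j; rewrite mxE ltn_ord.
  have -> : H 0%N = X' by apply/matrixP => i j; rewrite mxE.
  by ring.
apply: (phomD hG); first by apply: (phomM hG).
apply: (phom_sum G_max) => m _; apply: phom_minor => i j; rewrite !mxE.
case: eqP => _; first exact: (ZE (i, j)).
by case: ifP.
Qed.

End Degeneration.

(** * The closure of the secant points *)

Section HomogeneousParts.
Variables (K : fieldType) (N : nat).
Hypothesis char0 : [pchar K] =i pred0.
Implicit Types (F : {mpoly K[N]}) (v : 'I_N -> K).

Lemma homog_meval_scale d F v a : F \is d.-homog ->
  F.@[fun i => a * v i] = a ^+ d * F.@[v].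
Proof.
move=> /dhomogP F_homog; rewrite !mevalE mulr_sumr big_seq [RHS]big_seq.
apply: eq_bigr => m /F_homog /= md; rewrite mulrCA; congr (_ * _).
rewrite -md mdegE -prodrXr -big_split; apply: eq_bigr => i _ /=.
by rewrite exprMn.
Qed.

(** On the line through [v], [F] is a polynomial in [a] whose coefficients are the values of its
    homogeneous parts; it has all natural numbers as roots. *)
Lemma homog_part_eq0 F v d : (forall a, F.@[fun i => a * v i] = 0) ->
  (pihomog mdeg d F).@[v] = 0.
Proof.
move=> F0; pose D := maxn d.+1 (mmeasure mdeg F).
pose Q := \poly_(i < D) (pihomog mdeg i F).@[v].
have Q0 a : Q.[a] = 0.
  have FE : F = \sum_(i < D) pihomog mdeg i F by apply: pihomog_partitionE; apply: leq_maxr.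
  rewrite horner_poly -[RHS](F0 a) [in RHS]FE raddf_sum; apply: eq_bigr => i _ /=.
  by rewrite (homog_meval_scale _ _ (pihomogP _ _ _)) mulrC.
have -> : (pihomog mdeg d F).@[v] = Q`_d by rewrite coef_poly leq_maxl.
suff -> : Q = 0 by rewrite coef0.
apply/eqP; apply: contraT => Qn0.
have := max_poly_roots (rs := [seq i%:R | i <- iota 0 (size Q)]) Qn0.
rewrite size_map size_iota ltnn; apply.
  by apply/allP => _ /mapP[i _ ->]; apply/rootP/Q0.
by rewrite map_inj_uniq ?iota_uniq //; apply: pchar0_natr_inj.
Qed.

End HomogeneousParts.

Section MinorSymmetry.
Variables (k n : nat).
Implicit Types (f : {ffun 'I_k -> 'I_n}).

Lemma minor_map (R S : comNzRingType) (phi : {rmorphism R -> S}) (X : 'M[R]_(k, n)) f :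
  minor (map_mx phi X) f = phi (minor X f).
Proof.
by rewrite /minor -det_map_mx; congr (\det _); apply/matrixP => i j; rewrite !mxE.
Qed.

Lemma minor_not_inj (R : comNzRingType) (X : 'M[R]_(k, n)) f : ~~ injectiveb f ->
  minor X f = 0.
Proof.
move=> /injectivePn[i [j ij fij]]; rewrite /minor -det_tr.
by apply: (determinant_alternate ij) => m; rewrite !mxE fij.
Qed.

Lemma minor_perm (R : comNzRingType) (X : 'M[R]_(k, n)) f (s : 'S_k) :
  minor X f = (-1) ^+ s * minor X [ffun i => f (s i)].
Proof.
have -> : minor X [ffun i => f (s i)] = \det (col_perm s (\matrix_(i, j) X i (f j))).
  by congr (\det _); apply/matrixP => i j; rewrite !mxE ffunE.
rewrite col_permE det_mulmx det_perm odd_permV mulrCA -signr_addb addbb expr0 mulr1.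
by [].
Qed.

End MinorSymmetry.

Section Coordinates.
Variables (K : fieldType) (V : vectType K) (k : nat).
Local Notation n := (\dim {:V}).
Local Notation e := (vbasis {:V}).

Definition row_vectors (A : 'M[K]_(k, n)) : 'I_k -> V := fun i => \sum_j A i j *: e`_j.

Lemma coord_row_vectors A i j : coord e j (row_vectors A i) = A i j.
Proof. by rewrite /row_vectors coord_sum_free // (basis_free (vbasisP _)). Qed.

Lemma wedge_row_vectors A (I : multiindex V k) : wedge (row_vectors A) I = minor A (val I).
Proof.
by rewrite ffunE; congr (\det _); apply/matrixP => i j; rewrite !mxE coord_row_vectors.
Qed.

Lemma row_vectors_surj (x : 'I_k -> V) : exists A, x = row_vectors A.
Proof.
exists (\matrix_(i, j) coord e j (x i)); apply: funext => i.
rewrite {1}(coord_vbasis (memvf (x i))); apply: eq_bigr => j _.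
by rewrite mxE.
Qed.

Lemma row_vectors_set_row A Z i : row_vectors (set_row A Z i) =
  replace (row_vectors A) i (row_vectors Z i).
Proof.
apply: funext => j; rewrite /replace /row_vectors; case: eqP => [->|/eqP ji].
  by apply: eq_bigr => m _; rewrite mxE eqxx.
by apply: eq_bigr => m _; rewrite mxE (negPf ji).
Qed.

(** A nonzero minor is, up to sign, one at an increasing multi-index, which is a coordinate of the
    wedge. *)
Lemma minor_wedge_neq0 A f : minor A f != 0 -> wedge (row_vectors A) != 0.
Proof.
apply: contra => /eqP w0.
have [/injectiveP f_inj|f_inj] := boolP (injectiveb f); last first.
  by rewrite minor_not_inj.
have [s s_inc] := increasing_perm f_inj.
rewrite (minor_perm A f s); have := wedge_row_vectors A (Sub _ s_inc).
by rewrite w0 ffunE => <-; rewrite mulr0.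
Qed.

End Coordinates.

(** * The generic secant vector and its specializations *)

Section SecantClosure.
Variables (K : closedFieldType) (V : vectType K) (k : nat).
Hypothesis char0 : [pchar K] =i pred0.
Hypothesis k_gt1 : (1 < k)%N.
Let k_gt0 := ltnW k_gt1.
Local Notation n := (\dim {:V}).
Local Notation E := (extpow V k).
Local Notation N := (\dim {:E}).

Definition coords (t : E) : 'I_N -> K := fun i => coord (vbasis {:E}) i t.

(** The closure tests forms only, but the secant cone is stable under scaling, so each homogeneous
    part of [F] vanishes on it and hence at [t]. *)
Lemma secant_closure_meval q t (F : {mpoly K[N]}) : sigma2 (Gr V k) q -> is_pt q t ->
  (forall x y : 'I_k -> V, F.@[coords (wedge x + wedge y)] = 0) -> F.@[coords t] = 0.
Proof.
move=> q_sigma qt F0.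
have -> : F = \sum_(d < mmeasure mdeg F) pihomog mdeg d F.
  by apply: pihomog_partitionE; apply: leqnn.
rewrite raddf_sum.
apply: big1 => d _ /=; apply: (q_sigma d _ (pihomogP _ _ _)); last by rewrite qt memv_line.
move=> z [p1 [p2 [[x px] [y py] zp]]] u uz; apply: homog_part_eq0 => // a.
have : u \in (val p1 + val p2)%VS by apply: subvP zp _ uz.
rewrite px py => /memv_addP[_ /vlineP[a1 ->] [_ /vlineP[a2 ->] uE]].
rewrite -(F0 (replace x (Ordinal k_gt0) ((a * a1) *: x (Ordinal k_gt0)))
  (replace y (Ordinal k_gt0) ((a * a2) *: y (Ordinal k_gt0)))).
apply: meval_eq => i; rewrite -!wedge_scale /coords -!scalerA -scalerDr -uE.
by rewrite linearZ.
Qed.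

Local Notation T := (bool * 'I_k * 'I_n)%type.
Local Notation R := {mpoly K[#|{: T}|]}.

Definition generic (b : bool) : 'M[R]_(k, n) :=
  \matrix_(i, j) 'X_(enum_rank ((b, i, j) : T)).

Definition point (A B : 'M[K]_(k, n)) (m : 'I_#|{: T}|) : K :=
  let: (b, i, j) := enum_val m in if b then A i j else B i j.

Lemma point_generic A B b : map_mx (meval (point A B)) (generic b) = if b then A else B.
Proof.
apply/matrixP => i j; rewrite !mxE mevalXU /point enum_rankK.
by case: b.
Qed.

Definition generic_secant (f : {ffun 'I_k -> 'I_n}) : R :=
  minor (generic true) f + minor (generic false) f.

Lemma meval_generic_secant A B f :
  (generic_secant f).@[point A B] = minor A f + minor B f.
Proof.
have E b : (minor (generic b) f).@[point A B] = minor (if b then A else B) f.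
  by rewrite -(minor_map (meval (point A B))) point_generic.
exact: etrans (mevalD _ _ _) (congr2 +%R (E true) (E false)).
Qed.

(** The vectors e_I. Polynomials on the exterior power are written in the unspecified basis
    [vbasis {:E}], so the two bases have to be compared. *)
Definition basis_vec (I : multiindex V k) : E := [ffun J => (I == J)%:R].

Lemma extpow_basis (t : E) : t = \sum_I (t I : K) *: basis_vec I.
Proof.
apply/ffunP => J; rewrite sum_ffunE (bigD1 J) //= big1 ?addr0 => [|I IJ].
  by rewrite !ffunE eqxx [_ *: _]mulr1.
by rewrite !ffunE (negPf IJ) [_ *: _]mulr0.
Qed.

Definition generic_coords : N.-tuple R :=
  [tuple \sum_(I : multiindex V k) (coords (basis_vec I) i) *: generic_secant (val I) | i < N].

Lemma meval_generic_coords A B i : (tnth generic_coords i).@[point A B] =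
  coords (wedge (row_vectors A) + wedge (row_vectors B)) i.
Proof.
rewrite tnth_mktuple raddf_sum /coords [X in coord _ _ X]extpow_basis linear_sum.
apply: eq_bigr => I _; rewrite /= mevalZ meval_generic_secant linearZ /= mulrC.
congr (_ * _); rewrite -!wedge_row_vectors.
by apply/esym; rewrite ffunE.
Qed.

Definition coordinate_form (I : multiindex V k) : {mpoly K[N]} :=
  \sum_(i < N) ((vbasis {:E})`_i I : K) *: 'X_i.

Lemma meval_coordinate_form I t : (coordinate_form I).@[coords t] = t I.
Proof.
rewrite raddf_sum [in RHS](coord_vbasis (memvf t)) sum_ffunE.
by apply: eq_bigr => i _; rewrite /= mevalZ mevalXU mulrC ffunE.
Qed.

(** The change of basis from the [basis_vec J] to [vbasis {:E}], composed with its inverse. *)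
Lemma dual_basis_sum (W : lmodType K) (w : multiindex V k -> W) I :
  \sum_(i < N) ((vbasis {:E})`_i I : K) *: \sum_J coords (basis_vec J) i *: w J = w I.
Proof.
under eq_bigr do rewrite scaler_sumr.
rewrite exchange_big /= (bigD1 I) //= [X in _ + X]big1 ?addr0 => [|J JI].
  under eq_bigr do rewrite scalerA mulrC.
  rewrite -scaler_suml; have /ffunP/(_ I) := coord_vbasis (memvf (basis_vec I)).
  rewrite sum_ffunE ffunE eqxx => E1; rewrite -[RHS]scale1r; congr (_ *: _).
  by apply: etrans (esym E1); apply: eq_bigr => i _; rewrite ffunE.
under eq_bigr do rewrite scalerA mulrC.
rewrite -scaler_suml; have /ffunP/(_ I) := coord_vbasis (memvf (basis_vec J)).
rewrite sum_ffunE ffunE (negPf JI) => E0; rewrite -[RHS](scale0r (w J)); congr (_ *: _).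
by apply: etrans (esym E0); apply: eq_bigr => i _; rewrite ffunE.
Qed.

Lemma comp_coordinate_form I :
  coordinate_form I \mPo generic_coords = generic_secant (val I).
Proof.
rewrite -(dual_basis_sum (fun J => generic_secant (val J)) I) raddf_sum.
apply: eq_bigr => i _.
by rewrite [LHS]comp_mpolyZ comp_mpolyXU -(tnth_nth 0 generic_coords) tnth_mktuple.
Qed.

(** A polynomial vanishing at the generic secant vector vanishes at all sums of two decomposable
    vectors, hence at [t]. So its value at the generic vector may be assigned its value at [t] as
    residue, and this partial homomorphism extends to a maximal one. *)
Lemma secant_place q t : sigma2 (Gr V k) q -> is_pt q t ->
  exists (L : fieldType) (iota : {rmorphism K -> L}) G (X Y : 'M[L]_(k, n)),
    maximal_phom iota G /\
    forall I : multiindex V k, G (minor X (val I) + minor Y (val I), t I).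
Proof.
move=> q_sigma qt; pose L : fieldType := {fraction R}.
pose iota : {rmorphism K -> L} := @tofrac R \o @mpolyC #|{: T}| K.
pose psi := comp_mpoly generic_coords.
pose G0 := [set u : L * K | exists F, u.1 = tofrac (psi F) /\ u.2 = F.@[coords t]].
have hG0 : partial_hom iota G0.
  split=> [c|x a y b [F [/= -> ->]] [F' [/= -> ->]]|x a y b [F [/= -> ->]] [F' [/= -> ->]]|c [F [/= F0 ->]]].
  - by exists c%:MP; rewrite /psi comp_mpolyC mevalC.
  - by exists (F + F'); rewrite /psi !rmorphD.
  - by exists (F * F'); rewrite /psi !rmorphM.
  have {}F0 : psi F = 0 by apply/eqP; rewrite -tofrac_eq0 -F0.
  apply: (secant_closure_meval q_sigma qt) => x y.
  have [A ->] := row_vectors_surj x; have [B ->] := row_vectors_surj y.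
  have := congr1 (meval (point A B)) F0; rewrite comp_mpoly_meval meval0 => <-.
  by apply: meval_eq => i; rewrite meval_generic_coords.
have [G G_max G0G] := maximal_phom_exists hG0.
exists L, iota, G, (map_mx (@tofrac R) (generic true)), (map_mx (@tofrac R) (generic false)).
split=> // I; apply: G0G; exists (coordinate_form I); split=> /=.
  by rewrite /psi comp_coordinate_form !minor_map -rmorphD.
by rewrite meval_coordinate_form.
Qed.

Lemma sigma2_cases q : sigma2 (Gr V k) q ->
  (exists p1 p2, [/\ Gr V k p1, Gr V k p2 & (val q <= val p1 + val p2)%VS]) \/ tau V k q.
Proof.
move=> q_sigma; have [t qt] := is_pt_ex q.
have [L [iota [G [X [Y [G_max XYt]]]]]] := secant_place q_sigma qt.
(* [t] provides residues at increasing multi-indices only; symmetry of the minors provides those at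
   all other maps. *)
have /choice[u uE] : forall f : {ffun 'I_k -> 'I_n}, exists a, G (minor X f + minor Y f, a).
  move=> f; have [/injectiveP f_inj|f_inj] := boolP (injectiveb f); last first.
    by exists 0; rewrite !minor_not_inj // addr0; apply: (phom0 G_max).
  have [s s_inc] := increasing_perm f_inj; pose I : multiindex V k := Sub _ s_inc.
  exists ((-1) ^+ s * t I); rewrite !(minor_perm _ f s) -mulrDr.
  apply: (phomM (proj1 G_max)); last exact: (XYt I).
  by apply: (phomX G_max); apply: (phomN G_max); apply: (phom1 G_max).
have tu (I : multiindex V k) : t I = u (val I) by apply: (phom_inj G_max (XYt I)).
have [|[A [B [a [b tE]]]]|[A [Z [c [[f Af] tE]]]]] := degeneration G_max uE.
- apply: contrapT => /forallNP u0; case/eqP: (is_pt_neq0 qt); apply/ffunP => I.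
  by rewrite tu ffunE; have /negP/negbNE/eqP := u0 (val I).
- have {tE} tE : t = a *: wedge (row_vectors A) + b *: wedge (row_vectors B).
    apply/ffunP => I; rewrite tu tE -!wedge_row_vectors; apply/esym.
    by rewrite ffunE; congr (_ + _); rewrite ffunE.
  pose i0 : 'I_k := Ordinal k_gt0; left.
  move: tE; rewrite !(wedge_scale i0).
  set x := replace _ _ _; set y := replace _ _ _ => tE.
  have [x0|x0] := eqVneq (wedge x) 0.
    have qy : is_pt q (wedge y) by rewrite -[wedge y]add0r -x0 -tE.
    by exists q, q; split; [exists y|exists y|rewrite addvv subvv].
  have [y0|y0] := eqVneq (wedge y) 0.
    have qx : is_pt q (wedge x) by rewrite -[wedge x]addr0 -y0 -tE.
    by exists q, q; split; [exists x|exists x|rewrite addvv subvv].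
  have [p1 px] := is_pt_exists x0; have [p2 py] := is_pt_exists y0.
  exists p1, p2; split; [by exists x|by exists y|].
  by rewrite qt px py -memvE tE memv_add ?memv_line.
right; have A0 := minor_wedge_neq0 Af; have [p pA] := is_pt_exists A0.
exists p; first by exists (row_vectors A).
apply: (tangent_pt pA _ qt).
have -> : t = c *: wedge (row_vectors A) +
    \sum_i wedge (replace (row_vectors A) i (row_vectors Z i)).
  apply/ffunP => I; rewrite tu tE ffunE sum_ffunE; congr (_ + _).
    by rewrite ffunE -wedge_row_vectors.
  by apply: eq_bigr => i _; rewrite -row_vectors_set_row wedge_row_vectors.
apply: affine_tangentD.
  rewrite (wedge_scale (Ordinal k_gt0)); apply: (@affine_tangent_gen _ _ _ _ _ (Ordinal k_gt0)) => j ji.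
  by rewrite replace_ne ?mem_spanv.
elim/big_ind: _ => [||i _].
- by exists [::]; rewrite // span_nil mem0v.
- by move=> ? ?; apply: affine_tangentD.
by apply: (@affine_tangent_gen _ _ _ _ _ i) => j ji; rewrite replace_ne ?mem_spanv.
Qed.

End SecantClosure.

(** * The two lists of orbits *)

Section OrbitList.
Variables (K : closedFieldType) (V : vectType K) (k : nat).
Hypothesis char0 : [pchar K] =i pred0.
Hypothesis k_ge3 : (3 <= k)%N.
Hypothesis k_le : (k.*2 <= \dim {:V})%N.

Let k_gt1 : (1 < k)%N. Proof. exact: ltnW. Qed.
Let k_gt0 : (0 < k)%N. Proof. exact: ltnW. Qed.
Let V_gt0 : (0 < \dim {:V})%N. Proof. by rewrite (leq_trans _ k_le) // double_gt0. Qed.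
Let k_lt : (k < \dim {:V})%N.
Proof. by rewrite (leq_trans _ k_le) // -addnn -addn1 leq_add2l. Qed.

Local Notation e := (vbasis {:V}).

Lemma SL_orbit_refl (p : proj (extpow V k)) : SL_orbit p p.
Proof.
have [t pt] := is_pt_ex p; exists (\1)%VF, t; split=> //.
  by rewrite /in_SL passmx.mxof1 ?det1 ?(basis_free (vbasisP _)).
suff -> : extpow_map \1%VF t = t by [].
apply/ffunP => J; rewrite sum_ffunE (bigD1 J) //= big1 ?addr0 => [|I IJ].
  rewrite ffunE (_ : (fun _ => _) = fun i => e`_(val J i)) ?wedge_basis ?eqxx.
    exact: mulr1.
  by apply: funext => i; rewrite id_lfunE.
rewrite ffunE (_ : (fun _ => _) = fun i => e`_(val I i)) ?wedge_basis ?(negPf IJ).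
  exact: mulr0.
by apply: funext => i; rewrite id_lfunE.
Qed.

Lemma indep_ex m : (m <= \dim {:V})%N -> exists b : nat -> V, indep m b.
Proof.
have [|b [b_free _]] := @indep_extend K V 0 (fun=> 0); first exact: nil_free.
by move=> mn; exists b; apply: indepW b_free.
Qed.

Lemma Gr_orbit (p : proj (extpow V k)) : Gr V k p -> SL_orbit p = Gr V k.
Proof.
move=> [v pv]; have [b /(indepW (ltnW k_lt)) b_free vb] := wedge_nat_ex (is_pt_neq0 pv).
rewrite vb in pv; rewrite (@SL_orbit_NF K V k V_gt0 k (wedge_nat k) _ _ p b) //.
- apply/seteqP; split=> [q [c _ qc]|q [x qx]]; first by exists (fun i : 'I_k => c i).
  have [c /(indepW (ltnW k_lt)) c_free xc] := wedge_nat_ex (is_pt_neq0 qx).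
  by exists c; rewrite // -xc.
- by move=> g c; apply: extpow_map_wedge.
- by move=> c c' cc; congr wedge; apply: funext => i; apply: cc.
Qed.

Lemma not_decomposable_neq0 (t : extpow V k) : ~ decomposable t -> t != 0.
Proof.
move=> t_dec; apply/eqP => t0; apply: t_dec; rewrite t0.
exists (fun=> 0); symmetry; apply/eqP; rewrite wedge_eq0.
by rewrite /spanv big1 ?dimv0 // => i _; apply/eqP; rewrite -dimv_eq0 dim_vline eqxx.
Qed.

Lemma NS_orbit l p b : (0 < l <= k)%N -> indep (k + l) b -> is_pt p (NS k l b) ->
  SL_orbit p = Sigma V k l.
Proof.
move=> lk b_free pb; rewrite (SigmaE V k_gt0 lk).
exact: (SL_orbit_NF V_gt0 (NS_map k l) (@NS_local K V k l) b_free pb).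
Qed.

Lemma NT_orbit l p b : (0 < l <= k)%N -> indep (k + l) b -> is_pt p (NT k l b) ->
  SL_orbit p = Theta V k l.
Proof.
move=> lk b_free pb; rewrite (ThetaE V k_gt0 lk).
exact: (SL_orbit_NF V_gt0 (NT_map k l) (@NT_local K V k l) b_free pb).
Qed.

(** An orbit is recovered from any of its points, so the case analyses of secant and tangent points
    list all candidates. Non-decomposability separates the orbits found from [Gr]. *)
Lemma identifiable_orbits (O : set (proj (extpow V k))) :
  [/\ is_SL_orbit O, O `<=` sigma2 (Gr V k), O <> Gr V k & identifiable_orbit O]
  <-> exists2 l : nat, (3 <= l <= k)%N & O = Sigma V k l.
Proof.
split=> [[[p ->] O_sigma O_Gr O_id]|[l lk ->]].
  have pO := SL_orbit_refl p.
  have NT_no l b : (1 < l <= k)%N -> indep (k + l) b -> is_pt p (NT k l b) -> False.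
    move=> lk b_free pb.
    exact: (NT_not_identifiable char0 lk b_free pb (O_id _ pO)).
  have [[p1 [p2 [p1Gr p2Gr pp]]]|p_tau] := sigma2_cases char0 k_gt1 (O_sigma _ pO).
    have [/Gr_orbit //|[b b_free pb]|[l [b [lk b_free pb]]]] :=
        secant_cases k_gt1 p1Gr p2Gr pp.
      by case: (NT_no 2%N b).
    have l_gt0 : (0 < l <= k)%N by case/andP: lk => l3 ->; rewrite (leq_trans _ l3).
    by exists l; rewrite // (NS_orbit l_gt0 b_free pb).
  have [/Gr_orbit //|[l [b [lk b_free pb]]]] := tau_cases k_gt0 p_tau.
  by case: (NT_no l b).
have /andP[l3 lk'] := lk; have l_gt0 : (0 < l <= k)%N by rewrite lk' (leq_trans _ l3).
have l_gt1 : (1 < l <= k)%N by rewrite lk' (leq_trans _ l3).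
have [b b_free] : exists b : nat -> V, indep (k + l) b.
  by apply: indep_ex; rewrite (leq_trans _ k_le) // -addnn leq_add2l.
have b_dec := NS_not_decomposable k_gt0 l_gt1 b_free.
have [p pb] := is_pt_exists (not_decomposable_neq0 b_dec).
rewrite -(NS_orbit l_gt0 b_free pb); split; first by exists p.
- rewrite (NS_orbit l_gt0 b_free pb) => q [x [y [p1 [p2 [px py _ qt]]]]].
  move=> d F _ F0; apply: F0; exists p1, p2; split; [by exists x|by exists y|].
  by rewrite qt px py -memvE memv_add ?memv_line.
- move=> OGr; have := SL_orbit_refl p; rewrite OGr => /(Gr_decomposable k_gt0 pb).
  exact: b_dec.
- rewrite (NS_orbit l_gt0 b_free pb) (SigmaE V k_gt0 l_gt0) => q [c c_free qc].
  exact: (NS_identifiable k_gt0 lk c_free qc).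
Qed.

Lemma tangential_orbits (O : set (proj (extpow V k))) :
  [/\ is_SL_orbit O, O `<=` tau V k & tangential_identifiable_orbit O]
  <-> exists2 l : nat, (3 <= l <= k)%N & O = Theta V k l.
Proof.
split=> [[[p ->] O_tau O_id]|[l lk ->]].
  have pO := SL_orbit_refl p; have p_id := O_id _ pO.
  have [/Gr_not_tangential_identifiable H|[l [b [lk b_free pb]]]] :=
      tau_cases k_gt0 (O_tau _ pO); first by case: (H k_gt0 k_lt).
  have l_gt0 : (0 < l <= k)%N by case/andP: lk => l2 ->; rewrite ltnW.
  exists l; last exact: (NT_orbit l_gt0 b_free pb).
  have /andP[l2 ->] := lk; rewrite andbT ltn_neqAle l2 andbT.
  apply/eqP => l2E; rewrite -l2E in b_free pb.
  exact: (NT2_not_tangential_identifiable k_gt0 k_gt1 b_free pb p_id).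
have /andP[l3 lk'] := lk; have l_gt0 : (0 < l <= k)%N by rewrite lk' (leq_trans _ l3).
have [b b_free] : exists b : nat -> V, indep (k + l) b.
  by apply: indep_ex; rewrite (leq_trans _ k_le) // -addnn leq_add2l.
have [phi [tE rk]] := NT_tangent lk' b_free.
have b0 : wedge (fun i : 'I_k => b i) != 0.
  by rewrite wedge_nat_neq0 (indepW _ b_free) ?leq_addr.
have b_dec : ~ decomposable (NT k l b).
  by rewrite tE; apply: tangent_vec_not_decomposable; rewrite // rk (leq_trans _ l3).
have [p pb] := is_pt_exists (not_decomposable_neq0 b_dec).
split; first by exists p; rewrite (NT_orbit l_gt0 b_free pb).
- by move=> q [].
- rewrite (ThetaE V k_gt0 l_gt0) => q [c c_free qc].
  exact: (NT_tangential_identifiable k_gt0 lk c_free qc).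
Qed.

End OrbitList.

Theorem mainTheorem2 (K : closedFieldType) (V : vectType K) (k : nat)
    (char0 : [pchar K] =i pred0) (k_ge3 : (3 <= k)%N)
    (k_le : (k.*2 <= \dim {:V})%N) :
  (forall O : set (proj (extpow V k)),
     [/\ is_SL_orbit O, O `<=` sigma2 (Gr V k), O <> Gr V k &
         identifiable_orbit O]
     <-> exists2 l : nat, (3 <= l <= k)%N & O = Sigma V k l)
  /\
  (forall O : set (proj (extpow V k)),
     [/\ is_SL_orbit O, O `<=` tau V k & tangential_identifiable_orbit O]
     <-> exists2 l : nat, (3 <= l <= k)%N & O = Theta V k l).
Proof.
by split=> O; [exact: identifiable_orbits|exact: tangential_orbits].
Qed.
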